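(* Let $p$ be a positive even integer. The following facts hold. 1. Let $u\in U_p(\mathcal{H})$ and $x\in\mathcal{B}_p(\mathcal{H})_{ah}$ with $\|x\|\le\pi$. Then the curve $\mu(t)=ue^{tx}$, $t\in[0,1]$, has minimal length: $L_p(\mu)\le L_p(\gamma)$ for every piecewise smooth curve $\gamma$ in $U_p(\mathcal{H})$ joining the same endpoints. Moreover, if $\|x\|<\pi$, $\mu$ is unique with this property (up to reparametrization). 2. Let $u_0,u_1\in U_p(\mathcal{H})$. Then there exists a minimal geodesic curve joining them. If $\|u_0-u_1\|<2$, this geodesic is unique. 3. There are in $U_p(\mathcal{H})$ minimal geodesics of arbitrary length. Thus the diameter of $U_p(\mathcal{H})$ is infinite. 4. If $u,v\in U_p(\mathcal{H})$ then $$\sqrt{1-\frac{\pi^2}{12}}\; d_p(u,v)\le\|u-v\|_p\le d_p(u,v).$$ In particular the metric space $(U_p(\mathcal{H}),d_p)$ is complete.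
   Context: $\mathcal{H}$ is an infinite dimensional (complex) Hilbert space, $\|\cdot\|$ is the operator norm on $\mathcal{B}(\mathcal{H})$, $p$ is a positive even integer, $\mathcal{B}_p(\mathcal{H})=\{a\in\mathcal{B}(\mathcal{H}):Tr((a^*a)^{p/2})<\infty\}$ with norm $\|a\|_p=Tr((a^*a)^{p/2})^{1/p}$, and $\mathcal{B}_p(\mathcal{H})_{ah}=\{a\in\mathcal{B}_p(\mathcal{H}):a^*=-a\}$. $U_p(\mathcal{H})=\{u\text{ unitary}:u-1\in\mathcal{B}_p(\mathcal{H})\}$ is a Banach-Lie group with the topology given by $\|u-v\|_p$ and Lie algebra $\mathcal{B}_p(\mathcal{H})_{ah}$. For a piecewise smooth curve $\alpha:[t_0,t_1]\to U_p(\mathcal{H})$, $L_p(\alpha)=\int_{t_0}^{t_1}\|\dot\alpha(t)\|_p\,dt$, and $d_p(u_1,u_2)$ is the infimum of $L_p(\gamma)$ over piecewise smooth curves $\gamma\subset U_p(\mathcal{H})$ joining $u_1$ and $u_2$. A geodesic in $U_p(\mathcal{H})$ is a curve of the form $t\mapsto ue^{tx}$ with $u\in U_p(\mathcal{H})$, $x\in\mathcal{B}_p(\mathcal{H})_{ah}$ (parametrized on $[0,1]$ when it joins two points); it is minimal if its length is the distance $d_p$ between its endpoints. A curve $\gamma$ on $[0,1]$ is a reparametrization of $\mu$ if $\gamma=\mu\circ\varphi$ for some continuous nondecreasing surjection $\varphi:[0,1]\to[0,1]$. *)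

(* Defs.v *)
From HB Require Import structures.
From mathcomp Require Import all_boot all_order all_algebra.
From mathcomp Require Import all_classical all_reals all_analysis.
From mathcomp Require Import complex.

Set Implicit Arguments.
Unset Strict Implicit.
Unset Printing Implicit Defensive.

Import Order.TTheory GRing.Theory Num.Theory.
Import numFieldNormedType.Exports.

Local Open Scope classical_set_scope.
Local Open Scope ring_scope.
Local Open Scope complex_scope.

(* A complex Hilbert space is a complete normed space [H] over [R[i]] with a
   positive definite Hermitian form [ip] (linear in its first argument) such
   that [ip x x = `|x| ^+ 2].  Norms of vectors are values in [R[i]].  Operators
   are functions [H -> H], with the pointwise vector space structure, [idfun] as
   unit and [\o] as product. *)

Definition infinite_dimensional (R : realType) (H : lmodType R[i]) : Prop :=
  ~ exists (n : nat) (e : 'I_n -> H),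
      forall v : H, exists c : 'I_n -> R[i], v = \sum_(i < n) c i *: e i.

Section HilbertBasis.
Context (R : realType) (H : lmodType R[i]) (ip : {dot H for Num.conj}).

Definition orthonormal_set (B : set H) : Prop :=
  forall e f, B e -> B f -> ip e f = (e == f)%:R.

Definition orthonormal_basis (B : set H) : Prop :=
  orthonormal_set B /\ forall v, (forall e, B e -> ip v e = 0) -> v = 0.

Lemma orthonormal_basis_exists : exists B, orthonormal_basis B.
Proof.
have [F FP Ftot|B [oB maxB]] := @Zorn_bigcup H orthonormal_set.
  move=> e f [X FX Xe] [Y FY Yf].
  have [XY|YX] := Ftot _ _ FX FY.
    by apply: (FP Y FY) => //; exact: XY.
  by apply: (FP X FX) => //; exact: YX.
exists B; split => // v vB; apply: contrapT => /eqP v0.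
have vv_gt0 : 0 < ip v v by exact: neq0_dnorm_gt0.
pose c := (sqrtC (ip v v))^-1; pose w := c *: v.
have cge0 : 0 <= c by rewrite invr_ge0 sqrtC_ge0 ltW.
have wB e : B e -> ip w e = 0.
  by move=> /vB ve; rewrite /w linearZl_LR /= ve mulr0.
have Bw e : B e -> ip e w = 0.
  move=> /wB we; transitivity ((-1) ^+ false * Num.conj (ip w e)).
    exact: hermitian_subproof.
  by rewrite we conjC0 mulr0.
have ww : ip w w = 1.
  rewrite /w linearZl_LR /= linearZr_LR /= (CrealP (ger0_real cge0)).
  rewrite mulrA -expr2 exprVn sqrtCK mulVf// gt_eqF//.
apply: (maxB (B `|` [set w]) _).
  split; first by left.
  move=> BwB; have /wB : B w by apply: BwB; right.
  by rewrite ww => /eqP; rewrite oner_eq0.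
move=> e f [Be|->] [Bf|->].
- exact: oB.
- rewrite Bw//; case: eqP => // ew; move: (Bw _ Be).
  by rewrite ew ww => /eqP; rewrite oner_eq0.
- rewrite wB//; case: eqP => // ew; move: (wB _ Bf).
  by rewrite -ew ww => /eqP; rewrite oner_eq0.
- by rewrite ww eqxx.
Qed.

Definition hbasis : set H := projT1 (cid orthonormal_basis_exists).

End HilbertBasis.

Section Operators.
Context (R : realType) (H : completeNormedModType R[i]).
Context (ip : {dot H for Num.conj}).
Implicit Types a b u x : H -> H.

Definition opnorm a : \bar R :=
  ereal_sup [set (complex.Re `|a v|)%:E | v in [set v : H | `|v| <= 1]].

Definition bounded_op a : Prop := linear a /\ (opnorm a < +oo)%E.

Definition adjoint a : H -> H :=
  get [set b | bounded_op b /\ forall v w, ip (a v) w = ip v (b w)].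

(* The trace of a positive operator; [esum] is a supremum of finite sums, hence
   the sum only for nonnegative terms. *)
Definition trace a : \bar R :=
  \esum_(e in hbasis ip) (complex.Re (ip (a e) e))%:E.

(* [Tr ((a^* a)^(p/2))], for even [p]. *)
Definition schatten_trace (p : nat) a : \bar R :=
  trace (iter p./2 (adjoint a \o a)).

Definition schatten (p : nat) : set (H -> H) :=
  [set a | bounded_op a /\ (schatten_trace p a < +oo)%E].

Definition schatten_ah (p : nat) : set (H -> H) :=
  [set a | schatten p a /\ adjoint a = - a].

Definition pnorm (p : nat) a : \bar R := poweR (schatten_trace p a) p%:R^-1.

Definition unitary u : Prop :=
  [/\ bounded_op u, adjoint u \o u = idfun & u \o adjoint u = idfun].

Definition Up (p : nat) : set (H -> H) :=
  [set u | unitary u /\ schatten p (u - idfun)].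

(* The sum of the exponential series in the operator norm. *)
Definition opexp x : H -> H :=
  get [set e | bounded_op e /\
    opnorm ((\sum_(k < n) (k`!%:R^-1 : R[i]) *: iter k x) - e)
      @[n --> \oo] --> (0 : \bar R)].

(* [d] is the derivative at [t], relative to the set [I] and in the norm
   [pnorm p], of the curve [g]. *)
Definition is_pderiv (p : nat) (I : set R) (g : R -> H -> H) (t : R)
    (d : H -> H) : Prop :=
  schatten p d /\
  pnorm p ((s - t)^-1%:C *: (g s - g t) - d) @[s --> within I t^']
    --> (0 : \bar R).

(* Infinitely differentiable on the closed interval, one-sided at its end points: [D n] is the
   [n]-th derivative. *)
Definition psmooth (p : nat) (t0 t1 : R) (g : R -> H -> H) : Prop :=
  exists D : nat -> R -> H -> H, D 0%N = g /\
    forall n t, t \in `[t0, t1] -> is_pderiv p `[t0, t1] (D n) t (D n.+1 t).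

Definition Up_curve (p : nat) (t0 t1 : R) (g : R -> H -> H) : Prop :=
  [/\ t0 < t1,
      forall t, t \in `[t0, t1] -> Up p (g t) &
      exists s : seq R, itv_partition t0 t1 s /\
        forall i, (i < size s)%N ->
          psmooth p (nth t1 (t0 :: s) i) (nth t1 s i) g].

Definition joins (p : nat) (u v : H -> H) (t0 t1 : R) (g : R -> H -> H) : Prop :=
  [/\ Up_curve p t0 t1 g, g t0 = u & g t1 = v].

(* Arbitrary at the finitely many points where the derivative does not exist. *)
Definition velocity (p : nat) (t0 t1 : R) (g : R -> H -> H) (t : R) : H -> H :=
  get [set d | is_pderiv p `[t0, t1] g t d].

Definition plength (p : nat) (t0 t1 : R) (g : R -> H -> H) : \bar R :=
  (\int[lebesgue_measure]_(t in `[t0, t1]) pnorm p (velocity p t0 t1 g t))%E.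

Definition pdist (p : nat) (u v : H -> H) : \bar R :=
  ereal_inf [set l | exists t0 t1 g,
    joins p u v t0 t1 g /\ l = plength p t0 t1 g].

Definition shortest_curve (p : nat) (m : R -> H -> H) : Prop :=
  Up_curve p 0 1 m /\
  forall t0 t1 g, joins p (m 0) (m 1) t0 t1 g ->
    (plength p 0 1 m <= plength p t0 t1 g)%E.

Definition reparametrization (g m : R -> H -> H) : Prop :=
  exists phi : R -> R,
    [/\ {within `[0, 1], continuous phi},
        forall s t, s \in `[0, 1] -> t \in `[0, 1] -> s <= t -> phi s <= phi t,
        phi @` `[0, 1]%classic = `[0, 1]%classic &
        forall t, t \in `[0, 1] -> g t = m (phi t)].

Definition geodesic_curve u x (t : R) : H -> H := u \o opexp (t%:C *: x).

Definition geodesic (p : nat) (g : R -> H -> H) : Prop :=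
  exists u x, [/\ Up p u, schatten_ah p x & g = geodesic_curve u x].

Definition minimal_geodesic (p : nat) (g : R -> H -> H) : Prop :=
  geodesic p g /\ plength p 0 1 g = pdist p (g 0) (g 1).

End Operators.

Definition metric_on (R : realType) (T : Type) (S : set T) (d : T -> T -> \bar R)
    : Prop :=
  [/\ forall a b, S a -> S b -> (0 <= d a b < +oo)%E,
      forall a b, S a -> S b -> (d a b = 0%E <-> a = b),
      forall a b, S a -> S b -> d a b = d b a &
      forall a b c, S a -> S b -> S c -> (d a c <= d a b + d b c)%E].

Definition complete_on (R : realType) (T : Type) (S : set T)
    (d : T -> T -> \bar R) : Prop :=
  forall f : nat -> T, (forall n, S (f n)) ->
    (forall e : R, 0 < e -> exists N, forall m n, (N <= m)%N -> (N <= n)%N ->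
      (d (f m) (f n) < e%:E)%E) ->
    exists2 l, S l & d (f n) l @[n --> \oo] --> (0 : \bar R).

(* Main.v *)
Require Import Defs.
From HB Require Import structures.
From mathcomp Require Import all_boot all_order all_algebra.
From mathcomp Require Import all_classical all_reals all_analysis measurable_realfun.
From mathcomp Require Import complex zify ring lra.

(** The main point is that geodesics can be compared with arbitrary curves one
    vector at a time.  If [g] is a curve of unitaries and [e] a unit vector,
    then [g t e] runs on the unit sphere, whose angular distance is [ang].  A
    curve in [U_p] of length [L] satisfies
    [\sum_(e <- F) ang (g 0 e) (g 1 e) ^ p <= L ^ p] for every orthonormal
    family [F], by Hölder's inequality and [\sum_(e <- F) |a e| ^ p <= |a|_p ^ p].
    Along [u e^{tx}] with [|x| <= pi] an eigenvector [e] of [x] with eigenvalue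
    [i t_e] moves through the angle [|t_e|], and [\sum_e |t_e| ^ p = |x|_p ^ p],
    so [|x|_p <= L].  Hence [d_p (u, v)] is the least [D] with
    [\sum_(e <- F) ang (u e) (v e) ^ p <= D ^ p] for all [F], which gives the
    metric axioms without concatenating curves.  For a shortest curve the strict
    convexity of [r ^ p] forces each [g t e] onto the great arc from [u e] to
    [u e^x e].  Bounds between [d_p] and [|u - v|_p] come from diagonalizing
    [u^* v].  The norm properties of [|.|_p] are immediate once [|a|_p <= A] is
    known to mean that [a] is compact and [\sum_(e <- F) |a e| ^ p <= A ^ p] for
    every orthonormal family [F]. *)

Set Implicit Arguments.
Unset Strict Implicit.
Unset Printing Implicit Defensive.

Import Order.TTheory GRing.Theory Num.Theory.
Import numFieldNormedType.Exports ComplexField.Normc.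

Local Open Scope classical_set_scope.
Local Open Scope ring_scope.
Local Open Scope complex_scope.


(** Working vector by vector avoids differentiating [|.|_p]; the only spectral input is the
    existence of orthonormal eigenbases. Hölder's inequality enters linearly: for two points of a
    curve the weights [ang ^ (p - 1)] are frozen, and the weighted sum of angles is Lipschitz along
    the curve. So only first-order comparisons are required, of angle with chord and of chord with
    arc length. The evenness of [p] turns the trace of the power [p / 2] of [adj a \o a] into a
    Hilbert-Schmidt sum for an alternating product of [a] and [adj a], without square roots of
    operators. The constant [1 - pi^2/12] comes from [|e^{it} - 1|^2 = 2 - 2 cos t >= t^2 - t^4/12].
    The bound [pi] on eigenvalues is strict for uniqueness, for two reasons: great arcs shorter than
    [pi] are determined by their end points, and [t |-> e^{it}] is injective on [(-pi, pi)]. *)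

Notation Re := complex.Re.
Notation Im := complex.Im.

Section HilbertSpace.
Context (R : realType) (H : completeNormedModType R[i]).
Context (ip : {dot H for Num.conj}).
Hypothesis ip_norm : forall v : H, ip v v = `|v| ^+ 2.
Notation adj := (adjoint ip).
Notation unitary := (unitary ip).
Notation mu := (@lebesgue_measure R).

(** * Real part, imaginary part and modulus of complex numbers *)

Section ComplexNumbers.
Implicit Types (z w : R[i]).

Lemma normcE z : `|z| = (normc z)%:C.
Proof. by case: z => a b; rewrite normc_def. Qed.

Lemma normc2 z : normc z ^+ 2 = Re z ^+ 2 + Im z ^+ 2.
Proof. by case: z => a b /=; rewrite sqr_sqrtr// addr_ge0 ?sqr_ge0. Qed.

Lemma normc_ge0 z : 0 <= normc z.
Proof. by case: z => a b /=; rewrite sqrtr_ge0. Qed.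

Lemma normcR (r : R) : normc r%:C = `|r|.
Proof. by rewrite /= expr0n addr0 sqrtr_sqr. Qed.

Lemma ReM z w : Re (z * w) = Re z * Re w - Im z * Im w.
Proof. by case: z => a b; case: w. Qed.

Lemma ImM z w : Im (z * w) = Re z * Im w + Im z * Re w.
Proof. by case: z => a b; case: w. Qed.

Lemma ReD z w : Re (z + w) = Re z + Re w.
Proof. by case: z => a b; case: w. Qed.

Lemma ImD z w : Im (z + w) = Im z + Im w.
Proof. by case: z => a b; case: w. Qed.

Lemma ReN z : Re (- z) = - Re z.
Proof. by case: z. Qed.

Lemma ImN z : Im (- z) = - Im z.
Proof. by case: z. Qed.

Lemma Re_conj z : Re (Num.conj z) = Re z.
Proof. by case: z. Qed.

Lemma Im_conj z : Im (Num.conj z) = - Im z.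
Proof. by case: z. Qed.

Lemma normc_conj z : normc (Num.conj z) = normc z.
Proof. by case: z => a b /=; rewrite sqrrN. Qed.

Lemma complex_eqP z w : Re z = Re w -> Im z = Im w -> z = w.
Proof. by case: z => a b; case: w => c d /= -> ->. Qed.

Lemma conjcM z : z * Num.conj z = (normc z ^+ 2)%:C.
Proof.
apply: complex_eqP; rewrite ?ReM ?ImM Re_conj Im_conj normc2 /=; ring.
Qed.

Lemma Re_le_normc z : `|Re z| <= normc z.
Proof.
rewrite -(@ler_pXn2r _ 2) ?nnegrE ?normr_ge0 ?normc_ge0// normc2.
by rewrite real_normK ?num_real// lerDl sqr_ge0.
Qed.

Lemma normc_eq0 z : (normc z == 0) = (z == 0).
Proof. by apply/eqP/eqP => [/eq0_normc//|->]; rewrite normc0. Qed.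

Lemma ltc0R z : 0 < z -> z = (Re z)%:C /\ 0 < Re z.
Proof.
move=> z0; have := z0; rewrite ltcE /= => /andP[/eqP iz rz].
by split => //; apply: complex_eqP.
Qed.

End ComplexNumbers.

(** * The real-valued norm and convergence of sequences *)

Section Hilbert.
Implicit Types (v w : H).

(** The norm of [H] takes values in [R[i]]; its real part brings every estimate into the ordered
    field [R]. *)
Definition nr v : R := Re `|v|.

Lemma nrE v : `|v| = (nr v)%:C.
Proof. by rewrite /nr RRe_real// ger0_real. Qed.

Lemma nr_ge0 v : 0 <= nr v.
Proof. by rewrite -ler0c -nrE. Qed.

Lemma nr0 : nr 0 = 0.
Proof. by rewrite /nr normr0. Qed.

Lemma nr_eq0 v : (nr v == 0) = (v == 0).
Proof.
by rewrite -(@normr_eq0 _ _ v) nrE -(inj_eq (@complexI _)).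
Qed.

Lemma nr_gt0 v : (0 < nr v) = (v != 0).
Proof. by rewrite lt_def nr_ge0 andbT nr_eq0. Qed.

Lemma nrN v : nr (- v) = nr v.
Proof. by rewrite /nr normrN. Qed.

Lemma nrD v w : nr (v + w) <= nr v + nr w.
Proof. by rewrite -lecR rmorphD /= -!nrE ler_normD. Qed.

Lemma nrBC v w : nr (v - w) = nr (w - v).
Proof. by rewrite -nrN opprB. Qed.

Lemma nrZ c v : nr (c *: v) = normc c * nr v.
Proof. by apply: complexI; rewrite -nrE normrZ normcE nrE rmorphM. Qed.

Lemma nr_triangle v w x : nr (v - x) <= nr (v - w) + nr (w - x).
Proof. by have := nrD (v - w) (w - x); rewrite addrA subrK. Qed.

Lemma nr_sum I (s : seq I) (P : pred I) (f : I -> H) :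
  nr (\sum_(i <- s | P i) f i) <= \sum_(i <- s | P i) nr (f i).
Proof.
elim/big_ind2 : _ => [|x a y b xa yb|//]; first by rewrite nr0.
by rewrite (le_trans (nrD _ _))// lerD.
Qed.

Definition seqlim (u : nat -> H) l :=
  forall e : R, 0 < e -> exists N, forall n, (N <= n)%N -> nr (u n - l) < e.

Definition seqcauchy (u : nat -> H) :=
  forall e : R, 0 < e -> exists N, forall m n, (N <= m)%N -> (N <= n)%N ->
    nr (u m - u n) < e.

Lemma seqcauchy_lim u : seqcauchy u -> exists l, seqlim u l.
Proof.
move=> uc.
have : cauchy (u @ \oo).
  apply: cauchy_exP => e /ltc0R[eE e0].
  have [N NP] := uc _ e0.
  exists (u N); exists N => // n /= Nn.
  rewrite -ball_normE /ball_ /=.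
  by rewrite eE nrE ltcR NP.
move=> /cauchy_cvg /cvg_ex[l /cvgrPdist_lt ul]; exists l => e e0.
have e0' : 0 < e%:C :> R[i] by rewrite ltcR.
have [N _ NP] := ul _ e0'.
by exists N => n Nn; have := NP n Nn; rewrite /= nrE ltcR nrBC.
Qed.

Lemma seqlim_unique u l l' : seqlim u l -> seqlim u l' -> l = l'.
Proof.
move=> ul ul'; apply/eqP; rewrite -subr_eq0 -nr_eq0; apply: contraT => n0.
have e0 : 0 < nr (l - l') / 2 by rewrite divr_gt0// lt_def n0 nr_ge0.
have [N NP] := ul _ e0; have [N' NP'] := ul' _ e0.
have := NP (maxn N N') (leq_maxl _ _); have := NP' (maxn N N') (leq_maxr _ _).
have := nr_triangle l (u (maxn N N')) l'; rewrite (nrBC l (u _)).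
by move=> *; exfalso; lra.
Qed.

End Hilbert.

(** * Finite sums and tails of bounded families *)

Lemma inv_small (e : R) : 0 < e ->
  exists N, forall n, (N <= n)%N -> n.+1%:R^-1 < e.
Proof.
by move=> e0; have [N _ NP] := near_infty_natSinv_lt (PosNum e0); exists N.
Qed.

Lemma big_subseq (V : nmodType) (T : eqType) (f : T -> V) (F F' : seq T) :
  uniq F -> uniq F' -> {subset F <= F'} ->
  \sum_(x <- F') f x = \sum_(x <- F) f x + \sum_(x <- F' | x \notin F) f x.
Proof.
move=> uF uF' sub; rewrite (bigID (mem F)) /=; congr (_ + _).
rewrite -big_filter; apply: perm_big; apply: uniq_perm => //.
  exact: filter_uniq.
move=> x; rewrite mem_filter; apply/andP/idP => [[]//|xF].
by split => //; exact: sub.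
Qed.

Lemma ler_sum_in (T : eqType) (F : seq T) (f g : T -> R) :
  {in F, forall x, f x <= g x} -> \sum_(x <- F) f x <= \sum_(x <- F) g x.
Proof. by move=> fg; rewrite big_seq [leRHS]big_seq; exact: ler_sum. Qed.

(** A family [F] whose sum is within [e] of the supremum of all finite sums leaves at most [e] to
    any family disjoint from it. Possibly uncountable index sets are thus handled without series. *)
Lemma fin_tail (T : eqType) (S : set T) (f : T -> R) (K : R) :
  (forall x, 0 <= f x) ->
  (forall F, uniq F -> {in F, forall x, S x} -> \sum_(x <- F) f x <= K) ->
  forall e, 0 < e -> exists F, [/\ uniq F, {in F, forall x, S x} &
    forall G, uniq G -> {in G, forall x, S x} -> {in G, forall x, x \notin F} ->
      \sum_(x <- G) f x <= e].
Proof.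
move=> f0 fK e e0.
pose A : set R := [set r | exists F, [/\ uniq F, {in F, forall x, S x} &
  r = \sum_(x <- F) f x]].
have supA : has_sup A.
  split; first by exists 0, [::]; split => //; rewrite big_nil.
  by exists K => r [F [uF SF ->]]; exact: fK.
have [r [F [uF SF ->]] rF] := sup_adherent e0 supA.
exists F; split => // G uG SG GF.
have : \sum_(x <- F ++ G) f x <= sup A.
  apply: ub_le_sup; first by case: supA.
  exists (F ++ G); split => //.
    rewrite cat_uniq uF uG andbT; apply/hasPn => x xG.
    exact: GF.
  by move=> x; rewrite mem_cat => /orP[/SF|/SG].
rewrite big_cat /= => ?; lra.
Qed.

(** * Inner product, finite orthonormal families, Riesz-Fischer *)

Section InnerProduct.
Implicit Types (v w x : H).

Lemma ipDl u v w : ip (u + v) w = ip u w + ip v w.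
Proof. by rewrite linearDl. Qed.
Lemma ipDr u v w : ip u (v + w) = ip u v + ip u w.
Proof. by rewrite linearDr. Qed.
Lemma ipNl v w : ip (- v) w = - ip v w.
Proof. by rewrite linearNl. Qed.
Lemma ipNr v w : ip v (- w) = - ip v w.
Proof. by rewrite linearNr. Qed.
Lemma ipBl u v w : ip (u - v) w = ip u w - ip v w.
Proof. by rewrite ipDl ipNl. Qed.
Lemma ipBr u v w : ip u (v - w) = ip u v - ip u w.
Proof. by rewrite ipDr ipNr. Qed.
Lemma ipZl c v w : ip (c *: v) w = c * ip v w.
Proof. by rewrite linearZl_LR. Qed.
Lemma ipZr c v w : ip v (c *: w) = Num.conj c * ip v w.
Proof. by rewrite linearZr_LR. Qed.
Lemma ip0l v : ip 0 v = 0.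
Proof. by rewrite linear0l. Qed.
Lemma ip0r v : ip v 0 = 0.
Proof. by rewrite linear0r. Qed.
Lemma ip_suml I (s : seq I) (P : pred I) (f : I -> H) v :
  ip (\sum_(i <- s | P i) f i) v = \sum_(i <- s | P i) ip (f i) v.
Proof. by rewrite linear_sumlz. Qed.
Lemma ip_sumr I (s : seq I) (P : pred I) (f : I -> H) v :
  ip v (\sum_(i <- s | P i) f i) = \sum_(i <- s | P i) ip v (f i).
Proof. by rewrite linear_sumr. Qed.

Lemma ipC v w : ip v w = Num.conj (ip w v).
Proof.
transitivity ((-1) ^+ false * Num.conj (ip w v)).
  exact: hermitian_subproof.
by rewrite mul1r.
Qed.

Lemma ipvv v : ip v v = ((nr v) ^+ 2)%:C.
Proof. by rewrite ip_norm nrE rmorphXn. Qed.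

Lemma nr2E v : nr v ^+ 2 = Re (ip v v).
Proof. by rewrite ipvv. Qed.

Lemma ip_eq0C v w : ip v w = 0 -> ip w v = 0.
Proof. by move=> vw; rewrite ipC vw conjC0. Qed.

Lemma ReipC v w : Re (ip v w) = Re (ip w v).
Proof. by rewrite ipC Re_conj. Qed.

Lemma nrD2 v w : nr (v + w) ^+ 2 = nr v ^+ 2 + nr w ^+ 2 + 2 * Re (ip v w).
Proof.
rewrite !nr2E ipDl !ipDr !ReD (ReipC w v); ring.
Qed.

Lemma nrB2 v w : nr (v - w) ^+ 2 = nr v ^+ 2 + nr w ^+ 2 - 2 * Re (ip v w).
Proof. by rewrite nrD2 nrN ipNr ReN; ring. Qed.

Lemma nrD2_orth v w : ip v w = 0 -> nr (v + w) ^+ 2 = nr v ^+ 2 + nr w ^+ 2.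
Proof. by move=> vw; rewrite nrD2 vw /= mulr0 addr0. Qed.

Lemma cauchy_schwarz v w : normc (ip v w) <= nr v * nr w.
Proof.
have [->|w0] := eqVneq w 0; first by rewrite ip0r normc0 nr0 mulr0.
have a0 : 0 < nr w ^+ 2 by rewrite exprn_gt0// nr_gt0.
set z := ip v w.
have := sqr_ge0 (nr ((nr w ^+ 2)%:C *: v - z *: w)).
rewrite nrB2 !nrZ ipZl ipZr -/z normcR (ger0_norm (sqr_ge0 _)).
have -> : Re ((nr w ^+ 2)%:C * (Num.conj z * z)) = nr w ^+ 2 * normc z ^+ 2.
  by rewrite mulrC (mulrC (Num.conj z)) conjcM -rmorphM /= mulrC.
move=> h; have : 0 <= nr w ^+ 2 * (nr v ^+ 2 * nr w ^+ 2 - normc z ^+ 2) by lra.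
rewrite pmulr_rge0// subr_ge0 -exprMn ler_pXn2r// nnegrE ?normc_ge0//.
by rewrite mulr_ge0 ?nr_ge0.
Qed.

Lemma Reip_le v w : Re (ip v w) <= nr v * nr w.
Proof.
by rewrite (le_trans (ler_norm _))// (le_trans (Re_le_normc _))// cauchy_schwarz.
Qed.

Lemma ip_ext v w : (forall x, ip x v = ip x w) -> v = w.
Proof.
move=> vw; apply/eqP; rewrite -subr_eq0 -nr_eq0 -sqrf_eq0 nr2E ipBr vw subrr.
by [].
Qed.

Definition ons (F : seq H) :=
  uniq F /\ {in F &, forall e f, ip e f = (e == f)%:R}.

Lemma ons_of_set B F : orthonormal_set ip B -> uniq F -> {in F, forall e, B e} ->
  ons F.
Proof. by move=> BP uF FB; split => // e f /FB eB /FB fB; exact: BP. Qed.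

Lemma unit_of_ip v : ip v v = 1 -> nr v = 1.
Proof.
rewrite ipvv => -[] /eqP; rewrite sqrf_eq1 => /orP[/eqP//|/eqP nv].
by have := nr_ge0 v; rewrite nv => ?; exfalso; lra.
Qed.

Lemma ons_nr F e : ons F -> e \in F -> nr e = 1.
Proof. by move=> [_ FP] eF; apply: unit_of_ip; rewrite FP// eqxx. Qed.

Lemma ons1 v : nr v = 1 -> ons [:: v].
Proof.
move=> v1; split => // e f; rewrite !inE => /eqP -> /eqP ->.
by rewrite eqxx ipvv v1 expr1n.
Qed.

Lemma ip_comb F (c : H -> R[i]) e : ons F ->
  ip (\sum_(f <- F) c f *: f) e = \sum_(f <- F) c f * ip f e.
Proof. by move=> _; rewrite ip_suml; apply: eq_bigr => f _; rewrite ipZl. Qed.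

Lemma ip_comb_in F (c : H -> R[i]) e : ons F -> e \in F ->
  ip (\sum_(f <- F) c f *: f) e = c e.
Proof.
move=> oF eF; rewrite ip_comb//; case: oF => uF FP.
rewrite (bigD1_seq e)//= FP// eqxx mulr1 big_seq_cond big1 ?addr0//.
by move=> f /andP[fF /negbTE fe]; rewrite FP// fe mulr0.
Qed.

Lemma nr2_comb F (c : H -> R[i]) : ons F ->
  nr (\sum_(f <- F) c f *: f) ^+ 2 = \sum_(f <- F) normc (c f) ^+ 2.
Proof.
move=> oF; rewrite nr2E ip_sumr big_seq.
transitivity (Re (\sum_(f <- F) (normc (c f) ^+ 2)%:C)).
  congr Re; rewrite [RHS]big_seq; apply: eq_bigr => f fF.
  by rewrite ipZr ip_comb_in// mulrC conjcM.
by rewrite -rmorph_sum.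
Qed.

Definition pr F v := \sum_(f <- F) ip v f *: f.

Lemma pr_orth F v e : ons F -> e \in F -> ip (v - pr F v) e = 0.
Proof. by move=> oF eF; rewrite ipBl ip_comb_in// subrr. Qed.

Lemma nr2_sub_pr F v : ons F ->
  nr (v - pr F v) ^+ 2 = nr v ^+ 2 - \sum_(f <- F) normc (ip v f) ^+ 2.
Proof.
move=> oF; rewrite -(nr2_comb _ oF) -/(pr F v).
have -> : nr v ^+ 2 = nr ((v - pr F v) + pr F v) ^+ 2 by rewrite subrK.
rewrite (@nrD2_orth (v - pr F v)) ?addrK// {2}/pr ip_sumr big_seq big1// => f fF.
by rewrite ipZr pr_orth// mulr0.
Qed.

Lemma bessel F v : ons F -> \sum_(f <- F) normc (ip v f) ^+ 2 <= nr v ^+ 2.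
Proof. by move=> oF; rewrite -subr_ge0 -nr2_sub_pr// sqr_ge0. Qed.

(** The span of [F] lies in that of [F']. It is expressed through orthogonal complements, the form
    in which [compactop] speaks of finite families. *)
Lemma gram_schmidt (F : seq H) : exists F', ons F' /\
  forall v, {in F', forall e, ip v e = 0} -> {in F, forall f, ip v f = 0}.
Proof.
elim: F => [|f F [F' [oF' F'P]]]; first by exists [::].
have [f0|f0] := eqVneq (f - pr F' f) 0.
  exists F'; split => // v vF' e; rewrite inE => /orP[/eqP ->|]; last exact: F'P.
  move/eqP: f0; rewrite subr_eq0 => /eqP ->; rewrite ip_sumr big_seq big1// => g gF.
  by rewrite ipZr vF'// mulr0.
pose g := f - pr F' f; pose h := (nr g)^-1%:C *: g.
have g0 : nr g != 0 by rewrite nr_eq0.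
have h1 : ip h h = 1.
  rewrite ipvv nrZ normcR ger0_norm ?invr_ge0 ?nr_ge0// mulVf//.
  by rewrite expr1n.
have hF' e : e \in F' -> ip h e = 0.
  by move=> eF'; rewrite ipZl pr_orth// mulr0.
have F'h e : e \in F' -> ip e h = 0 by move/hF'/ip_eq0C.
have hnF' : h \notin F'.
  by apply/negP => /hF'; rewrite h1 => /eqP; rewrite oner_eq0.
exists (h :: F'); split.
  split => /=; first by rewrite hnF'; case: oF'.
  move=> a b; rewrite !inE => /orP[/eqP ->|aF] /orP[/eqP ->|bF].
  - by rewrite eqxx.
  - by rewrite hF'//; case: eqP => // hb; rewrite hb bF in hnF'.
  - by rewrite F'h//; case: eqP => // ha; rewrite -ha aF in hnF'.
  - by case: oF' => _ ->.
move=> v vP e; rewrite inE => /orP[/eqP ->|]; last first.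
  by apply: F'P => e' e'F; apply: vP; rewrite inE e'F orbT.
have -> : f = g + pr F' f by rewrite subrK.
rewrite ipDr ip_sumr big_seq big1 ?addr0; last first.
  by move=> k kF; rewrite ipZr vP ?mulr0// inE kF orbT.
have -> : g = (nr g)%:C *: h by rewrite scalerA -rmorphM /= divff// scale1r.
by rewrite ipZr vP ?mulr0// inE eqxx.
Qed.

(** The families [F n] leave a square sum of at most [(d n)^2] outside, so two partial sums are both
    close to the one over the union, and a Cauchy sequence results. The second clause is convergence
    of the net of all finite partial sums, the form that [expansion] needs. *)
Lemma riesz_fischer (B : set H) (c : H -> R[i]) (K : R) :
  orthonormal_set ip B ->
  (forall F, uniq F -> {in F, forall x, B x} ->
     \sum_(x <- F) normc (c x) ^+ 2 <= K) ->
  exists w, (forall e, B e -> ip w e = c e) /\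
    forall r, 0 < r -> exists F, [/\ uniq F, {in F, forall x, B x} &
      forall F', uniq F' -> {in F', forall x, B x} -> {subset F <= F'} ->
        nr (w - \sum_(x <- F') c x *: x) <= r].
Proof.
move=> oB cK.
pose s F := \sum_(x <- F) c x *: x.
pose d n : R := n.+1%:R^-1.
have d0 n : 0 < d n by rewrite invr_gt0.
have tail := fin_tail (fun x => sqr_ge0 (normc (c x))) cK.
have /choice[F FP] n := tail _ (exprn_gt0 2 (d0 n)).
have Fs n F' : uniq F' -> {in F', forall x, B x} -> {subset F n <= F'} ->
    nr (s F' - s (F n)) <= d n.
  move=> uF' BF' sub; case: (FP n) => uF BF FT.
  rewrite /s (big_subseq _ uF uF' sub) addrAC subrr add0r -big_filter.
  have uG : uniq [seq x <- F' | x \notin F n] by exact: filter_uniq.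
  have BG : {in [seq x <- F' | x \notin F n], forall x, B x}.
    by move=> x; rewrite mem_filter => /andP[_ /BF'].
  rewrite -(@ler_pXn2r _ 2) ?nnegrE ?nr_ge0 ?(ltW (d0 n))//.
  rewrite nr2_comb; last exact: ons_of_set oB uG BG.
  by apply: FT => // x; rewrite mem_filter => /andP[].
have sc : seqcauchy (fun n => s (F n)).
  move=> e e0; have e20 : 0 < e / 2 by rewrite divr_gt0.
  have [N NP] := inv_small e20; exists N => m n Nm Nn.
  have [uFm BFm _] := FP m; have [uFn BFn _] := FP n.
  pose G := undup (F m ++ F n).
  have uG : uniq G by exact: undup_uniq.
  have BG : {in G, forall x, B x}.
    by move=> x; rewrite mem_undup mem_cat => /orP[/BFm|/BFn].
  have h1 : nr (s G - s (F m)) <= d m.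
    by apply: Fs => // x; rewrite mem_undup mem_cat => ->.
  have h2 : nr (s G - s (F n)) <= d n.
    by apply: Fs => // x; rewrite mem_undup mem_cat => ->; rewrite orbT.
  have := NP _ Nm; have := NP _ Nn; rewrite -/(d n) -/(d m).
  have := nr_triangle (s (F m)) (s G) (s (F n)); rewrite (nrBC (s (F m)) (s G)).
  move=> *; lra.
have [w wP] := seqcauchy_lim sc.
have wF r : 0 < r -> exists F, [/\ uniq F, {in F, forall x, B x} &
      forall F', uniq F' -> {in F', forall x, B x} -> {subset F <= F'} ->
        nr (w - \sum_(x <- F') c x *: x) <= r].
  move=> r0; have r20 : 0 < r / 2 by rewrite divr_gt0.
  have [N NP] := inv_small r20; have [N' N'P] := wP _ r20.
  set M := maxn N N'.
  have [uF BF _] := FP M.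
  exists (F M); split => // F' uF' BF' sub.
  have := Fs _ _ uF' BF' sub; have := N'P M (leq_maxr _ _).
  have := NP M (leq_maxl _ _); rewrite -/(d M) -/(s F').
  have := nr_triangle w (s (F M)) (s F'); rewrite (nrBC w (s (F M))) (nrBC (s (F M)) (s F')).
  move=> *; lra.
exists w; split => // e Be.
apply/eqP; rewrite -subr_eq0 -normc_eq0; apply: contraT => n0.
have n1 : 0 < normc (ip w e - c e) / 2.
  by rewrite divr_gt0// lt_def n0 normc_ge0.
have [F' [uF' BF' F'P]] := wF _ n1.
pose G := undup (e :: F').
have uG : uniq G by exact: undup_uniq.
have BG : {in G, forall x, B x}.
  by move=> x; rewrite mem_undup inE => /orP[/eqP ->|/BF'].
have eG : e \in G by rewrite mem_undup inE eqxx.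
have oG := ons_of_set oB uG BG.
have := F'P G uG BG; have := cauchy_schwarz (w - s G) e.
rewrite ipBl ip_comb_in// (ons_nr oG eG) mulr1 => h1 h2.
have := le_trans h1 (h2 _).
have sub : {subset F' <= G} by move=> x xF; rewrite mem_undup inE xF orbT.
move=> /(_ sub) h3; exfalso; move: n1 h3; lra.
Qed.

(** Most passages to the limit take this form: an error [k * r] with [k] independent of [r]. *)
Lemma approx_le0 (x k : R) : (forall r, 0 < r -> x <= k * r) -> x <= 0.
Proof.
move=> h; rewrite leNgt; apply/negP => x0.
have k0 : 0 < `|k| + 1 by rewrite ltr_wpDl.
set y := x / (`|k| + 1) / 2.
have y0 : 0 < y by rewrite !divr_gt0.
have yE : (`|k| + 1) * y = x / 2 by rewrite /y; field; rewrite gt_eqF.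
have := h y y0; have := ler_norm k.
rewrite -(ler_pM2r y0); lra.
Qed.

End InnerProduct.

(** * Expansions in an orthonormal basis and orthogonal projection *)

Section Bases.
Implicit Types (v w x : H) (B : set H).

Lemma bessel_set B v F : orthonormal_set ip B -> uniq F ->
  {in F, forall x, B x} -> \sum_(f <- F) normc (ip v f) ^+ 2 <= nr v ^+ 2.
Proof. by move=> oB uF BF; apply: bessel => //; exact: ons_of_set oB uF BF. Qed.

Lemma expansion B v : orthonormal_basis ip B -> forall r, 0 < r ->
  exists F, [/\ uniq F, {in F, forall x, B x} &
    forall F', uniq F' -> {in F', forall x, B x} -> {subset F <= F'} ->
      nr (v - pr F' v) <= r].
Proof.
move=> [oB Btot] r r0.
have [w [wB wF]] := riesz_fischer oB (fun F => @bessel_set B v F oB).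
suff vw : v = w by have := wF _ r0; rewrite -vw.
apply/eqP; rewrite -subr_eq0; apply/eqP/Btot => e Be.
by rewrite ipBl wB// subrr.
Qed.

Lemma parseval B v : orthonormal_basis ip B -> forall r, 0 < r ->
  exists F, [/\ uniq F, {in F, forall x, B x} &
    nr v ^+ 2 <= \sum_(f <- F) normc (ip v f) ^+ 2 + r].
Proof.
move=> bB r r0; have s0 : 0 < Num.sqrt r by rewrite sqrtr_gt0.
have [F [uF BF FP]] := expansion v bB s0; exists F; split => //.
have := FP F uF BF (fun _ => id).
rewrite -(@ler_pXn2r _ 2) ?nnegrE ?nr_ge0 ?(ltW s0)// sqr_sqrtr ?(ltW r0)//.
rewrite nr2_sub_pr//; last exact: ons_of_set bB.1 uF BF.
by move=> ?; lra.
Qed.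

Lemma parseval_le B v w (k : R) : 0 <= k -> orthonormal_basis ip B ->
  (forall e, B e -> normc (ip v e) <= k * normc (ip w e)) -> nr v <= k * nr w.
Proof.
move=> k0 bB h.
rewrite -(@ler_pXn2r _ 2) ?nnegrE ?mulr_ge0 ?nr_ge0// -subr_le0.
apply: (@approx_le0 _ 1) => r r0; rewrite mul1r.
have [F [uF BF FP]] := parseval v bB r0.
have := bessel_set w bB.1 uF BF.
have : \sum_(f <- F) normc (ip v f) ^+ 2 <= k ^+ 2 * \sum_(f <- F) normc (ip w f) ^+ 2.
  rewrite mulr_sumr big_seq [leRHS]big_seq ler_sum// => f fF.
  by rewrite -exprMn ler_pXn2r ?nnegrE ?mulr_ge0 ?normc_ge0// h//; exact: BF.
move=> h1 h2; have := ler_wpM2l (sqr_ge0 k) h2.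
rewrite exprMn => h3; lra.
Qed.

Lemma basis_ext B v w : orthonormal_basis ip B ->
  (forall e, B e -> ip v e = ip w e) -> v = w.
Proof.
move=> [_ Btot] vw; apply/eqP; rewrite -subr_eq0; apply/eqP/Btot => e Be.
by rewrite ipBl vw// subrr.
Qed.

(** [w] is the component of [v] orthogonal to [B]. It replaces a test vector by one in the
    complement of [B], where [contraction_eigenvector] works. *)
Lemma orth_projection B v : orthonormal_set ip B ->
  exists w, (forall e, B e -> ip w e = 0) /\
    forall x, (forall e, B e -> ip x e = 0) -> ip x v = ip x w.
Proof.
move=> oB.
have [w [wB wF]] := riesz_fischer oB (fun F => @bessel_set B v F oB).
exists (v - w); split => [e Be|x xB]; first by rewrite ipBl wB// subrr.
rewrite ipBr; suff -> : ip x w = 0 by rewrite subr0.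
apply/eqP; rewrite -normc_eq0 eq_le normc_ge0 andbT.
apply: (@approx_le0 _ (nr x)) => r r0.
have [F [uF BF /(_ F uF BF (fun _ => id))]] := wF _ r0.
set s := \sum_(_ <- _) _ => ws.
have -> : ip x w = ip x (w - s).
  rewrite ipBr /s ip_sumr big_seq big1 ?subr0// => f fF.
  by rewrite ipZr xB ?mulr0//; exact: BF.
by rewrite (le_trans (cauchy_schwarz _ _))// ler_wpM2l// nr_ge0.
Qed.

End Bases.

(** * Bounded operators and the operator norm *)

Section BoundedOperators.
Implicit Types (v w x : H) (a b : H -> H) (k l : R).

Definition opbound a k := 0 <= k /\ forall v, nr (a v) <= k * nr v.

Definition bop a := linear a /\ exists k, opbound a k.

Lemma opbound_ge0 a k : opbound a k -> 0 <= k. Proof. by case. Qed.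

Section Linear.
Context a (la : linear a).
Lemma linearopD v w : a (v + w) = a v + a w.
Proof. by have := la 1 v w; rewrite !scale1r. Qed.
Lemma linearop0 : a 0 = 0.
Proof. by apply: (addrI (a 0)); rewrite -linearopD !addr0. Qed.
Lemma linearopZ c v : a (c *: v) = c *: a v.
Proof. by have := la c v 0; rewrite !addr0 linearop0 addr0. Qed.
Lemma linearopN v : a (- v) = - a v.
Proof. by rewrite -scaleN1r linearopZ scaleN1r. Qed.
Lemma linearopB v w : a (v - w) = a v - a w.
Proof. by rewrite linearopD linearopN. Qed.
Lemma linearop_sum I (s : seq I) (P : pred I) (f : I -> H) :
  a (\sum_(i <- s | P i) f i) = \sum_(i <- s | P i) a (f i).
Proof. exact: (big_morph a linearopD linearop0). Qed.
End Linear.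

Section Bop.
Context a (ba : bop a).
Let la := ba.1.
Definition bopD := linearopD la.
Definition bop0 := linearop0 la.
Definition bopZ := linearopZ la.
Definition bopN := linearopN la.
Definition bopB := linearopB la.
Definition bop_sum I s P f := @linearop_sum _ la I s P f.
End Bop.

Lemma opbound_comp a b k l : opbound a k -> opbound b l -> opbound (a \o b) (k * l).
Proof.
move=> [k0 ak] [l0 bl]; split; first exact: mulr_ge0.
by move=> v /=; rewrite (le_trans (ak _))// -mulrA ler_wpM2l.
Qed.

Lemma opboundD a b k l : opbound a k -> opbound b l -> opbound (a + b) (k + l).
Proof.
move=> [k0 ak] [l0 bl]; split; first exact: addr_ge0.
by move=> v; rewrite (le_trans (nrD _ _))// mulrDl lerD.
Qed.

Lemma opboundZ a k c : opbound a k -> opbound (c *: a) (normc c * k).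
Proof.
move=> [k0 ak]; split; first by rewrite mulr_ge0// normc_ge0.
by move=> v; rewrite nrZ -mulrA ler_wpM2l// normc_ge0.
Qed.

Lemma opbound_id : opbound (@idfun H) 1.
Proof. by split => // v; rewrite mul1r. Qed.

Lemma opaddE a b v : (a + b) v = a v + b v. Proof. by []. Qed.
Lemma opsubE a b v : (a - b) v = a v - b v. Proof. by []. Qed.
Lemma opoppE a v : (- a) v = - a v. Proof. by []. Qed.
Lemma opscaleE c a v : (c *: a) v = c *: a v. Proof. by []. Qed.
Lemma opzeroE v : (0 : H -> H) v = 0. Proof. by []. Qed.

Lemma bop_comp a b : bop a -> bop b -> bop (a \o b).
Proof.
move=> ba bb; split; first by move=> c v w /=; rewrite !(bopD, bopZ).
case: ba bb => _ [k ak] [_ [l bl]]; exists (k * l); exact: opbound_comp.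
Qed.

Lemma bop_add a b : bop a -> bop b -> bop (a + b).
Proof.
move=> ba bb; split.
  move=> c v w; rewrite !opaddE !(bopD ba, bopZ ba, bopD bb, bopZ bb) scalerDr.
  by rewrite addrACA.
case: ba bb => _ [k ak] [_ [l bl]]; exists (k + l); exact: opboundD.
Qed.

Lemma bop_scale c a : bop a -> bop (c *: a).
Proof.
move=> ba; split.
  move=> d v w; rewrite !opscaleE !(bopD ba, bopZ ba) scalerDr.
  by rewrite !scalerA mulrC.
case: ba => _ [k ak]; exists (normc c * k); exact: opboundZ.
Qed.

Lemma bop_opp a : bop a -> bop (- a).
Proof. by rewrite -scaleN1r; exact: bop_scale. Qed.

Lemma bop_sub a b : bop a -> bop b -> bop (a - b).
Proof. by move=> ba bb; apply: bop_add => //; exact: bop_opp. Qed.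

Lemma bop_id : bop (@idfun H).
Proof. by split; [move=> c v w|exists 1; exact: opbound_id]. Qed.

Lemma bop_zero : bop (0 : H -> H).
Proof.
split; first by move=> c v w; rewrite !opzeroE scaler0 addr0.
by exists 0; split => // v; rewrite !opzeroE nr0 mul0r.
Qed.

Lemma opnorm_ge0 a : linear a -> (0 <= opnorm a)%E.
Proof.
move=> la; apply: ereal_sup_ubound; exists 0; last by rewrite linearop0// normr0.
by rewrite /= normr0.
Qed.

Lemma opnorm_le a k : linear a -> 0 <= k ->
  (opnorm a <= k%:E)%E <-> opbound a k.
Proof.
move=> la k0; split => [ak|[_ ak]].
  split => // v; have [->|v0] := eqVneq v 0.
    by rewrite linearop0// nr0 mulr0.
  have v1 : nr ((nr v)^-1%:C *: v) = 1.
    by rewrite nrZ normcR ger0_norm ?invr_ge0 ?nr_ge0// mulVf// nr_eq0.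
  have : ((nr (a ((nr v)^-1%:C *: v)))%:E <= k%:E)%E.
    apply: le_trans ak; apply: ereal_sup_ubound; exists ((nr v)^-1%:C *: v) => //=.
    by rewrite nrE v1.
  rewrite lee_fin linearopZ// nrZ normcR ger0_norm ?invr_ge0 ?nr_ge0//.
  by rewrite mulrC ler_pdivrMr// lt_def nr_ge0 nr_eq0 v0.
apply: ge_ereal_sup => _ [v /= v1 <-]; rewrite lee_fin -/(nr (a v)).
rewrite (le_trans (ak v))// ler_piMr//.
by move: v1; rewrite nrE -(lecR (nr v)).
Qed.

Lemma bounded_opE a : bounded_op a <-> bop a.
Proof.
split=> [[la alty]|[la [k ak]]]; split => //.
  have := opnorm_ge0 la; move: alty; case E : (opnorm a) => [k| |]//= _ k0.
  by exists k; apply/opnorm_le; rewrite ?E.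
by rewrite (le_lt_trans _ (ltry k))//; apply/opnorm_le => //; case: ak.
Qed.

End BoundedOperators.

(** * Existence of adjoints *)

Section Adjoint.
Implicit Types (v w x : H) (B : set H) (a b : H -> H).

Lemma hbasisP : orthonormal_basis ip (hbasis ip).
Proof. exact: projT2 (cid (orthonormal_basis_exists ip)). Qed.

Lemma ip_lim0 (z : R[i]) (k : R) : (forall r, 0 < r -> normc z <= k * r) -> z = 0.
Proof.
move=> h; apply/eqP; rewrite -normc_eq0 eq_le normc_ge0 andbT.
exact: approx_le0 h.
Qed.

(** Riesz representation of [v |-> ip (a v) w]. If [S] is a finite sum of squared coefficients and
    [y] the vector with these coefficients, then [S = |y|^2 = Re (ip w (a y)) <= k |w| |y|], which
    bounds [S]; Riesz-Fischer provides [z]. *)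
Lemma riesz_op a k w : linear a -> opbound a k ->
  exists z, forall v, ip (a v) w = ip v z.
Proof.
move=> la [k0 ak]; have [oB Btot] := hbasisP.
have cK F : uniq F -> {in F, forall x, hbasis ip x} ->
    \sum_(x <- F) normc (ip w (a x)) ^+ 2 <= (k * nr w) ^+ 2.
  move=> uF BF; have oF := ons_of_set oB uF BF.
  set S := \sum_(x <- F) _; pose y := \sum_(x <- F) ip w (a x) *: x.
  have S0 : 0 <= S by apply: sumr_ge0 => x _; exact: sqr_ge0.
  have yS : nr y ^+ 2 = S by rewrite (nr2_comb _ oF).
  have wy : Re (ip w (a y)) = S.
    rewrite /y linearop_sum// ip_sumr.
    transitivity (Re (\sum_(f <- F) (normc (ip w (a f)) ^+ 2)%:C)).
      congr Re; apply: eq_bigr => f _.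
      by rewrite linearopZ// ipZr mulrC conjcM.
    by rewrite -rmorph_sum.
  have : S <= (k * nr w) * nr y.
    rewrite -wy (le_trans (Reip_le _ _))// mulrAC mulrC.
    by rewrite ler_wpM2r ?nr_ge0.
  have kw0 : 0 <= k * nr w by rewrite mulr_ge0 ?nr_ge0.
  have [y0|y0] := eqVneq (nr y) 0.
    by move=> _; rewrite -yS y0 expr0n/= sqr_ge0.
  rewrite -yS expr2 ler_pM2r ?lt_def ?y0 ?nr_ge0// => h.
  by rewrite -expr2 ler_pXn2r// nnegrE ?nr_ge0.
have [z [zP _]] := riesz_fischer oB cK.
exists z => v; apply/eqP; rewrite -subr_eq0; apply/eqP.
apply: (@ip_lim0 _ (k * nr w + nr z)) => r r0.
have [F [uF BF /(_ F uF BF (fun _ => id)) vF]] := expansion v hbasisP r0.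
have sF : ip (a (pr F v)) w = ip (pr F v) z.
  rewrite /pr linearop_sum// !ip_suml big_seq [RHS]big_seq; apply: eq_bigr => f fF.
  by rewrite linearopZ// !ipZl (ipC (a f)) (ipC f) zP//; exact: BF.
have -> : ip (a v) w - ip v z = ip (a (v - pr F v)) w - ip (v - pr F v) z.
  by rewrite linearopB// !ipBl sF; ring.
rewrite (le_trans (le_normcD _ _))// normcN mulrDl lerD//.
  rewrite (le_trans (cauchy_schwarz _ _))// mulrAC ler_wpM2r ?nr_ge0//.
  by rewrite (le_trans (ak _))// ler_wpM2l.
by rewrite (le_trans (cauchy_schwarz _ _))// mulrC ler_wpM2l ?nr_ge0.
Qed.

Lemma adj_bound0 a b k : opbound a k -> (forall v w, ip (a v) w = ip v (b w)) ->
  opbound b k.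
Proof.
move=> [k0 ak] ab; split => // w.
have [->|b0] := eqVneq (nr (b w)) 0; first by rewrite mulr_ge0 ?nr_ge0.
have b1 : 0 < nr (b w) by rewrite lt_def b0 nr_ge0.
rewrite -(ler_pM2r b1) -expr2 nr2E -ab.
rewrite (le_trans (Reip_le _ _))// mulrAC ler_wpM2r ?nr_ge0//.
Qed.

Lemma adjoint_exists a : bop a ->
  exists b, bop b /\ forall v w, ip (a v) w = ip v (b w).
Proof.
move=> [la [k ak]].
have /choice[b bP] : forall w, exists z, forall v, ip (a v) w = ip v z.
  by move=> w; exact: riesz_op ak.
exists b; split => //; split; last by exists k; exact: adj_bound0 ak _.
move=> c v w; apply: ip_ext => x.
by rewrite -bP !ipDr !ipZr !bP.
Qed.

Lemma adjP a : bop a -> bop (adj a) /\ forall v w, ip (a v) w = ip v (adj a w).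
Proof.
move=> ba; have [b [bb ab]] := adjoint_exists ba.
have : [set b | bounded_op b /\ forall v w, ip (a v) w = ip v (b w)] (adj a).
  by apply: (@getPex _ [set b | bounded_op b /\ _]); exists b; split=> //; exact/bounded_opE.
by move=> [/bounded_opE].
Qed.

Lemma bop_adj a : bop a -> bop (adj a). Proof. by case/adjP. Qed.

Lemma adjE a v w : bop a -> ip (a v) w = ip v (adj a w).
Proof. by case/adjP. Qed.

Lemma adjEl a v w : bop a -> ip (adj a v) w = ip v (a w).
Proof. by move=> ba; rewrite ipC -adjE// -ipC. Qed.

Lemma adj_uniq a b : bop a -> (forall v w, ip (a v) w = ip v (b w)) -> adj a = b.
Proof.
move=> ba ab; apply/funext => w; apply: ip_ext => x.
by rewrite -adjE// ab.
Qed.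

Lemma adj_bound a k : bop a -> opbound a k -> opbound (adj a) k.
Proof. by move=> ba ak; apply: adj_bound0 ak _ => v w; exact: adjE. Qed.

End Adjoint.

(** * Compact operators *)

Section Compact.
Implicit Types (v w x : H) (B : set H) (a b : H -> H).

(* Equivalent to compactness for bounded operators, and visibly stable under
   sums, left multiplication and limits in the operator norm. *)
Definition compactop a := forall e : R, 0 < e -> exists F, ons F /\
  forall v, {in F, forall f, ip v f = 0} -> nr (a v) <= e * nr v.

Lemma compactop_lim a : (forall e : R, 0 < e -> exists b, compactop b /\
    forall v, nr (a v - b v) <= e * nr v) -> compactop a.
Proof.
move=> h e e0; have e20 : 0 < e / 2 by rewrite divr_gt0.
have [b [cb ab]] := h _ e20; have [F [oF Fb]] := cb _ e20.
exists F; split => // v /Fb bv; rewrite -(subrK (b v) (a v)).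
by rewrite (le_trans (nrD _ _))// [e in leRHS](splitr e) mulrDl lerD.
Qed.

Lemma compactop_dom a b (k : R) : (forall v, nr (b v) <= k * nr (a v)) ->
  compactop a -> compactop b.
Proof.
move=> bk ca e e0.
have k0 : 0 < `|k| + 1 by rewrite ltr_wpDl.
have [F [oF Fa]] := ca (e / (`|k| + 1)) (divr_gt0 e0 k0).
exists F; split => // v /Fa av; rewrite (le_trans (bk v))//.
have h : k * nr (a v) <= (`|k| + 1) * nr (a v).
  by rewrite ler_wpM2r ?nr_ge0// (le_trans (ler_norm _))// lerDl.
rewrite (le_trans h)// -(ler_pM2l (x := (`|k| + 1)^-1)) ?invr_gt0//.
by rewrite mulKf ?gt_eqF// mulrA (mulrC _^-1).
Qed.

Lemma compactop_add a b : compactop a -> compactop b -> compactop (a + b).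
Proof.
move=> ca cb e e0; have e20 : 0 < e / 2 by rewrite divr_gt0.
have [F [_ Fa]] := ca _ e20; have [G [_ Gb]] := cb _ e20.
have [F' [oF' F'P]] := gram_schmidt (F ++ G).
exists F'; split => // v /F'P vFG; rewrite opaddE (le_trans (nrD _ _))//.
rewrite [e in leRHS](splitr e) mulrDl lerD//.
  by apply: Fa => f fF; apply: vFG; rewrite mem_cat fF.
by apply: Gb => f fF; apply: vFG; rewrite mem_cat fF orbT.
Qed.

Lemma compactop_scale c a : compactop a -> compactop (c *: a).
Proof. by apply: (@compactop_dom _ _ (normc c)) => v; rewrite opscaleE nrZ. Qed.

Lemma compactop_comp b a : bop b -> compactop a -> compactop (b \o a).
Proof. by move=> [_ [k [k0 bk]]]; apply: (@compactop_dom _ _ k) => v /=. Qed.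

Lemma compactop_zero : compactop (0 : H -> H).
Proof.
move=> e e0; exists [::]; split => // v _.
by rewrite opzeroE nr0 mulr_ge0 ?nr_ge0 ?ltW.
Qed.

End Compact.

(** * Eigenvectors of compact self-adjoint operators *)

Section TopEigenvector.
Implicit Types (v w x : H).

Section Contraction.
Context (B : set H) (c : H -> H) (oB : orthonormal_set ip B) (bc : bop c).
Hypothesis c_self : forall v w, ip (c v) w = ip v (c w).
Local Notation M := [set v | forall e, B e -> ip v e = 0].
Hypothesis cM : forall v, M v -> M (c v).
Hypothesis c1 : forall v, M v -> nr (c v) <= nr v.

Let M_sub v w : M v -> M w -> M (v - w).
Proof. by move=> vM wM e Be; rewrite ipBl vM// wM// subrr. Qed.

Let iterM j v : M v -> M (iter j c v).
Proof. by move=> vM; elim: j => [//|j IH]; exact: cM. Qed.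

Let iter_self i v w : ip (iter i c v) w = ip v (iter i c w).
Proof. by elim: i v w => [//|i IH] v w; rewrite iterS c_self IH -iterSr. Qed.

Let iter_shift i j k l v : (i + j = k + l)%N ->
  ip (iter i c v) (iter j c v) = ip (iter k c v) (iter l c v).
Proof. by move=> ij; rewrite !iter_self -!iterD ij. Qed.

Let q v i := nr (iter i c v) ^+ 2.

Let q_noninc v i j : M v -> (i <= j)%N -> q v j <= q v i.
Proof.
move=> vM /subnK <-; elim: (j - i)%N => [//|k IH]; apply: le_trans IH.
rewrite /q ler_pXn2r ?nnegrE ?nr_ge0// addSn iterS; apply: c1; exact: iterM.
Qed.

Let q_sub v i j :
  nr (iter i.*2 c v - iter j.*2 c v) ^+ 2 = q v i.*2 + q v j.*2 - 2 * q v (i + j)%N.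
Proof.
rewrite nrB2; congr (_ - 2 * _); rewrite /q nr2E.
by congr Re; apply: iter_shift; rewrite -!addnn; lia.
Qed.

(** The squared norms [q v i] are nonincreasing and bounded below, and by [q_sub] the squared
    distance of two even iterates is a second difference of them. An eigenvalue -1 would make the
    sequence of all iterates oscillate, hence the even ones. *)
Let q_lim v : M v -> seqcauchy (fun j => iter j.*2 c v).
Proof.
move=> vM e e0.
pose A : set R := [set q v i | i in setT].
have lbA : has_inf A.
  by split; [exists (q v 0%N), 0%N|exists 0 => _ [i _ <-]; exact: sqr_ge0].
have e20 : 0 < e ^+ 2 / 4 by rewrite divr_gt0 ?exprn_gt0.
have [_ [N _ <-] NP] := inf_adherent e20 lbA.
exists N => m n Nm Nn.
have qL i : inf A <= q v i by apply: ge_inf; [case: lbA|exists i].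
have qN i : (N <= i)%N -> q v i < inf A + e ^+ 2 / 4.
  by move=> Ni; rewrite (le_lt_trans _ NP)// q_noninc.
have dbl (k : nat) : (N <= k)%N -> (N <= k.*2)%N by move=> Nk; rewrite -addnn (leq_trans Nk)// leq_addr.
rewrite -(@ltr_pXn2r _ 2) ?nnegrE ?nr_ge0 ?(ltW e0)// q_sub.
have := qN _ (dbl _ Nm); have := qN _ (dbl _ Nn); have := qL (m + n)%N.
have : 0 < e ^+ 2 by rewrite exprn_gt0.
move=> *; lra.
Qed.

Let top_lim v : M v -> exists y, [/\ seqlim (fun j => iter j.*2 c v) y, M y & c (c y) = y].
Proof.
move=> vM; have [y yP] := seqcauchy_lim (q_lim vM); exists y; split => //.
  move=> e Be; apply: (@ip_lim0 _ (nr e)) => r r0.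
  have [N NP] := yP _ r0; have := NP N (leqnn _) => /ltW h.
  have -> : ip y e = ip (y - iter N.*2 c v) e.
    by rewrite ipBl [X in _ - X](iterM _ vM)// subr0.
  rewrite (le_trans (cauchy_schwarz _ _))// mulrC ler_wpM2l ?nr_ge0//.
  by rewrite nrBC.
case: (bc) => _ [k [k0 ck]].
have yP2 : seqlim (fun j => iter j.*2 c v) (c (c y)).
  move=> e e0; have k2 : 0 < k * k + 1 by rewrite ltr_wpDl ?mulr_ge0.
  have [N NP] := yP _ (divr_gt0 e0 k2).
  exists N.+1 => -[//|n] Nn; rewrite doubleS !iterS -!(bopB bc).
  rewrite (le_lt_trans (ck _))// (@le_lt_trans _ _ (k * (k * nr (iter n.*2 c v - y))))//.
    by rewrite ler_wpM2l.
  have := NP n Nn; rewrite ltr_pdivlMr// => h.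
  have := nr_ge0 (iter n.*2 c v - y).
  rewrite mulrA; lra.
exact: seqlim_unique yP2 yP.
Qed.

(** A limit [y] of even iterates satisfies [c (c y) = y] and yields an eigenvector unless it
    vanishes. If all limits vanish, take a unit [v] almost preserved in norm by [c]. Then [c (c v)]
    is near [v], hence so is a chosen even iterate, and moving the iteration to the other side of
    [ip] makes [v] almost orthogonal to the finite family [F] of [compactop]. Off [F] the operator
    shrinks by one half, against [|c v|] near 1. This replaces weak compactness of the ball. *)
Lemma contraction_eigenvector : compactop c ->
  (forall r, 0 < r -> exists v, [/\ M v, nr v = 1 & 1 - r <= nr (c v)]) ->
  exists v, [/\ M v, v <> 0 & c v = v \/ c v = - v].
Proof.
move=> cc cN; apply: contrapT => noeig.
have lim0 v : M v -> seqlim (fun j => iter j.*2 c v) 0.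
  move=> vM; have [y [yl yM ccy]] := top_lim vM.
  suff <- : y = 0 by [].
  apply: contrapT => y0; apply: noeig.
  (* As [c (c y) = y], either [c y = y] or [c y - y] is an eigenvector for -1. *)
  have [cy|cy] := eqVneq (c y - y) 0.
    by exists y; split => //; left; apply/eqP; rewrite -subr_eq0 cy.
  exists (c y - y); split; [exact: M_sub (cM yM) yM|exact/eqP|right].
  by rewrite (bopB bc) ccy opprB.
have half0 : 0 < 2^-1 :> R by rewrite invr_gt0.
have [F [oF FP]] := cc _ half0.
(* [F] need not lie in [M], where the even iterates are known to tend to 0; vectors of [M] see only
   its projection. *)
have /choice[f' f'P] : forall f, exists w, M w /\ forall x, M x -> ip x f = ip x w.
  by move=> f; have [w [wM wP]] := orth_projection f oB; exists w.
have [k [k0 ck]] := bc.2.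
pose K := k * (size F)%:R.
have K0 : 0 <= K by rewrite mulr_ge0.
(* Once [|ip v f| <= 2 d] for [f] in [F], the part of [c v] due to [F] is at most [2 K d <= 1/8], so
   [|c v| <= 5/8], whereas [v] will have [|c v| >= 3/4]. *)
pose d := (16 * (K + 1))^-1.
have K1 : 0 < 16 * (K + 1) by rewrite mulr_gt0// ltr_wpDl.
have d0 : 0 < d by rewrite invr_gt0.
have [j jP] : exists j, {in F, forall f, nr (iter j.*2 c (f' f)) <= d}.
  have : forall G : seq H, exists N, forall n, (N <= n)%N ->
      {in G, forall f, nr (iter n.*2 c (f' f)) <= d}.
    elim=> [|g G [N NP]]; first by exists 0%N.
    have [N' N'P] := lim0 _ (f'P g).1 _ d0.
    exists (maxn N N') => n; rewrite geq_max => /andP[Nn N'n] f.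
    rewrite inE => /orP[/eqP ->|]; last exact: NP.
    by have := N'P n N'n; rewrite subr0 => /ltW.
  by move=> /(_ F)[N NP]; exists N; exact: NP.
(* If [1 - d' ^+ 2 / 4 <= |c v|], then [c \o c] moves [v] by at most [d'], and [j] applications move
   it by at most [j d' <= d]. *)
pose d' := d / (j.*2.+1)%:R.
have d'0 : 0 < d' by rewrite divr_gt0.
have d1 : d <= 1 / 16.
  by rewrite div1r lef_pV2 ?posrE// ler_pMr// lerDr.
have d'd : d' <= d by rewrite ler_pdivrMr// ler_peMr ?(ltW d0)// ler1n.
have r0 : 0 < d' ^+ 2 / 4 by rewrite divr_gt0// exprn_gt0.
have [v [vM v1 cv]] := cN _ r0.
have cv1 : nr (c v) <= 1 by rewrite -v1 c1.
have ccv : nr (c (c v) - v) <= d'.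
  rewrite -(@ler_pXn2r _ 2) ?nnegrE ?nr_ge0 ?(ltW d'0)//.
  rewrite nrB2 c_self -nr2E v1.
  rewrite expr1n; have : nr (c (c v)) ^+ 2 <= 1.
    by rewrite exprn_ile1 ?nr_ge0// (le_trans (c1 (cM vM))).
  have : (1 - d' ^+ 2 / 4) ^+ 2 <= nr (c v) ^+ 2.
    rewrite ler_pXn2r ?nnegrE ?nr_ge0// subr_ge0.
    have : d' ^+ 2 <= 1 by rewrite exprn_ile1 ?(ltW d'0)//; lra.
    by move=> ?; lra.
  have : 0 <= (d' ^+ 2) ^+ 2 by rewrite sqr_ge0.
  move=> *; nra.
have jv i : nr (iter i.*2 c v - v) <= i%:R * d'.
  elim: i => [|i IH]; first by rewrite subrr nr0 mul0r.
  rewrite (le_trans (nr_triangle _ (c (c v)) _))// -natr1 mulrDl mul1r lerD//.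
  rewrite doubleS !iterS -!(bopB bc) (le_trans (c1 _))//.
    by apply: cM; apply: M_sub => //; exact: iterM.
  by rewrite (le_trans (c1 _))//; apply: M_sub => //; exact: iterM.
have f'1 f : f \in F -> nr (f' f) <= 1.
  move=> fF; have [fM fP] := f'P f.
  have := nr2E (f' f); rewrite -fP// => h.
  have := Reip_le (f' f) f; rewrite -h (ons_nr oF fF) mulr1 expr2.
  have [->//|n0] := eqVneq (nr (f' f)) 0.
  by rewrite ger_pMr// lt_def n0 nr_ge0.
have vf f : f \in F -> normc (ip v f) <= 2 * d.
  move=> fF; have [fM fP] := f'P f; rewrite fP//.
  have -> : ip v (f' f) = ip v (iter j.*2 c (f' f)) - ip (iter j.*2 c v - v) (f' f).
    by rewrite ipBl -iter_self; ring.
  rewrite (le_trans (le_normcD _ _))// normcN mulr2n mulrDl mul1r lerD//.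
    by rewrite (le_trans (cauchy_schwarz _ _))// v1 mul1r jP.
  rewrite (le_trans (cauchy_schwarz _ _))//.
  rewrite (@le_trans _ _ (j%:R * d' * 1))//.
    by rewrite ler_pM ?nr_ge0// f'1.
  rewrite mulr1 /d' mulrCA ger_pMr// ler_pdivrMr// mul1r ler_nat -addnn.
  by rewrite -addnS leq_addr.
have prv : nr (pr F v) <= (size F)%:R * (2 * d).
  rewrite (le_trans (nr_sum _ _ _))// big_seq.
  rewrite (@le_trans _ _ (\sum_(f <- F | f \in F) (2 * d)))//.
    by apply: ler_sum => f fF; rewrite nrZ (ons_nr oF fF) mulr1 vf.
  by rewrite -big_seq big_const_seq count_predT iter_addr_0 -[leLHS]mulr_natl.
have v'1 : nr (v - pr F v) <= 1.
  rewrite -(@ler_pXn2r _ 2) ?nnegrE ?nr_ge0// nr2_sub_pr// v1 gerBl.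
  by apply: sumr_ge0 => f _; exact: sqr_ge0.
have : nr (c v) <= 2^-1 + K * (2 * d).
  rewrite -{1}(subrK (pr F v) v) (bopD bc) (le_trans (nrD _ _))// lerD//.
    rewrite (le_trans (FP _ _))//.
      by move=> f fF; rewrite pr_orth.
    by rewrite ler_piMr// invr_ge0.
  by rewrite (le_trans (ck _))// /K -mulrA ler_wpM2l.
have : K * (2 * d) <= 1 / 8.
  have : (K + 1) * d = 1 / 16.
    by rewrite /d; field; rewrite gt_eqF// ltr_wpDl.
  by move=> ?; lra.
have : d' ^+ 2 <= 1 by rewrite exprn_ile1 ?(ltW d'0)//; lra.
move=> *; lra.
Qed.

End Contraction.

(** Division by [m], the norm of [h] on the complement of [B], produces a contraction whose norm 1
    is approached on unit vectors. If [m <= 0], then [h] vanishes there and [v0] itself is an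
    eigenvector. *)
Lemma top_eigenvector (B : set H) (h : H -> H) v0 : orthonormal_set ip B -> bop h ->
  (forall v w, ip (h v) w = ip v (h w)) ->
  (forall v, (forall e, B e -> ip v e = 0) -> forall e, B e -> ip (h v) e = 0) ->
  compactop h -> (forall e, B e -> ip v0 e = 0) -> v0 <> 0 ->
  exists v (l : R), [/\ forall e, B e -> ip v e = 0, v <> 0 & h v = l%:C *: v].
Proof.
move=> oB bh h_self hM ch v0M /eqP v00.
pose M := [set v | forall e, B e -> ip v e = 0].
have MZ z v : M v -> M (z *: v) by move=> vM e Be; rewrite ipZl vM// mulr0.
have normed v : M v -> v != 0 -> M ((nr v)^-1%:C *: v) /\ nr ((nr v)^-1%:C *: v) = 1.
  move=> vM v_0; split; first exact: MZ.
  by rewrite nrZ normcR ger0_norm ?invr_ge0 ?nr_ge0// mulVf// nr_eq0.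
pose A : set R := [set nr (h v) | v in [set v | M v /\ nr v = 1]].
have [k [k0 hk]] := bh.2.
have [w0M w01] := normed _ v0M v00.
have supA : has_sup A.
  split; first by exists (nr (h ((nr v0)^-1%:C *: v0))), ((nr v0)^-1%:C *: v0).
  by exists k => _ [v [vM v1] <-]; rewrite (le_trans (hk v))// v1 mulr1.
set m := sup A.
have hm v : M v -> nr (h v) <= m * nr v.
  move=> vM; have [->|v_0] := eqVneq v 0; first by rewrite (bop0 bh) nr0 mulr0.
  have [wM w1] := normed _ vM v_0.
  have : nr (h ((nr v)^-1%:C *: v)) <= m.
    by apply: ub_le_sup; [case: supA|exists ((nr v)^-1%:C *: v)].
  rewrite (bopZ bh) nrZ normcR ger0_norm ?invr_ge0 ?nr_ge0//.
  by rewrite mulrC ler_pdivrMr// nr_gt0.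
have [m0|m0] := leP m 0.
  exists v0, 0; split => //; first exact/eqP.
  rewrite scale0r; apply/eqP; rewrite -nr_eq0 eq_le nr_ge0 andbT.
  by rewrite (le_trans (hm _ v0M))// mulr_le0_ge0 ?nr_ge0.
pose c := m^-1%:C *: h.
have bc : bop c by exact: bop_scale.
have nrc v : nr (c v) = m^-1 * nr (h v).
  by rewrite /c opscaleE nrZ normcR ger0_norm ?invr_ge0 ?ltW.
have [v [vM v_0 cv]] : exists v, [/\ M v, v <> 0 & c v = v \/ c v = - v].
  apply: contraction_eigenvector => //.
  - move=> v w; rewrite /c !opscaleE ipZl ipZr h_self; congr (_ * _).
    by apply: complex_eqP => /=; rewrite ?oppr0.
  - by move=> v vM; rewrite /c opscaleE; apply: MZ; exact: hM.
  - by move=> v vM; rewrite nrc mulrC ler_pdivrMr// mulrC hm.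
  - exact: compactop_scale.
  move=> r r0; have rm : 0 < r * m by rewrite mulr_gt0.
  have [_ [v [vM v1] <-] hv] := sup_adherent rm supA.
  exists v; split => //; rewrite nrc mulrC ler_pdivlMr//.
  by rewrite mulrBl mul1r ltW.
have hE : h v = m%:C *: c v.
  by rewrite /c opscaleE scalerA -rmorphM divff ?gt_eqF// scale1r.
case: cv => cv; rewrite cv in hE.
  by exists v, m; split.
by exists v, (- m); split => //; rewrite hE scalerN -scaleNr -rmorphN.
Qed.

End TopEigenvector.

(** * Orthonormal eigenbases *)

Section SpectralTheorem.
Implicit Types (v w x : H).

(** Since [a] commutes with its adjoint [a'], the vectors [a' v - conj l v] and [a v - l v] have the
    same norm. *)
Lemma normal_eigen (a a' : H -> H) l v : bop a -> bop a' ->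
  (forall v w, ip (a v) w = ip v (a' w)) -> (forall v, a (a' v) = a' (a v)) ->
  a v = l *: v -> a' v = Num.conj l *: v.
Proof.
move=> ba ba' aa' comm av.
have a'a x y : ip (a' x) y = ip x (a y) by rewrite ipC -aa' -ipC.
apply/eqP; rewrite -subr_eq0 -nr_eq0 -sqrf_eq0 nr2E; apply/eqP.
have -> : ip (a' v - Num.conj l *: v) (a' v - Num.conj l *: v) =
          ip (a v - l *: v) (a v - l *: v).
  rewrite !ipBl !ipBr !ipZl !ipZr !a'a !aa' -comm conjCK; ring.
by rewrite av subrr ip0l.
Qed.

Lemma monic_quadratic_split (s q : R[i]) : exists r1 r2, s = r1 + r2 /\ q = - (r1 * r2).
Proof.
pose d := sqrtC (s ^+ 2 + 4 * q).
have dd : d ^+ 2 = s ^+ 2 + 4 * q by rewrite sqrtCK.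
exists ((s + d) / 2), ((s - d) / 2); split; first by field.
have -> : - ((s + d) / 2 * ((s - d) / 2)) = (d ^+ 2 - s ^+ 2) / 4 by field.
by rewrite dd; field.
Qed.

(* [h] is compact with finite-dimensional eigenspaces off its kernel; the
   quadratic relation replaces the fundamental theorem of algebra on them. *)
Lemma eigenbasis (a a' h : H -> H) : bop a -> bop a' -> bop h ->
  (forall v w, ip (a v) w = ip v (a' w)) -> (forall v, a (a' v) = a' (a v)) ->
  (forall v w, ip (h v) w = ip v (h w)) -> compactop h ->
  (forall v, h (a v) = a (h v)) ->
  (forall v (l : R), h v = l%:C *: v ->
     exists s q, a (a v) = s *: a v + q *: v) ->
  exists B, orthonormal_basis ip B /\ forall e, B e -> exists l, a e = l *: e.
Proof.
move=> ba ba' bh aa' comm h_self ch ha quad.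
pose P (B : set H) := orthonormal_set ip B /\
  forall e, B e -> (exists l, a e = l *: e) /\ exists l : R, h e = l%:C *: e.
(* [B] is a maximal orthonormal set of joint eigenvectors of [a] and [h]; a nonzero vector
   orthogonal to it will lead to one more. *)
have [F FP Ftot|B [[oB eB] maxB]] := @Zorn_bigcup H P.
  split.
    move=> e f [X FX Xe] [Y FY Yf].
    have [XY|YX] := Ftot _ _ FX FY.
      by apply: (FP Y FY).1 => //; exact: XY.
    by apply: (FP X FX).1 => //; exact: YX.
  by move=> e [X FX Xe]; apply: (FP X FX).2.
exists B; split; last by move=> e /eB[].
split => // v vB; apply: contrapT => v0.
have aM x : (forall e, B e -> ip x e = 0) -> forall e, B e -> ip (a x) e = 0.
  move=> xM e Be; have [[l ae] _] := eB e Be.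
  by rewrite aa' (normal_eigen ba ba' aa' comm ae) ipZr xM// mulr0.
have hM x : (forall e, B e -> ip x e = 0) -> forall e, B e -> ip (h x) e = 0.
  move=> xM e Be; have [_ [l he]] := eB e Be.
  by rewrite h_self he ipZr xM// mulr0.
have [v1 [c [v1M v10 hv1]]] := top_eigenvector oB bh h_self hM ch vB v0.
have [s [q aav]] := quad _ _ hv1.
have [r1 [r2 [sE qE]]] := monic_quadratic_split s q.
have [w [wM w0 [l aw] hw]] : exists w, [/\ forall e, B e -> ip w e = 0, w != 0,
    exists l, a w = l *: w & h w = c%:C *: w].
  (* The quadratic relation reads [(a - r2) (a - r1) v1 = 0]: either [v1] is an eigenvector of [a]
     for [r1], or [(a - r1) v1] is one for [r2]. *)
  have [y0|y0] := eqVneq (a v1 - r1 *: v1) 0.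
    exists v1; split => //; first exact/eqP.
    by exists r1; apply/eqP; rewrite -subr_eq0 y0.
  exists (a v1 - r1 *: v1); split => //.
  - by move=> e Be; rewrite ipBl ipZl aM// v1M// mulr0 subrr.
  - exists r2; rewrite (bopB ba) (bopZ ba) aav sE qE.
    rewrite scalerBr !scalerDl scaleNr scalerA (mulrC r2).
    rewrite [r1 *: _ + _]addrC -!addrA; congr (_ + _).
    by rewrite addrCA subrr addr0.
  - by rewrite (bopB bh) (bopZ bh) ha hv1 (bopZ ba) scalerBr !scalerA mulrC.
pose z := (nr w)^-1%:C *: w.
have zz : ip z z = 1.
  rewrite ipvv nrZ normcR ger0_norm ?invr_ge0 ?nr_ge0// mulVf ?nr_eq0//.
  by rewrite expr1n.
have zB e : B e -> ip z e = 0 by move=> Be; rewrite ipZl wM// mulr0.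
have Bz e : B e -> ip e z = 0 by move=> /zB/ip_eq0C.
apply: (maxB (B `|` [set z])).
  split; first by left.
  move=> BwB; have /zB : B z by apply: BwB; right.
  by rewrite zz => /eqP; rewrite oner_eq0.
split.
  move=> e f [Be|->] [Bf|->].
  - exact: oB.
  - rewrite Bz//; case: eqP => // ew; move: (Bz _ Be).
    by rewrite ew zz => /eqP; rewrite oner_eq0.
  - rewrite zB//; case: eqP => // ew; move: (zB _ Bf).
    by rewrite -ew zz => /eqP; rewrite oner_eq0.
  - by rewrite zz eqxx.
move=> e [/eB//|->]; split.
  by exists l; rewrite (bopZ ba) aw !scalerA mulrC.
by exists c; rewrite (bopZ bh) hw !scalerA mulrC.
Qed.

End SpectralTheorem.

(** * Convexity of powers and Minkowski's inequality *)

Section PowerMeans.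
Implicit Types (s t x y : R).

Lemma pow_chebyshev x y n : 0 <= x -> 0 <= y -> 0 <= (x - y) * (x ^+ n - y ^+ n).
Proof.
move=> x0 y0; have [xy|/ltW yx] := leP x y.
  by rewrite mulr_le0// subr_le0// lerXn2r.
by rewrite mulr_ge0// subr_ge0// lerXn2r.
Qed.

(** Multiplying the bound for [n] by [s x + t y] leaves the remainder [s t (x - y) (x^n - y^n)],
    nonnegative by [pow_chebyshev]. *)
Lemma pow_convex s t x y n : 0 <= s -> 0 <= t -> s + t = 1 -> 0 <= x -> 0 <= y ->
  (s * x + t * y) ^+ n <= s * x ^+ n + t * y ^+ n.
Proof.
move=> s0 t0 st x0 y0; elim: n => [|n IH]; first by rewrite !expr0 !mulr1 st.
have z0 : 0 <= s * x + t * y by rewrite addr_ge0 ?mulr_ge0.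
rewrite exprS (le_trans (ler_wpM2l z0 IH))// -subr_ge0.
have -> : s * x ^+ n.+1 + t * y ^+ n.+1 - (s * x + t * y) * (s * x ^+ n + t * y ^+ n)
    = (s * t) * ((x - y) * (x ^+ n - y ^+ n)).
  by rewrite !exprS (_ : t = 1 - s); [ring|lra].
by rewrite mulr_ge0 ?pow_chebyshev// mulr_ge0.
Qed.

(** The square is strictly convex, and the increasing convex map [z |-> z ^+ n] on nonnegative
    numbers preserves the strict inequality. *)
Lemma pow_convex_eq s t x y n : (0 < n)%N -> 0 < s -> 0 < t -> s + t = 1 ->
  0 <= x -> 0 <= y ->
  (s * x + t * y) ^+ n.*2 = s * x ^+ n.*2 + t * y ^+ n.*2 -> x = y.
Proof.
move=> n0 s0 t0 st x0 y0 h; apply/eqP; apply: contraT => xy.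
have h1 : (s * x + t * y) ^+ 2 < s * x ^+ 2 + t * y ^+ 2.
  rewrite -subr_gt0.
  have -> : s * x ^+ 2 + t * y ^+ 2 - (s * x + t * y) ^+ 2 = s * t * (x - y) ^+ 2.
    by rewrite (_ : t = 1 - s); [ring|lra].
  by rewrite mulr_gt0 ?(mulr_gt0 s0 t0)// exprn_even_gt0//= subr_eq0.
have h2 : (s * x ^+ 2 + t * y ^+ 2) ^+ n <= s * (x ^+ 2) ^+ n + t * (y ^+ 2) ^+ n.
  by apply: pow_convex; rewrite ?sqr_ge0 ?ltW.
have h3 : ((s * x + t * y) ^+ 2) ^+ n < (s * x ^+ 2 + t * y ^+ 2) ^+ n.
  by rewrite ltr_pXn2r// nnegrE ?sqr_ge0// addr_ge0// mulr_ge0 ?sqr_ge0// ltW.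
have := lt_le_trans h3 h2.
by rewrite -!exprM mul2n h ltxx.
Qed.

(** [(x + y) / (A + B)] is the mean of [x / A] and [y / B] with weights [A / (A + B)] and
    [B / (A + B)]. Summed, this gives Minkowski's inequality; its pointwise equality case is what
    [ang_split] exploits. *)
Lemma pow_add_le A B x y n : 0 < A -> 0 < B -> 0 <= x -> 0 <= y ->
  (x + y) ^+ n <= (A + B) ^+ n *
    (A / (A + B) * (x ^+ n / A ^+ n) + B / (A + B) * (y ^+ n / B ^+ n)).
Proof.
move=> A0 B0 x0 y0; have AB : 0 < A + B by rewrite addr_gt0.
have -> : x + y = (A + B) * (A / (A + B) * (x / A) + B / (A + B) * (y / B)).
  by field; rewrite !gt_eqF.
rewrite exprMn ler_wpM2l ?exprn_ge0 ?(ltW AB)// -!expr_div_n.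
apply: pow_convex; rewrite ?divr_ge0 ?(ltW A0) ?(ltW B0) ?(ltW AB)//.
by field; rewrite gt_eqF.
Qed.

Lemma minkowski_pow (T : Type) (F : seq T) (x y : T -> R) A B n :
  0 < A -> 0 < B -> (forall i, 0 <= x i) -> (forall i, 0 <= y i) ->
  \sum_(i <- F) x i ^+ n <= A ^+ n -> \sum_(i <- F) y i ^+ n <= B ^+ n ->
  \sum_(i <- F) (x i + y i) ^+ n <= (A + B) ^+ n.
Proof.
move=> A0 B0 x0 y0 xA yB; have AB : 0 < A + B by rewrite addr_gt0.
rewrite (le_trans (ler_sum _ (fun i _ => pow_add_le n A0 B0 (x0 i) (y0 i))))//.
rewrite -mulr_sumr ler_piMr ?exprn_ge0 ?(ltW AB)//.
rewrite big_split/= -!mulr_sumr -!mulr_suml.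
rewrite (@le_trans _ _ (A / (A + B) * 1 + B / (A + B) * 1))//.
  rewrite lerD// ler_wpM2l ?divr_ge0 ?(ltW A0) ?(ltW B0) ?(ltW AB)//.
    by rewrite ler_pdivrMr ?mul1r// exprn_gt0.
  by rewrite ler_pdivrMr ?mul1r// exprn_gt0.
by rewrite !mulr1 -mulrDl divff// gt_eqF.
Qed.

End PowerMeans.

(** * Alternating products and Hilbert-Schmidt sums *)

Section Words.
Implicit Types (v w x : H) (B : set H) (a b W : H -> H).

(** An alternating product of [k] factors whose rightmost one is [a]; it stands for the power [k] of
    the absolute value of [a]. By [word_nr2] the trace of [iter n (adj a \o a)] is the
    Hilbert-Schmidt sum of [word a n]. *)
Fixpoint word a k : H -> H :=
  if k is j.+1 then (if odd j then adj a else a) \o word a j else idfun.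

Lemma bop_word a k : bop a -> bop (word a k).
Proof.
move=> ba; elim: k => [|k IH]; first exact: bop_id.
by apply: bop_comp => //; case: odd => //; exact: bop_adj.
Qed.

Lemma word_double a k : word a k.*2 = iter k (adj a \o a).
Proof.
elim: k => [//|k IH]; apply/funext => v.
by rewrite doubleS iterS /= odd_double /= IH.
Qed.

Lemma word_shift a i j v : bop a -> odd i != odd j ->
  ip (word a i.+1 v) (word a j v) = ip (word a i v) (word a j.+1 v).
Proof.
move=> ba /=; case: (odd i); case: (odd j) => //= _.
- by rewrite adjEl.
- by rewrite adjE.
Qed.

(** Letters are moved across [ip] one at a time until the [2 n] of them are shared equally by the
    two arguments. *)
Lemma word_nr2 a n v : bop a ->
  ip (iter n (adj a \o a) v) v = (nr (word a n v) ^+ 2)%:C.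
Proof.
move=> ba; rewrite -ipvv -word_double.
suff h k : (k <= n)%N -> ip (word a (n + k) v) (word a (n - k) v) =
    ip (word a n v) (word a n v).
  by have := h n (leqnn _); rewrite subnn addnn.
elim: k => [|k IH] kn; first by rewrite addn0 subn0.
rewrite -IH ?(ltnW kn)// addnS word_shift//; last by lia.
by rewrite subnSK.
Qed.

Lemma word_logconvex a n v : bop a ->
  nr (word a n.+1 v) ^+ 2 <= nr (word a n v) * nr (word a n.+2 v).
Proof.
move=> ba; rewrite nr2E word_shift//; last by rewrite /=; case: odd.
exact: Reip_le.
Qed.

(** By log-convexity the ratios of successive [|word a k v|] do not decrease, and the first ratio is
    [|a v|]. *)
Lemma word_jensen a n v : bop a -> nr v = 1 -> nr (a v) ^+ n <= nr (word a n v).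
Proof.
move=> ba v1.
have h k : nr (a v) * nr (word a k v) <= nr (word a k.+1 v).
  elim: k => [|k IH]; first by rewrite /= v1 mulr1.
  have := word_logconvex k v ba.
  set x1 := nr (a v) in IH *; set xk := nr (word a k v) in IH *.
  set y := nr (word a k.+1 v) in IH *; set z := nr (word a k.+2 v) => h.
  have x10 : 0 <= x1 := nr_ge0 _; have z0 : 0 <= z := nr_ge0 _.
  have [->|y0] := eqVneq y 0; first by rewrite mulr0.
  have y1 : 0 < y by rewrite lt_def y0 nr_ge0.
  rewrite -(ler_pM2r y1); have := ler_wpM2l x10 h.
  have := ler_wpM2r z0 IH; lra.
elim: n => [|n IH]; first by rewrite expr0 /= v1.
by rewrite exprS (le_trans _ (h n))// ler_wpM2l ?nr_ge0.
Qed.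

Definition hs_bound B W (K : R) :=
  forall F, uniq F -> {in F, forall e, B e} -> \sum_(e <- F) nr (W e) ^+ 2 <= K.

Lemma parseval_common B (g : H -> H) (G : seq H) r : orthonormal_basis ip B -> 0 < r ->
  exists E, [/\ uniq E, {in E, forall e, B e} & {in G, forall f,
    nr (g f) ^+ 2 <= \sum_(e <- E) normc (ip (g f) e) ^+ 2 + r}].
Proof.
move=> bB r0.
have mono E E' v : uniq E -> uniq E' -> {subset E <= E'} ->
    \sum_(e <- E) normc (ip v e) ^+ 2 <= \sum_(e <- E') normc (ip v e) ^+ 2.
  move=> uE uE' sub; rewrite (big_subseq _ uE uE' sub) lerDl.
  by apply: sumr_ge0 => e _; exact: sqr_ge0.
elim: G => [|f G [E [uE EB EP]]]; first by exists [::].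
have [E' [uE' E'B E'P]] := parseval (g f) bB r0.
exists (undup (E ++ E')); split; first exact: undup_uniq.
  by move=> e; rewrite mem_undup mem_cat => /orP[/EB|/E'B].
have s1 : {subset E <= undup (E ++ E')} by move=> e; rewrite mem_undup mem_cat => ->.
have s2 : {subset E' <= undup (E ++ E')}.
  by move=> e; rewrite mem_undup mem_cat => ->; rewrite orbT.
move=> h; rewrite inE => /orP[/eqP ->|/EP hP].
  by rewrite (le_trans E'P)// lerD2r mono// undup_uniq.
by rewrite (le_trans hP)// lerD2r mono// undup_uniq.
Qed.

(** The double sum of [|ip (adj W f) e|^2] is compared with one side by Parseval in [e] and with the
    other by Bessel in [f]. Used twice, this shows that the bound does not depend on the basis. *)
Lemma hs_bound_adj B B' W K : orthonormal_basis ip B -> orthonormal_set ip B' ->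
  bop W -> hs_bound B W K -> hs_bound B' (adj W) K.
Proof.
move=> bB oB' bW WK F uF FB'; rewrite -subr_le0.
apply: (@approx_le0 _ (size F)%:R) => r r0.
have [E [uE EB EP]] := parseval_common (adj W) F bB r0.
rewrite lerBlDr big_seq (le_trans (ler_sum _ EP))// -big_seq big_split/= addrC.
rewrite big_const_seq count_predT iter_addr_0 -[in leLHS]mulr_natl lerD2l.
rewrite exchange_big/= (le_trans _ (WK E uE EB))// ler_sum// => e _.
under eq_bigr do rewrite adjEl// ipC normc_conj.
exact: (bessel_set _ oB' uF FB').
Qed.

Lemma adjK W : bop W -> adj (adj W) = W.
Proof.
move=> bW; apply: (adj_uniq (bop_adj bW)) => v w.
exact: adjEl.
Qed.

Lemma hs_bound_basis B B' W K : orthonormal_basis ip B -> orthonormal_set ip B' ->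
  bop W -> hs_bound B W K -> hs_bound B' W K.
Proof.
move=> bB oB' bW WK; rewrite -(adjK bW).
apply: (hs_bound_adj hbasisP oB' (bop_adj bW)).
exact: hs_bound_adj bB hbasisP.1 bW WK.
Qed.

Lemma ons_sum_cs (F : seq H) (x y : H -> R) : ons F ->
  \sum_(e <- F) x e * y e <=
  nr (\sum_(e <- F) (x e)%:C *: e) * nr (\sum_(e <- F) (y e)%:C *: e).
Proof.
move=> oF; rewrite (le_trans _ (Reip_le _ _))// ip_sumr.
rewrite big_seq [X in _ <= Re X]big_seq.
rewrite (eq_bigr (fun e => (x e * y e)%:C)); last first.
  move=> e eF; rewrite ipZr (ip_comb_in (fun e => (x e)%:C) oF eF).
  by rewrite mulrC; apply: complex_eqP => /=; ring.
by rewrite -rmorph_sum.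
Qed.

(** Hilbert-Schmidt operators are compact: [F] leaves at most [r^2] of the sum to the rest of the
    basis, where Cauchy-Schwarz bounds [W v]. *)
Lemma hs_tail B W K : orthonormal_basis ip B -> bop W -> hs_bound B W K ->
  forall r, 0 < r -> exists F, ons F /\
    forall v, {in F, forall f, ip v f = 0} -> nr (W v) <= r * nr v.
Proof.
move=> bB bW WK r r0.
have [F [uF FB FT]] := fin_tail (fun e => sqr_ge0 (nr (W e))) WK (exprn_gt0 2 r0).
exists F; split; first exact: ons_of_set bB.1 uF FB.
move=> v vF; rewrite -subr_le0.
have [k [k0 Wk]] := bW.2.
apply: (@approx_le0 _ k) => s s0.
have [G [uG GB /(_ G uG GB (fun _ => id)) vG]] := expansion v bB s0.
pose G' := [seq e <- G | e \notin F].
have uG' : uniq G' by exact: filter_uniq.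
have GB' : {in G', forall e, B e} by move=> e; rewrite mem_filter => /andP[_ /GB].
have oG' := ons_of_set bB.1 uG' GB'.
have prE : pr G v = pr G' v.
  rewrite /pr (bigID (mem F))/= big1 ?add0r ?big_filter// => e eF.
  by rewrite vF// scale0r.
have h1 : nr (W (v - pr G v)) <= k * s.
  by rewrite (le_trans (Wk _))// ler_wpM2l.
suff h2 : nr (W (pr G' v)) <= r * nr v.
  have := nrD (W (v - pr G v)) (W (pr G v)).
  rewrite -(bopD bW) subrK prE; move: h1; rewrite prE => ? ?; lra.
rewrite /pr (bop_sum bW) (le_trans (nr_sum _ _ _))//.
under eq_bigr do rewrite (bopZ bW) nrZ.
rewrite (le_trans (ons_sum_cs (fun e => normc (ip v e)) (fun e => nr (W e)) oG'))//.
rewrite mulrC ler_pM ?nr_ge0//.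
  rewrite -(@ler_pXn2r _ 2) ?nnegrE ?nr_ge0 ?(ltW r0)//.
  rewrite (nr2_comb (fun e => (nr (W e))%:C) oG').
  under eq_bigr do rewrite normcR (ger0_norm (nr_ge0 _)).
  by apply: FT => // e; rewrite mem_filter => /andP[].
rewrite -(@ler_pXn2r _ 2) ?nnegrE ?nr_ge0//.
rewrite (nr2_comb (fun e => (normc (ip v e))%:C) oG').
under eq_bigr do rewrite normcR (ger0_norm (normc_ge0 _)).
exact: bessel.
Qed.

End Words.

(** * Trigonometric estimates on the unit circle *)

Section Cis.
Implicit Types (s t x : R).

Lemma ge0_of_derive (f df : R -> R) : (forall x, is_derive x 1 f (df x)) -> f 0 = 0 ->
  (forall x, 0 <= x -> 0 <= df x) -> forall x, 0 <= x -> 0 <= f x.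
Proof.
move=> fd f0 df0 x x0.
have cf : {within `[0, x], continuous f}.
  apply: continuous_subspaceT => y; apply: differentiable_continuous.
  by apply/derivable1_diffP; case: (fd y).
have [c cx] := MVT_segment x0 (fun y _ => fd y) cf.
rewrite f0 !subr0 => ->; rewrite mulr_ge0// df0//.
by move: cx; rewrite in_itv/= => /andP[].
Qed.

Lemma sin_le_id x : 0 <= x -> sin x <= x.
Proof.
move=> x0; rewrite -subr_ge0.
apply: (@ge0_of_derive (id - @sin R) (fun x => 1 - cos x) _ _ _ _ x0) => [|y _].
- by rewrite !fctE sin0 subrr.
- by rewrite subr_ge0 cos_le1.
Qed.

Lemma one_sub_cos x : 1 - cos x = 2 * sin (x / 2) ^+ 2.
Proof.
have -> : cos x = cos ((x / 2) *+ 2) by congr cos; lra.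
by have := cos2Dsin2 (x / 2); rewrite cos_mulr2n -mulr_natl => ?; lra.
Qed.

Lemma sin_abs_le x : `|sin x| <= `|x|.
Proof.
wlog x0 : x / 0 <= x.
  by move=> h; have [/h//|/ltW] := leP 0 x; rewrite -oppr_ge0 => /h; rewrite sinN !normrN.
rewrite (ger0_norm x0) ler_norml sin_le_id// andbT.
have [xp|xp] := leP x pi.
  by rewrite (le_trans _ (sin_ge0_pi _)) ?x0// oppr_le0.
rewrite (le_trans _ (sin_geN1 x))// lerN2 (le_trans _ (ltW xp))//.
by have := pi_ge2 R; lra.
Qed.

Lemma cos_ge x : 1 - x ^+ 2 / 2 <= cos x.
Proof.
have : sin (x / 2) ^+ 2 <= (x / 2) ^+ 2.
  by rewrite -(real_normK (num_real (sin _))) -(real_normK (num_real (x / 2)))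
    ler_pXn2r ?nnegrE ?normr_ge0// sin_abs_le.
have := one_sub_cos x; rewrite expr_div_n (_ : 2 ^+ 2 = 4 :> R); first lra.
by ring.
Qed.

Lemma sin_ge x : 0 <= x -> x - x ^+ 3 / 6 <= sin x.
Proof.
move=> x0; rewrite -subr_ge0.
pose f : R -> R := @sin R - (id - 6^-1 *: (id ^+ 3)).
pose df x : R := cos x - (1 - x ^+ 2 / 2).
have -> : sin x - (x - x ^+ 3 / 6) = f x.
  by rewrite /f !fctE /=; congr (_ - (_ - _)); rewrite /GRing.scale/= mulrC.
apply: (@ge0_of_derive f df _ _ _ _ x0) => [y||y _].
- apply: is_derive_eq; rewrite /df /GRing.scale /=.
  by congr (_ - (_ - _)); field.
- by rewrite /f !fctE sin0 /GRing.scale /= expr0n/= mulr0 !subr0.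
- by rewrite /df subr_ge0 cos_ge.
Qed.

(** With [y = x / 2] the right side is [4 sin(y)^2], and squaring [sin y >= y - y^3 / 6] gives
    [4 y^2 - 4 y^4 / 3] up to a nonnegative term. The squaring needs [y - y^3 / 6 >= 0], which holds
    for [x^2 <= 12]; beyond that the left side is negative. *)
Lemma cos_sub_le x : x ^+ 2 - x ^+ 4 / 12 <= 2 - 2 * cos x.
Proof.
have [x3|x3] := leP (x ^+ 2) 12; last first.
  have c1 := cos_le1 x.
  have : 0 <= x ^+ 2 * (x ^+ 2 - 12) by rewrite mulr_ge0 ?sqr_ge0// subr_ge0 ltW.
  rewrite (_ : x ^+ 4 = x ^+ 2 * x ^+ 2); [lra|ring].
wlog x0 : x x3 / 0 <= x.
  move=> h; have [/h->//|/ltW] := leP 0 x.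
  rewrite -oppr_ge0 => /h; rewrite cosN sqrrN => /(_ x3).
  by rewrite (_ : (- x) ^+ 4 = x ^+ 4) //; ring.
have y0 : 0 <= x / 2 by rewrite divr_ge0.
have h1 := one_sub_cos x.
have := sin_ge y0; set y := x / 2 in y0 h1 *.
have xE : x = 2 * y by rewrite /y; field.
clearbody y; rewrite xE in h1 *.
have y3 : y ^+ 2 <= 3 by move: x3; rewrite xE exprMn => ?; lra.
have z0 : 0 <= y - y ^+ 3 / 6.
  have : 0 <= y * (6 - y ^+ 2) by rewrite mulr_ge0//; lra.
  by rewrite (_ : y ^+ 3 = y * y ^+ 2); [lra|ring].
move=> h; have : (y - y ^+ 3 / 6) ^+ 2 <= sin y ^+ 2.
  by rewrite ler_pXn2r ?nnegrE// (le_trans z0).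
move=> h2.
have : (y - y ^+ 3 / 6) ^+ 2 = y ^+ 2 - y ^+ 4 / 3 + (y ^+ 3) ^+ 2 / 36 by field.
have := sqr_ge0 (y ^+ 3).
rewrite !exprMn (_ : 2 ^+ 2 = 4 :> R); last by ring.
rewrite (_ : 2 ^+ 4 = 16 :> R); last by ring.
lra.
Qed.

Lemma sin_sub_id_le x : `|x| <= 1 -> `|sin x - x| <= x ^+ 2.
Proof.
wlog x0 : x / 0 <= x.
  move=> h; have [/h//|/ltW] := leP 0 x.
  rewrite -oppr_ge0 => /h; rewrite normrN sinN sqrrN => h1 /h1.
  by rewrite -opprD normrN.
rewrite (ger0_norm x0) => x1.
have h1 := sin_le_id x0; have h2 := sin_ge x0.
rewrite ler0_norm; last by rewrite subr_le0.
have : x ^+ 3 <= x ^+ 2 by rewrite exprS ler_piMl ?sqr_ge0.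
have := exprn_ge0 2 x0; lra.
Qed.

Definition cis t : R[i] := cos t +i* sin t.

Lemma normc_cis t : normc (cis t) = 1.
Proof. by rewrite /= cos2Dsin2 sqrtr1. Qed.

Lemma cis0 : cis 0 = 1.
Proof. by rewrite /cis cos0 sin0. Qed.

Lemma cisD s t : cis (s + t) = cis s * cis t.
Proof. by apply: complex_eqP; rewrite ?ReM ?ImM /= ?cosD ?sinD; ring. Qed.

Lemma cisN t : cis (- t) = Num.conj (cis t).
Proof. by apply: complex_eqP; rewrite ?Re_conj ?Im_conj /= ?cosN ?sinN. Qed.

Lemma cis_conj t : Num.conj (cis t) * cis t = 1.
Proof. by rewrite -cisN -cisD addNr cis0. Qed.

Lemma normc_cis_sub1 t : normc (cis t - 1) ^+ 2 = 2 - 2 * cos t.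
Proof.
rewrite normc2 ReD ImD ReN ImN /= oppr0 addr0.
have := cos2Dsin2 t; rewrite sqrrB expr1n mulr1 => ?; lra.
Qed.

Lemma cis_sub1_le t : normc (cis t - 1) <= `|t|.
Proof.
rewrite -(@ler_pXn2r _ 2) ?nnegrE ?normc_ge0// normc_cis_sub1.
by rewrite real_normK ?num_real//; have := cos_ge t; lra.
Qed.

Lemma cis_sub1_ge t : `|t| <= pi ->
  Num.sqrt (1 - pi ^+ 2 / 12) * `|t| <= normc (cis t - 1).
Proof.
move=> tp; have [c0|c0] := leP (1 - pi ^+ 2 / 12 : R) 0.
  by rewrite ler0_sqrtr// mul0r normc_ge0.
rewrite -(@ler_pXn2r _ 2) ?nnegrE ?normc_ge0 ?mulr_ge0 ?sqrtr_ge0// normc_cis_sub1.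
rewrite exprMn sqr_sqrtr ?(ltW c0)// real_normK ?num_real//.
rewrite (le_trans _ (cos_sub_le t))//.
have : t ^+ 2 <= pi ^+ 2.
  by rewrite -(real_normK (num_real t)) ler_pXn2r// nnegrE pi_ge0.
have -> : t ^+ 4 = t ^+ 2 * t ^+ 2 by ring.
move=> h; have := ler_wpM2l (sqr_ge0 t) h; lra.
Qed.

(** A cruder bound than [cis_sub1_ge], for the places where a nonzero constant is required: it rests
    on [pi < 4], while positivity of [1 - pi^2/12] amounts to [pi^2 < 12]. *)
Lemma cis_sub1_ge4 t : `|t| <= pi -> `|t| <= 4 * normc (cis t - 1).
Proof.
wlog t0 : t / 0 <= t.
  move=> h; have [/h//|/ltW] := leP 0 t; rewrite -oppr_ge0 => /h; rewrite normrN.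
  have -> : cis (- t) - 1 = Num.conj (cis t - 1).
    by rewrite cisN; apply: complex_eqP; rewrite ?Re_conj ?Im_conj ?ReD ?ImD ?Re_conj ?Im_conj ?ReN ?ImN /=; ring.
  by rewrite normc_conj.
rewrite (ger0_norm t0) => tp.
rewrite -(@ler_pXn2r _ 2) ?nnegrE ?mulr_ge0 ?normc_ge0// exprMn normc_cis_sub1.
have [c|c] := leP (cos t) 0.
  have : t ^+ 2 <= 4 ^+ 2.
    rewrite ler_pXn2r ?nnegrE// (le_trans tp)//.
    by have := pihalf_lt2 R; lra.
  by rewrite (_ : 4 ^+ 2 = 16 :> R); [lra|ring].
(* Since [pi / 2 < 2], a positive cosine keeps [t] below 2, where [t^4 <= 4 t^2]. *)
have t2 : t <= 2.
  rewrite leNgt; apply/negP => t2.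
  have p2 := pihalf_lt2 R.
  have tpi : - (pi / 2) <= t - pi <= pi / 2 by apply/andP; split; lra.
  have := cos_ge0_pihalf tpi; rewrite cosB cospi sinpi => ?; lra.
have := cos_sub_le t.
have : t ^+ 4 <= 4 * t ^+ 2.
  have : t ^+ 2 <= 2 ^+ 2 by rewrite ler_pXn2r ?nnegrE.
  rewrite (_ : t ^+ 4 = t ^+ 2 * t ^+ 2); last by ring.
  move=> h; have := ler_wpM2l (sqr_ge0 t) h.
  by rewrite (_ : 2 ^+ 2 = 4 :> R); [lra|ring].
rewrite (_ : 4 ^+ 2 = 16 :> R); last by ring.
have := sqr_ge0 t; lra.
Qed.

Lemma cis_taylor1 t : `|t| <= 1 -> normc (cis t - 1 - t *i) <= 2 * t ^+ 2.
Proof.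
move=> t1; have -> : cis t - 1 - t *i = (cos t - 1)%:C + (sin t - t) *i.
  by apply: complex_eqP; rewrite !(ReD, ImD, ReN, ImN) /=; ring.
rewrite (le_trans (le_normcD _ _))// normcR.
have -> : normc ((sin t - t) *i) = `|sin t - t|.
  by rewrite /= expr0n/= add0r sqrtr_sqr.
have := sin_sub_id_le t1; have := cos_ge t; have := cos_le1 t.
have -> : `|cos t - 1| = 1 - cos t by rewrite ler0_norm ?opprB// subr_le0 cos_le1.
have := sqr_ge0 t; lra.
Qed.

Lemma cis_arg (z : R[i]) : normc z = 1 -> exists t, `|t| <= pi /\ z = cis t.
Proof.
move=> z1; have z2 := normc2 z; rewrite z1 expr1n in z2.
have r1 : -1 <= Re z <= 1.
  by rewrite -ler_norml -z1 Re_le_normc.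
have a0 := acos_ge0 r1; have ap := acos_lepi r1.
have ck : cos (acos (Re z)) = Re z by rewrite acosK// in_itv.
have sE : sin (acos (Re z)) = `|Im z|.
  by rewrite sin_acos// -sqrtr_sqr; congr Num.sqrt; lra.
have [i0|i0] := leP 0 (Im z).
  exists (acos (Re z)); rewrite ger0_norm//; split => //.
  by apply: complex_eqP; rewrite /= ?ck// sE ger0_norm.
exists (- acos (Re z)); rewrite normrN ger0_norm//; split => //.
by apply: complex_eqP; rewrite /= ?cosN ?sinN ?ck// sE ltr0_norm// opprK.
Qed.

Lemma cis_inj s t : `|s| < pi -> `|t| < pi -> cis s = cis t -> s = t.
Proof.
move=> sp tp [cE sE].
have abs x : `|x| < pi -> cos x = cos `|x| /\ `|x| \in `[0, pi].
  by move=> /ltW xp; rewrite cos_norm in_itv/= normr_ge0.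
have [cs si] := abs _ sp; have [ct ti] := abs _ tp.
have stE : `|s| = `|t| by apply: cos_inj => //; rewrite -cs -ct.
have [s0|s0] := leP 0 s; have [t0|t0] := leP 0 t.
- by move: stE; rewrite !ger0_norm.
- move: stE; rewrite (ger0_norm s0) (ltr0_norm t0) => st.
  have : 0 < sin (- t) by apply: sin_gt0_pi; rewrite oppr_gt0 t0/= -(ltr0_norm t0).
  have : 0 <= sin s by apply: sin_ge0_pi; rewrite s0/= -(ger0_norm s0) ltW.
  by rewrite sE sinN => ? ?; exfalso; lra.
- move: stE; rewrite (ltr0_norm s0) (ger0_norm t0) => st.
  have : 0 < sin (- s) by apply: sin_gt0_pi; rewrite oppr_gt0 s0/= -(ltr0_norm s0).
  have : 0 <= sin t by apply: sin_ge0_pi; rewrite t0/= -(ger0_norm t0) ltW.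
  by rewrite -sE sinN => ? ?; exfalso; lra.
- by move: stE; rewrite !ltr0_norm// => /oppr_inj.
Qed.

End Cis.

(** * The exponential series on the imaginary axis *)

Section CisSeries.
Implicit Types (s t : R).

Definition cis_sum n t : R[i] := \sum_(k < n) (k`!%:R^-1 : R[i]) * (t *i) ^+ k.

Lemma natc (n : nat) : (n%:R : R[i]) = (n%:R)%:C.
Proof. by rewrite rmorph_nat. Qed.

Lemma sumRe n (f : 'I_n -> R[i]) : Re (\sum_(k < n) f k) = \sum_(k < n) Re (f k).
Proof. by elim/big_rec2 : _ => [//|i x y _ <-]; rewrite ReD. Qed.

Lemma sumIm n (f : 'I_n -> R[i]) : Im (\sum_(k < n) f k) = \sum_(k < n) Im (f k).
Proof. by elim/big_rec2 : _ => [//|i x y _ <-]; rewrite ImD. Qed.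

Lemma imag_exp t k : (t *i) ^+ k =
  ((~~ odd k)%:R * (-1) ^+ k./2 * t ^+ k) +i* ((odd k)%:R * (-1) ^+ k.-1./2 * t ^+ k).
Proof.
have sq m : (t *i) ^+ m.*2 = ((-1) ^+ m * t ^+ m.*2)%:C.
  rewrite -muln2 mulnC exprM (_ : (t *i) ^+ 2 = (- t ^+ 2)%:C).
    by rewrite -(rmorphXn (real_complex R)) /= [in RHS]exprM -exprNn.
  by rewrite expr2; apply: complex_eqP; rewrite ?ReM ?ImM /=; ring.
rewrite -[k]odd_double_half; case: (odd k) => /=.
  rewrite add0n add1n exprS sq odd_double/= doubleK uphalf_double.
  by apply: complex_eqP; rewrite ?ReM ?ImM /= ?exprS; ring.
rewrite add0n sq odd_double /= doubleK.
by apply: complex_eqP => /=; ring.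
Qed.

Lemma Re_cis_sum n t : Re (cis_sum n t) = series (cos_coeff t) n.
Proof.
rewrite /cis_sum sumRe seriesEord; apply: eq_bigr => k _.
by rewrite natc -fmorphV ReM imag_exp /= mul0r subr0 mulrC.
Qed.

Lemma Im_cis_sum n t : Im (cis_sum n t) = series (sin_coeff t) n.
Proof.
rewrite /cis_sum sumIm seriesEord; apply: eq_bigr => k _.
by rewrite natc -fmorphV ImM imag_exp /= mul0r addr0 mulrC.
Qed.

Lemma normc_sum (I : Type) (r : seq I) (P : pred I) (f : I -> R[i]) :
  normc (\sum_(i <- r | P i) f i) <= \sum_(i <- r | P i) normc (f i).
Proof.
elim/big_ind2 : _ => [|x a y b xa yb|//]; first by rewrite normc0.
by rewrite (le_trans (le_normcD _ _))// lerD.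
Qed.

Lemma cis_sum_sub n m t K : `|t| <= K -> (n <= m)%N ->
  normc (cis_sum m t - cis_sum n t) <=
  series (exp_coeff K) m - series (exp_coeff K) n.
Proof.
move=> tK nm; rewrite /cis_sum sub_series_geq//.
rewrite -(big_mkord xpredT (fun k => (k`!%:R^-1 : R[i]) * (t *i) ^+ k)).
rewrite -(big_mkord xpredT (fun k => (k`!%:R^-1 : R[i]) * (t *i) ^+ k)).
rewrite (@big_cat_nat _ _ _ n 0%N m)//= addrAC subrr add0r.
rewrite (le_trans (normc_sum _ _ _))//; apply: ler_sum => k _.
rewrite normcM natc -fmorphV normcR ger0_norm ?invr_ge0// mulrC.
rewrite /exp_coeff /= ler_wpM2r ?invr_ge0//.
have -> : normc ((t *i) ^+ k) = `|t| ^+ k.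
  elim: k => [|k IH]; first by rewrite !expr0 normc1.
  by rewrite !exprS normcM IH /= expr0n/= add0r sqrtr_sqr.
by apply: lerXn2r => //; rewrite nnegrE// (le_trans _ tK).
Qed.

(** The terms are dominated by those of the exponential series at [K], so one [N] serves all [t].
    This uniformity turns the scalar limit into a limit in operator norm. *)
Lemma cis_series K e : 0 < e -> exists N, forall n t, (N <= n)%N -> `|t| <= K ->
  normc (cis_sum n t - cis t) <= e.
Proof.
move=> e0; have := @is_cvg_series_exp_coeff R K => /cvg_cauchy/cauchy_seriesP.
have := @is_cvg_series_exp_coeff R K => /cvg_ex[l /cvgrPdist_lt el].
move=> _; have e2 : 0 < e / 2 by rewrite divr_gt0.
have [N _ NP] := el _ e2.
exists N => n t Nn tK; rewrite -subr_le0.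
apply: (@approx_le0 _ 2) => r r0.
have cc : series (cos_coeff t) n @[n --> \oo] --> cos t.
  by rewrite unlock; exact: is_cvg_series_cos_coeff.
have cs : series (sin_coeff t) n @[n --> \oo] --> sin t.
  by rewrite unlock; exact: is_cvg_series_sin_coeff.
move/cvgrPdist_lt : cc => /(_ _ r0)[N1 _ N1P].
move/cvgrPdist_lt : cs => /(_ _ r0)[N2 _ N2P].
pose m := maxn n (maxn N1 N2).
have nm : (n <= m)%N by rewrite leq_maxl.
have h1 := cis_sum_sub tK nm.
have h2 := NP n Nn; have h3 := NP m (leq_trans Nn nm).
have h4 : series (exp_coeff K) m - series (exp_coeff K) n <= e.
  have := ler_normB (l - series (exp_coeff K) n) (l - series (exp_coeff K) m).
  rewrite (_ : l - _ - (l - _) = series (exp_coeff K) m - series (exp_coeff K) n); last by ring.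
  have := ler_norm (series (exp_coeff K) m - series (exp_coeff K) n).
  move: h2 h3 => /= h2 h3 *; lra.
have m1 : (N1 <= m)%N by rewrite (leq_trans (leq_maxl N1 N2))// leq_maxr.
have m2 : (N2 <= m)%N by rewrite (leq_trans (leq_maxr N1 N2))// leq_maxr.
have h5 : normc (cis t - cis_sum m t) <= 2 * r.
  have -> : cis t - cis_sum m t = (cos t - series (cos_coeff t) m)%:C
      + (sin t - series (sin_coeff t) m) *i.
    apply: complex_eqP; rewrite !(ReD, ImD, ReN, ImN) ?Re_cis_sum ?Im_cis_sum /=; ring.
  rewrite (le_trans (le_normcD _ _))// normcR.
  have -> : normc ((sin t - series (sin_coeff t) m) *i)
      = `|sin t - series (sin_coeff t) m|.
    by rewrite /= expr0n/= add0r sqrtr_sqr.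
  have /= := N1P m m1; have /= := N2P m m2; move=> *; lra.
have : normc (cis_sum n t - cis t) <=
    normc (cis_sum m t - cis_sum n t) + normc (cis t - cis_sum m t).
  rewrite -normcN opprB (_ : cis t - cis_sum n t =
    (cis_sum m t - cis_sum n t) + (cis t - cis_sum m t)); last by ring.
  exact: le_normcD.
move=> *; lra.
Qed.

End CisSeries.

(** * Diagonal operators *)

Section Diagonal.
Context (B : set H) (bB : orthonormal_basis ip B).
Implicit Types (v w : H) (a b : H -> H) (l m : H -> R[i]).

Definition diag l a := bop a /\ forall e, B e -> a e = l e *: e.

Lemma diag_ip l a v e : diag l a -> B e -> ip (a v) e = l e * ip v e.
Proof.
move=> [ba ae] Be; rewrite adjE//.
suff -> : adj a e = Num.conj (l e) *: e by rewrite ipZr conjCK.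
apply: (basis_ext bB) => f Bf; rewrite adjEl// ae// ipZl ipZr bB.1//.
by case: eqP => [->//|_]; rewrite !mulr0.
Qed.

Lemma diag_intro l a : bop a -> (forall v e, B e -> ip (a v) e = l e * ip v e) ->
  diag l a.
Proof.
move=> ba h; split => // e Be; apply: (basis_ext bB) => f Bf.
rewrite h// ipZl bB.1//; case: eqP => [->//|_]; by rewrite !mulr0.
Qed.

Lemma diag_uniq l m a b : diag l a -> diag m b -> (forall e, B e -> l e = m e) ->
  a = b.
Proof.
move=> da db lm; apply/funext => v; apply: (basis_ext bB) => e Be.
by rewrite (diag_ip v da)// (diag_ip v db)// lm.
Qed.

(** Parseval passes from coefficients to norms. Through [diag_pn_dom], this reduces Schatten
    estimates for exponentials and logarithms to scalar ones. *)
Lemma diag_dom l m a b k : 0 <= k -> diag l a -> diag m b ->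
  (forall e, B e -> normc (l e) <= k * normc (m e)) ->
  forall v, nr (a v) <= k * nr (b v).
Proof.
move=> k0 da db lm v; apply: (parseval_le k0 bB) => e Be.
rewrite (diag_ip v da)// (diag_ip v db)// !normcM mulrA ler_wpM2r ?normc_ge0//.
exact: lm.
Qed.

Lemma diag_id : diag (fun=> 1) idfun.
Proof. by split; [exact: bop_id|move=> e _; rewrite scale1r]. Qed.

Lemma diag_bound l a k : 0 <= k -> diag l a -> (forall e, B e -> normc (l e) <= k) ->
  opbound a k.
Proof.
move=> k0 da lk; split => // v; apply: (diag_dom k0 da diag_id) => e Be.
by rewrite normc1 mulr1 lk.
Qed.

Lemma basis_nr e : B e -> nr e = 1.
Proof. by move=> Be; apply: unit_of_ip; rewrite bB.1 ?eqxx. Qed.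

Lemma diag_le_bound l a k e : diag l a -> opbound a k -> B e -> normc (l e) <= k.
Proof.
move=> [_ ae] [_ ak] Be; have := ak e.
by rewrite ae// nrZ basis_nr// !mulr1.
Qed.

Lemma diag_exists l k : 0 <= k -> (forall e, B e -> normc (l e) <= k) ->
  exists a, diag l a.
Proof.
move=> k0 lk.
have /choice[a aP] v : exists w, forall e, B e -> ip w e = l e * ip v e.
  have cK F : uniq F -> {in F, forall x, B x} ->
      \sum_(x <- F) normc (l x * ip v x) ^+ 2 <= k ^+ 2 * nr v ^+ 2.
    move=> uF FB; rewrite (le_trans _ (ler_wpM2l (sqr_ge0 k) (bessel_set v bB.1 uF FB)))//.
    rewrite mulr_sumr big_seq [leRHS]big_seq; apply: ler_sum => e eF.
    rewrite normcM exprMn ler_wpM2r ?sqr_ge0// ler_pXn2r ?nnegrE ?normc_ge0//.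
    exact/lk/FB.
  by have [w [wP _]] := riesz_fischer bB.1 cK; exists w.
exists a; apply: diag_intro => //; split.
  move=> c v w; apply: (basis_ext bB) => e Be.
  by rewrite aP// !ipDl !ipZl !aP//; ring.
exists k; split => // v; apply: (parseval_le k0 bB) => e Be.
by rewrite aP// normcM ler_wpM2r ?normc_ge0// lk.
Qed.

Lemma diag_comp l m a b : diag l a -> diag m b -> diag (fun e => l e * m e) (a \o b).
Proof.
move=> da db; apply: diag_intro; first exact: bop_comp da.1 db.1.
by move=> v e Be /=; rewrite (diag_ip _ da)// (diag_ip _ db)// mulrA.
Qed.

Lemma diag_add l m a b : diag l a -> diag m b -> diag (fun e => l e + m e) (a + b).
Proof.
move=> da db; split; first exact: bop_add da.1 db.1.
by move=> e Be; rewrite opaddE da.2// db.2// scalerDl.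
Qed.

Lemma diag_scale c l a : diag l a -> diag (fun e => c * l e) (c *: a).
Proof.
move=> da; split; first exact: bop_scale da.1.
by move=> e Be; rewrite opscaleE da.2// scalerA.
Qed.

Lemma diag_sub l m a b : diag l a -> diag m b -> diag (fun e => l e - m e) (a - b).
Proof.
move=> da db; split; first exact: bop_sub da.1 db.1.
by move=> e Be; rewrite opsubE da.2// db.2// scalerBl.
Qed.

Lemma diag_ext l m a : diag l a -> (forall e, B e -> l e = m e) -> diag m a.
Proof. by move=> [ba ae] lm; split => // e Be; rewrite ae// lm. Qed.

Lemma diag_iter k l a : diag l a -> diag (fun e => l e ^+ k) (iter k a).
Proof.
move=> da; elim: k => [|k IH]; first by apply: diag_ext diag_id _.
by apply: (diag_ext (diag_comp da IH)) => e _; rewrite exprS.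
Qed.

Lemma diag_adj l a : diag l a -> diag (fun e => Num.conj (l e)) (adj a).
Proof.
move=> da; apply: diag_intro; first by apply: bop_adj => //; exact: da.1.
move=> v e Be; rewrite adjEl; last exact: da.1.
by rewrite da.2// ipZr.
Qed.

Lemma diag_sum (I : Type) (r : seq I) (l : I -> H -> R[i]) (a : I -> H -> H) :
  (forall i, diag (l i) (a i)) ->
  diag (fun e => \sum_(i <- r) l i e) (\sum_(i <- r) a i).
Proof.
move=> da; elim: r => [|i r IH].
  rewrite big_nil; split; first exact: bop_zero.
  by move=> e _; rewrite big_nil scale0r.
rewrite big_cons; apply: (diag_ext (diag_add (da i) IH)) => e _.
by rewrite big_cons.
Qed.

Lemma normc_imag (t : R) : normc (t *i) = `|t|.
Proof. by rewrite /= expr0n/= add0r sqrtr_sqr. Qed.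

Lemma diag_skew (t : H -> R) a : diag (fun e => (t e) *i) a -> adj a = - a.
Proof.
move=> da; have db := diag_scale (-1) da; rewrite scaleN1r in db.
apply: (diag_uniq (diag_adj da) db) => e Be.
by apply: complex_eqP; rewrite ?Re_conj ?Im_conj ?ReM ?ImM /=; ring.
Qed.

End Diagonal.

Lemma cvge0P (T : Type) (F : set_system T) (FF : Filter F) (f : T -> \bar R) :
  (forall t, (0 <= f t)%E) ->
  (f @ F --> (0 : \bar R)) <->
  (forall e : R, 0 < e -> \forall t \near F, (f t <= e%:E)%E).
Proof.
move=> f0; split=> [/fine_cvgP[ff /cvgrPdist_le fl] e e0|h].
  have := fl e e0; apply: filterS2 ff => t ft; rewrite sub0r normrN /= => h.
  by rewrite -(fineK ft) lee_fin (le_trans (ler_norm _)).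
apply/fine_cvgP; split.
  have := h 1 ltr01; apply: filterS => t ft; rewrite ge0_fin_numE//.
  exact: le_lt_trans ft (ltry _).
apply/cvgrPdist_le => e e0; have := h e e0; apply: filterS => t ft.
have fin : f t \is a fin_num by rewrite ge0_fin_numE// (le_lt_trans ft)// ltry.
rewrite sub0r normrN /= ger0_norm ?fine_ge0//.
by rewrite -lee_fin fineK.
Qed.

Notation diagi B th := (diag B (fun e => (th e) *i)).

(** * Exponentials of diagonal operators *)

Section Exponential.
Context (B : set H) (bB : orthonormal_basis ip B).

(** The partial sums are diagonal with eigenvalues [cis_sum n (t e)], which converge uniformly on
    the spectrum. Limits in operator norm are unique, so the operator chosen by [get] is [u]. *)
Lemma opexp_diag (t : H -> R) (K : R) (x u : H -> H) :
  diagi B t x -> diag B (fun e => cis (t e)) u ->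
  (forall e, B e -> `|t e| <= K) -> opexp x = u.
Proof.
move=> dx du tK.
pose S n : H -> H := \sum_(k < n) (k`!%:R^-1 : R[i]) *: iter k x.
have dS n : diag B (fun e => cis_sum n (t e)) (S n).
  apply: diag_sum => k; apply: diag_scale; exact: (diag_iter bB).
have Su : forall e : R, 0 < e -> exists N, forall n, (N <= n)%N -> opbound (S n - u) e.
  move=> e e0; have [N NP] := cis_series K e0; exists N => n Nn.
  apply: (diag_bound bB (ltW e0) (diag_sub (dS n) du)) => f Bf.
  by apply: NP => //; exact: tK.
have P (w : H -> H) : bop w -> (opnorm (S n - w) @[n --> \oo] --> (0 : \bar R)) <->
    (forall e : R, 0 < e -> exists N, forall n, (N <= n)%N -> opbound (S n - w) e).
  move=> bw; have lw n : linear (S n - w) by exact: (bop_sub (dS n).1 bw).1.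
  rewrite cvge0P; last by move=> n; exact: opnorm_ge0.
  split=> h e e0; have [N] := h e e0.
    by move=> _ NP; exists N => n Nn; apply/opnorm_le => //; [exact: ltW|exact: NP].
  by move=> NP; exists N => // n /= Nn; apply/opnorm_le => //; [exact: ltW|exact: NP].
have [b1 b2] : [set e | bounded_op e /\
    opnorm ((\sum_(k < n) (k`!%:R^-1 : R[i]) *: iter k x) - e)
      @[n --> \oo] --> (0 : \bar R)] (opexp x).
  apply: (@getPex _ [set e | bounded_op e /\ _]); exists u; split.
    by apply/bounded_opE; exact: du.1.
  by apply/P => //; exact: du.1.
have {}b1 : bop (opexp x) by exact/bounded_opE.
move/(P _ b1) : b2 => b2.
apply/funext => v; apply/eqP; rewrite -subr_eq0 -nr_eq0 eq_le nr_ge0 andbT.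
apply: (@approx_le0 _ (2 * nr v)) => r r0.
have [N NP] := b2 r r0; have [N' N'P] := Su r r0.
have [_ h1] := NP (maxn N N') (leq_maxl _ _).
have [_ h2] := N'P (maxn N N') (leq_maxr _ _).
have := nr_triangle (opexp x v) (S (maxn N N') v) (u v).
have := h1 v; have := h2 v; rewrite !opsubE (nrBC _ (opexp x v)) => *; lra.
Qed.

End Exponential.

(** * Angles on the unit sphere *)

Section Angles.
Implicit Types (x y z w : H).

(** The angular distance on the sphere of the underlying real Hilbert space. Taking the real part,
    not the modulus, of [ip] makes it see the phase of [cis t *: x]. *)
Definition ang x y : R := acos (Re (ip x y)).

Lemma Reip_unit x y : nr x = 1 -> nr y = 1 -> -1 <= Re (ip x y) <= 1.
Proof.
move=> x1 y1; rewrite -ler_norml (le_trans (Re_le_normc _))//.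
by rewrite (le_trans (cauchy_schwarz _ _))// x1 y1 mulr1.
Qed.

Lemma ang_itv x y : nr x = 1 -> nr y = 1 -> 0 <= ang x y <= pi.
Proof.
by move=> x1 y1; rewrite acos_ge0 ?acos_lepi// Reip_unit.
Qed.

Lemma cos_ang x y : nr x = 1 -> nr y = 1 -> cos (ang x y) = Re (ip x y).
Proof. by move=> x1 y1; rewrite acosK// in_itv/= Reip_unit. Qed.

Lemma le_cos_itv (s t : R) : 0 <= s <= pi -> 0 <= t <= pi -> cos t <= cos s -> s <= t.
Proof.
move=> si ti; apply: contraTT; rewrite -!ltNge => ts.
by rewrite ltr_cos// in_itv/=.
Qed.

(** Removing the real components along [y] leaves [x'] and [z'] of norms [sin a] and [sin b].
    Cauchy-Schwarz for them gives [cos (ang x z) >= cos a cos b - sin a sin b = cos (a + b)]. *)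
Lemma ang_triangle x y z : nr x = 1 -> nr y = 1 -> nr z = 1 ->
  ang x z <= ang x y + ang y z.
Proof.
move=> x1 y1 z1.
have /andP[a0 ap] := ang_itv x1 y1; have /andP[b0 bp] := ang_itv y1 z1.
have /andP[c0 cp] := ang_itv x1 z1.
set a := ang x y in a0 ap *; set b := ang y z in b0 bp *.
have [h|h] := leP pi (a + b); first exact: le_trans h.
apply: le_cos_itv; rewrite ?c0 ?cp// ?addr_ge0 ?(ltW h)//.
rewrite cos_ang// cosD.
pose x' := x - (cos a)%:C *: y; pose z' := z - (cos b)%:C *: y.
have yy : ip y y = 1 by rewrite ipvv y1 expr1n.
have xy : Re (ip x y) = cos a by rewrite cos_ang.
have yz : Re (ip y z) = cos b by rewrite cos_ang.
have conjR (r : R) : Num.conj r%:C = r%:C by apply: complex_eqP => //=; rewrite oppr0.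
have xz' : Re (ip x' z') = Re (ip x z) - cos a * cos b.
  rewrite !ipBl !ipBr !ipZl !ipZr yy !conjR !(ReD, ReN, ReM) /= xy yz; ring.
have nx' : nr x' = sin a.
  apply/eqP; rewrite -(@eqrXn2 _ 2) ?nr_ge0 ?sin_ge0_pi ?a0//.
  rewrite sin2cos2 nr2E !ipBl !ipBr !ipZl !ipZr yy !conjR.
  rewrite !(ReD, ReN, ReM) /= (ReipC y x) xy -nr2E x1.
  by apply/eqP; ring.
have nz' : nr z' = sin b.
  apply/eqP; rewrite -(@eqrXn2 _ 2) ?nr_ge0 ?sin_ge0_pi ?b0//.
  rewrite sin2cos2 nr2E !ipBl !ipBr !ipZl !ipZr yy !conjR.
  rewrite !(ReD, ReN, ReM) /= (ReipC z y) yz -nr2E z1.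
  by apply/eqP; ring.
have := Reip_le x' (- z'); rewrite ipNr ReN xz' nrN nx' nz'; lra.
Qed.

Lemma angC x y : ang x y = ang y x.
Proof. by rewrite /ang ReipC. Qed.

Lemma chord_ang x y : nr x = 1 -> nr y = 1 -> nr (x - y) ^+ 2 = 2 - 2 * cos (ang x y).
Proof. by move=> x1 y1; rewrite nrB2 x1 y1 cos_ang// expr1n; ring. Qed.

Lemma ang_chord (e : R) : 0 < e -> exists d, 0 < d /\ forall x y,
  nr x = 1 -> nr y = 1 -> nr (x - y) < d -> ang x y <= (1 + e) * nr (x - y).
Proof.
wlog e1 : e / e <= 1.
  move=> h e0; have [/h/(_ e0)//|/ltW e1] := leP e 1.
  have [d [d0 dP]] := h 1 (lexx _) ltr01; exists d; split => // x y x1 y1 xy.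
  by rewrite (le_trans (dP _ _ x1 y1 xy))// ler_wpM2r ?nr_ge0// lerD2l.
move=> e0; exists (e / 2); split; first by rewrite divr_gt0.
move=> x y x1 y1 xyd; have /andP[a0 ap] := ang_itv x1 y1.
have c2 := chord_ang x1 y1; set c := nr (x - y) in c2 xyd *.
set t := ang x y in a0 ap c2 *.
have c0 : 0 <= c by exact: nr_ge0.
have t4 : t <= 4 * c.
  have := @cis_sub1_ge4 t; rewrite (ger0_norm a0) => /(_ ap).
  have -> : normc (cis t - 1) = c; last by [].
  apply/eqP; rewrite -(@eqrXn2 _ 2) ?normc_ge0//.
  by rewrite normc_cis_sub1 c2.
have h := cos_sub_le t; rewrite -c2 in h.
have t2 : t ^+ 2 <= 16 * c ^+ 2.
  by rewrite (_ : 16 * c ^+ 2 = (4 * c) ^+ 2); [rewrite ler_pXn2r ?nnegrE ?mulr_ge0|ring].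
have c2e : c ^+ 2 <= e / 4.
  rewrite (@le_trans _ _ ((e / 2) ^+ 2))//.
    by rewrite ler_pXn2r ?nnegrE ?divr_ge0 ?(ltW e0) ?(ltW xyd).
  have : e ^+ 2 <= e by rewrite expr2 ler_piMl ?(ltW e0).
  by rewrite (_ : (e / 2) ^+ 2 = e ^+ 2 / 4); [lra|field].
have t40 : t ^+ 4 = t ^+ 2 * t ^+ 2 by ring.
(* From [t^2 <= 16 c^2 <= 4 e] the quartic term [t^4 / 12] is at most [t^2 e / 3]. *)
have h1 : t ^+ 2 * (1 - e / 3) <= c ^+ 2.
  have := ler_wpM2l (sqr_ge0 t) (le_trans t2 (ler_wpM2l (ler0n _ 16) c2e)); lra.
rewrite -(@ler_pXn2r _ 2) ?nnegrE ?mulr_ge0 ?addr_ge0 ?(ltW e0)//.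
rewrite exprMn.
have h2 : 1 <= (1 - e / 3) * (1 + e) ^+ 2.
  have : 0 <= e * (5 / 3) + e ^+ 2 * (1 / 3) - e ^+ 2 * e * (1 / 3).
    have : e ^+ 2 * e <= e ^+ 2 by rewrite ler_piMr ?sqr_ge0.
    move=> ?; lra.
  by rewrite (_ : (1 - e / 3) * (1 + e) ^+ 2 =
    1 + (e * (5 / 3) + e ^+ 2 * (1 / 3) - e ^+ 2 * e * (1 / 3))); [lra|field].
have := ler_wpM2l (sqr_ge0 t) h2; rewrite mulr1 => h3.
have := ler_wpM2l (sqr_ge0 (1 + e)) h1; lra.
Qed.

Lemma ReipZ w x (r : R) : Re (ip w (r%:C *: x)) = r * Re (ip w x).
Proof. by rewrite ipZr ReM /= oppr0 mul0r subr0. Qed.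

Lemma ang_cis x (t : R) : nr x = 1 -> `|t| <= pi -> ang x (cis t *: x) = `|t|.
Proof.
move=> x1 tp; rewrite /ang ipZr -cisN ipvv x1 expr1n mulr1 /= cosN.
by rewrite -cos_norm cosK// in_itv/= normr_ge0.
Qed.

(* Equality case of the triangle inequality on the sphere: a point at the right
   distances from the end points of a short great arc lies on the arc. *)
Lemma slerp_unique x w (t s : R) : nr x = 1 -> nr w = 1 -> `|t| < pi -> 0 <= s <= 1 ->
  ang x w = s * `|t| -> ang w (cis t *: x) = (1 - s) * `|t| -> w = cis (s * t) *: x.
Proof.
move=> x1 w1 tp /andP[s0 s1] xw wt.
have n1 r : nr (cis r *: x) = 1 by rewrite nrZ normc_cis x1 mul1r.
suff : nr (w - cis (s * t) *: x) ^+ 2 = 0.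
  by move/eqP; rewrite sqrf_eq0 nr_eq0 subr_eq0 => /eqP.
suff h : Re (ip w (cis (s * t) *: x)) = 1.
  by rewrite nrB2 w1 n1 h; ring.
have wx : Re (ip w x) = cos (s * `|t|) by rewrite ReipC -cos_ang// xw.
have wtx : Re (ip w (cis t *: x)) = cos ((1 - s) * `|t|) by rewrite -cos_ang// wt.
have [t0|t0] := eqVneq t 0.
  by rewrite t0 mulr0 cis0 scale1r wx t0 normr0 mulr0 cos0.
have sint : 0 < sin `|t| by apply: sin_gt0_pi; rewrite normr_gt0 t0.
apply: (mulfI (lt0r_neq0 sint)); rewrite mulr1.
(* Spherical interpolation: the point of the arc is a real combination of its two ends, so its real
   inner product with [w] follows from the two given angles. *)
have cE : (sin `|t|)%:C * cis (s * t) =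
    (sin ((1 - s) * `|t|))%:C + (sin (s * `|t|))%:C * cis t.
  have -> : sin ((1 - s) * `|t|) = sin `|t| * cos (s * t) - cos t * sin (s * `|t|).
    by rewrite mulrBl mul1r sinB -!(cos_norm (s * _)) !normrM normr_id cos_norm.
  apply: complex_eqP; rewrite ?ReD ?ImD ?ReM ?ImM /=; first ring.
  have [t1|t1] := leP 0 t; first by rewrite ger0_norm//; ring.
  by rewrite ltr0_norm// mulrN !sinN; ring.
have -> : sin `|t| * Re (ip w (cis (s * t) *: x)) =
    Re (ip w (((sin `|t|)%:C * cis (s * t)) *: x)).
  by rewrite -scalerA ReipZ.
rewrite cE scalerDl -scalerA ipDr ReD !ReipZ wx wtx.
have -> : sin `|t| = sin ((1 - s) * `|t| + s * `|t|) by congr sin; ring.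
by rewrite sinD; ring.
Qed.

End Angles.

(** * A mean value inequality without derivatives *)

Section LocalToGlobal.
Implicit Types (f g : R -> R) (a b : R).

(** Continuity induction: let [c] be the supremum of the times where the bound holds with slack
    [e (t - a)]. The local hypothesis at [c] extends the bound to [c], and then past it if
    [c < b]. *)
Lemma local_le a b f g : a <= b ->
  (forall s t, a <= s -> s <= t -> t <= b -> g s <= g t) ->
  (forall t, a <= t <= b -> forall e, 0 < e -> exists d, 0 < d /\
    forall s, a <= s <= b -> `|s - t| < d ->
      `|f s - f t| <= `|g s - g t| + e * `|s - t|) ->
  f b - f a <= g b - g a.
Proof.
move=> ab gm loc; rewrite -subr_le0; apply: (@approx_le0 _ (b - a)) => e e0.
rewrite lerBlDr; pose P t := f t - f a <= g t - g a + e * (t - a).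
suff : P b by rewrite /P => ?; lra.
pose S : set R := [set t | a <= t <= b /\ P t].
have Sa : S a by split; [rewrite lexx ab|rewrite /P; lra].
have supS : has_sup S by split; [exists a|exists b => t [/andP[]]].
pose c := sup S.
have ac : a <= c by apply: ub_le_sup Sa; case: supS.
have cb : c <= b by apply: ge_sup; [exists a|move=> t [/andP[]]].
have step s t : a <= s <= b -> a <= t <= b -> s <= t -> P s ->
    `|f t - f s| <= `|g t - g s| + e * `|t - s| -> P t.
  move=> /andP[as_ sb] /andP[at_ tb] st; rewrite /P => Ps h.
  have := gm s t as_ st tb; have := ler_norm (f t - f s).
  move: h; rewrite (ger0_norm (x := g t - g s)) ?subr_ge0 ?gm//.
  rewrite (ger0_norm (x := t - s)) ?subr_ge0// => *; lra.
have cI : a <= c <= b by rewrite ac cb.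
have [d [d0 dP]] := loc c cI e e0.
have [t [tI Pt] tc] := sup_adherent d0 supS.
have tlec : t <= c by apply: ub_le_sup; [case: supS|split].
have Pc : P c.
  apply: (step t) => //; rewrite distrC (distrC (g c)) (distrC c).
  by apply: dP => //; rewrite ler0_norm ?subr_le0// opprB; rewrite -/c in tc; lra.
have [<-//|cb'] := eqVneq c b.
have cltb : c < b by rewrite lt_def eq_sym cb'.
pose s := Num.min b (c + d / 2).
have d20 : 0 < d / 2 by rewrite divr_gt0.
have cs : c < s by rewrite lt_min cltb/= ltrDl.
have sb : s <= b by rewrite ge_min lexx.
have sd : s <= c + d / 2 by rewrite ge_min lexx orbT.
have sI : a <= s <= b by rewrite sb andbT (le_trans ac)// ltW.
have : S s.
  split => //; apply: (step c) => //; first exact: ltW.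
  by apply: dP => //; rewrite ger0_norm ?subr_ge0 ?(ltW cs)//; lra.
move=> /ub_le_sup h; have := h (proj2 supS); rewrite -/c leNgt cs.
by [].
Qed.

End LocalToGlobal.

(** * Arc length functions *)

Section ArcLength.
Implicit Types (n F A : R -> R) (a b s t x : R) (D : R -> R -> R) (f : R -> \bar R).

(** The integral starts at [a - 1] so that the derivative is two-sided at [a] as well. *)
Lemma antiderivative n a b : continuous n ->
  exists F, forall x, a <= x <= b -> is_derive x 1 F (n x).
Proof.
move=> cn; exists (fun x => \int[mu]_(t in `[(a - 1), x]) n t)%R => x /andP[ax xb].
have xu : x < b + 1 by lra.
have ax' : a - 1 < x by lra.
have int : mu.-integrable `[(a - 1), (b + 1)] (EFin \o n).
  apply: continuous_compact_integrable; first exact: segment_compact.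
  exact: continuous_subspaceT.
have [d1 d2] := continuous_FTC1_closed xu int ax' (cn x).
by split; [exact: d1|rewrite -derive1E; exact: d2].
Qed.

Lemma is_derive_eps F x l : is_derive x 1 F l -> forall e, 0 < e ->
  exists d, 0 < d /\ forall s, `|s - x| < d ->
    `|F s - F x - l * (s - x)| <= e * `|s - x|.
Proof.
move=> [dF dE] e e0.
have : h^-1 *: (F (h *: 1 + x) - F x) @[h --> 0^'] --> l by rewrite -dE; exact: dF.
move=> /cvgrPdist_le /(_ _ e0) [d /= d0 dP]; exists d; split => // s sx.
have [->|sx0] := eqVneq s x; first by rewrite !subrr mulr0 subr0 normr0 mulr0.
have h0 : s - x != 0 by rewrite subr_eq0.
have := dP (s - x); rewrite /ball_/= sub0r normrN => /(_ sx h0).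
rewrite /GRing.scale/= mulr1 subrK => h.
have -> : F s - F x - l * (s - x) = - ((l - (s - x)^-1 * (F s - F x)) * (s - x)).
  by field.
by rewrite normrN normrM ler_wpM2r.
Qed.

(* [A] is an arc length function on [[a, b]] of a curve with speed [f] whose
   points at times [s] and [t] are at distance [D s t]; by the last clause [A]
   dominates [D] to first order. *)
Definition arcfun D f a b A :=
 [/\ measurable_fun `]a, b[ f /\ (\int[mu]_(t in `]a, b[) f t = (A b - A a)%:E)%E,
   forall s t, a <= s -> s <= t -> t <= b -> A s <= A t,
   forall t, a <= t <= b -> exists K d, [/\ 0 < d, 0 <= K &
     forall s, a <= s <= b -> `|s - t| < d -> `|A s - A t| <= K * `|s - t|] &
   forall t, a <= t <= b -> forall e, 0 < e -> exists d, 0 < d /\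
     forall s, a <= s <= b -> `|s - t| < d -> D s t <= `|A s - A t| + e * `|s - t|].

(** Composition with [clamp] extends a function on [[a, b]] by its end values, since
    [antiderivative] asks for continuity on the whole line. *)
Definition clamp a b x := Num.max a (Num.min x b).

Lemma clamp_itv a b x : a <= b -> a <= clamp a b x <= b.
Proof. by move=> ab; rewrite le_max lexx/= ge_max ab ge_min lexx orbT. Qed.

Lemma clamp_id a b x : a <= x <= b -> clamp a b x = x.
Proof. by move=> /andP[ax xb]; rewrite /clamp (min_idPl xb); apply/max_idPr. Qed.

Lemma clamp_lip a b x y : a <= b -> `|clamp a b x - clamp a b y| <= `|x - y|.
Proof.
move=> ab; have := ler_norm (x - y); have := ler_norm (y - x).
rewrite (distrC y x) ler_norml /clamp => ? ?.
case: (leP x b) => ?; case: (leP y b) => ?; rewrite ?(max_idPr ab);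
  case: (leP a x) => ?; case: (leP a y) => ?; by apply/andP; split; lra.
Qed.

Lemma arcfun_piece D f n a b : a < b ->
  (forall t, a <= t <= b -> 0 <= n t) ->
  (forall t, a <= t <= b -> forall e, 0 < e -> exists d, 0 < d /\
     forall s, a <= s <= b -> `|s - t| < d -> `|n s - n t| <= e) ->
  (forall t, a < t < b -> f t = (n t)%:E) ->
  (forall t, a <= t <= b -> forall e, 0 < e -> exists d, 0 < d /\
     forall s, a <= s <= b -> `|s - t| < d -> D s t <= (n t + e) * `|s - t|) ->
  exists A, arcfun D f a b A.
Proof.
move=> ab n0 nc fn Dn; have leab := ltW ab.
pose m x := n (clamp a b x).
have mE x : a <= x <= b -> m x = n x by move=> xI; rewrite /m clamp_id.
have cm : continuous m.
  move=> x; apply/cvgrPdist_le => e e0.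
  have [d [d0 dP]] := nc _ (clamp_itv x leab) e e0.
  apply/nbhs_ballP; exists d => // y; rewrite /ball/= => xy.
  rewrite distrC; apply: dP; first exact: clamp_itv.
  by rewrite (le_lt_trans (clamp_lip _ _ leab))// distrC.
have [F dF] := antiderivative a b cm.
have Fc x : a <= x <= b -> {for x, continuous F}.
  move=> xI; apply: differentiable_continuous; apply/derivable1_diffP.
  by case: (dF x xI).
have ooI x : x \in `]a, b[ -> a <= x <= b.
  by rewrite in_itv/= => /andP[/ltW -> /ltW ->].
have Fw : {within `[a, b], continuous F}.
  by apply: continuous_in_subspaceT => x; rewrite inE/= in_itv/= => /Fc.
exists F; split.
- have fm : {in `]a, b[%classic, (EFin \o m) =1 f}.
    move=> x; rewrite inE/= in_itv/= => /andP[ax xb].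
    by rewrite fn ?ax//= mE// !ltW.
  have mm : measurable_fun `]a, b[ (EFin \o m).
    apply/measurable_EFinP; apply: measurable_funTS.
    exact: continuous_measurable_fun.
  split; first exact: eq_measurable_fun fm mm.
  have -> : (\int[mu]_(t in `]a, b[) f t = \int[mu]_(t in `]a, b[) (m t)%:E)%E.
    by apply: eq_integral => x xI; rewrite -fm.
  rewrite -(integral_itv_bndoo true false)//.
  rewrite (@continuous_FTC2 _ m F)//.
  + exact: continuous_subspaceT.
  + split.
    * by move=> x /ooI /dF[].
    * by apply: cvg_at_right_filter; apply: Fc; rewrite lexx.
    * by apply: cvg_at_left_filter; apply: Fc; rewrite lexx leab.
  + by move=> x /ooI /dF[_ <-]; rewrite derive1E.
- move=> s t as_ st tb.
  have I x : s <= x <= t -> a <= x <= b.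
    by move=> /andP[sx xt]; rewrite (le_trans as_ sx) (le_trans xt tb).
  have cst : {within `[s, t], continuous F}.
    by apply: continuous_in_subspaceT => x; rewrite inE/= in_itv/= => /I/Fc.
  have dI x : x \in `]s, t[ -> is_derive x 1 F (m x).
    by rewrite in_itv/= => /andP[/ltW sx /ltW xt]; apply: dF; apply: I; rewrite sx.
  have [x xI E] := MVT_segment st dI cst.
  rewrite -subr_ge0 E mulr_ge0 ?subr_ge0//.
  move: xI; rewrite in_itv/= => /I xI; rewrite mE//; exact: n0.
- move=> t tI; have [d [d0 dP]] := is_derive_eps (dF t tI) ltr01.
  exists (m t + 1), d; split => //; first by rewrite addr_ge0// mE// n0.
  move=> s sI st; have := dP s st; have m0 : 0 <= m t by rewrite mE// n0.
  have := ler_normD (F s - F t - m t * (s - t)) (m t * (s - t)).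
  by rewrite subrK normrM (ger0_norm m0) => *; lra.
- move=> t tI e e0; have e20 : 0 < e / 2 by rewrite divr_gt0.
  have [d [d0 dP]] := is_derive_eps (dF t tI) e20.
  have [d' [d'0 d'P]] := Dn t tI _ e20.
  exists (Num.min d d'); split; first by rewrite lt_min d0.
  move=> s sI; rewrite lt_min => /andP[/dP h1 /(d'P s sI) h2].
  have m0 : 0 <= m t by rewrite mE// n0.
  have := ler_normB (F s - F t) (F s - F t - m t * (s - t)).
  have -> : F s - F t - (F s - F t - m t * (s - t)) = m t * (s - t) by ring.
  rewrite -(mE t tI) in h2; rewrite normrM (ger0_norm m0).
  by move=> ?; lra.
Qed.

Lemma arcfun_glue D f a b c A1 A2 : a < b -> b < c -> (forall t, (0 <= f t)%E) ->
  arcfun D f a b A1 -> arcfun D f b c A2 -> exists A, arcfun D f a c A.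
Proof.
move=> ab bc f0 [[mf1 int1] mono1 lip1 loc1] [[mf2 int2] mono2 lip2 loc2].
pose A t := if t <= b then A1 t else A1 b + (A2 t - A2 b).
have AL t : t <= b -> A t = A1 t by rewrite /A => ->.
have AR t : b <= t -> A t = A1 b + (A2 t - A2 b).
  rewrite /A; case: (leP t b) => // tb bt.
  by have -> : t = b by [apply/eqP; rewrite eq_le tb bt]; rewrite subrr addr0.
(* [glue] carries a local property from the two halves to [A]; at [t = b] both halves contribute,
   with the smaller radius. *)
have glue (P : R -> R -> R -> R -> Prop) :
    (forall t, a <= t <= b -> exists d, 0 < d /\ forall s, a <= s <= b ->
        `|s - t| < d -> P s t (A1 s) (A1 t)) ->
    (forall t, b <= t <= c -> exists d, 0 < d /\ forall s, b <= s <= c ->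
        `|s - t| < d -> P s t (A1 b + (A2 s - A2 b)) (A1 b + (A2 t - A2 b))) ->
    forall t, a <= t <= c -> exists d, 0 < d /\ forall s, a <= s <= c ->
        `|s - t| < d -> P s t (A s) (A t).
  move=> P1 P2 t /andP[at_ tc].
  have [tb|bt|tb] := ltgtP t b.
  - have [|d [d0 dP]] := P1 t; first by rewrite at_ ltW.
    exists (Num.min d (b - t)); split; first by rewrite lt_min d0 subr_gt0.
    move=> s /andP[as_ sc]; rewrite lt_min => /andP[sd sbt].
    have sb : s <= b by have := ler_norm (s - t); lra.
    by rewrite !AL ?(ltW tb)//; apply: dP; rewrite ?as_.
  - have [|d [d0 dP]] := P2 t; first by rewrite (ltW bt) tc.
    exists (Num.min d (t - b)); split; first by rewrite lt_min d0 subr_gt0.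
    move=> s /andP[as_ sc]; rewrite lt_min => /andP[sd sbt].
    have sb : b <= s by have := ler_norm (t - s); rewrite distrC; lra.
    by rewrite !AR ?(ltW bt)//; apply: dP; rewrite ?sb.
  - have [|d [d0 dP]] := P1 t; first by rewrite tb lexx ltW.
    have [|d' [d'0 d'P]] := P2 t; first by rewrite tb lexx ltW.
    exists (Num.min d d'); split; first by rewrite lt_min d0.
    have [tbl tbr] : t <= b /\ b <= t by rewrite tb.
    move=> s /andP[as_ sc]; rewrite lt_min => /andP[sd sd'].
    have [sb|/ltW sb] := leP s b.
      by rewrite !AL ?tbl//; apply: dP => //; rewrite as_.
    by rewrite !AR ?tbr//; apply: d'P => //; rewrite sb.
exists A; split.
- have sE : `]a, c[%classic = (`]a, b]%classic `|` `]b, c[%classic).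
    by rewrite -itv_bndbnd_setU// bnd_simp// ltW.
  have mf1' : measurable_fun `]a, b] f by exact/emeasurable_fun_itv_bndo_bndcP.
  have mf : measurable_fun (`]a, b]%classic `|` `]b, c[%classic) f.
    by apply/measurable_funU.
  rewrite sE; split => //; rewrite ge0_integral_setU//; last first.
    rewrite disj_set2E; apply/eqP; rewrite -subset0 => x [] /=.
    by rewrite !in_itv/= => /andP[_ xb] /andP[bx _]; rewrite ltNge xb in bx.
  rewrite integral_itv_bndoo// int1 int2 (AR c) ?(ltW bc)// (AL a) ?(ltW ab)//.
  by rewrite -EFinD; congr EFin; ring.
- move=> s t as_ st tc; have [tb|/ltW tb] := leP t b.
    by rewrite !AL// ?(le_trans st)//; exact: mono1.
  have [sb|/ltW sb] := leP s b.
    rewrite (AL s)// (AR t)// (le_trans (mono1 s b as_ sb (lexx _)))//.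
    by rewrite lerDl subr_ge0 mono2.
  by rewrite !AR// lerD2l lerD2r; apply: mono2.
- move=> t tI.
  suff [K [K0 [d [d0 dP]]]] : exists K, 0 <= K /\ exists d, 0 < d /\ forall s,
      a <= s <= c -> `|s - t| < d -> `|A s - A t| <= K * `|s - t|.
    by exists K, d.
  have [K1 [d1 [d10 K10 P1]]] : exists K d, [/\ 0 < d, 0 <= K & a <= t <= b ->
      forall s, a <= s <= b -> `|s - t| < d -> `|A1 s - A1 t| <= K * `|s - t|].
    have [h|h] := boolP (a <= t <= b); last by exists 0, 1.
    by have [K [d [d0 K0 dP]]] := lip1 t h; exists K, d.
  have [K2 [d2 [d20 K20 P2]]] : exists K d, [/\ 0 < d, 0 <= K & b <= t <= c ->
      forall s, b <= s <= c -> `|s - t| < d -> `|A2 s - A2 t| <= K * `|s - t|].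
    have [h|h] := boolP (b <= t <= c); last by exists 0, 1.
    by have [K [d [d0 K0 dP]]] := lip2 t h; exists K, d.
  exists (K1 + K2); split; first exact: addr_ge0.
  (* [glue] ranges over all base points, while [K1] and [K2] belong to the given [t]; hence the
     guard [t' = t]. *)
  pose P s t' x y := t' = t -> `|x - y| <= (K1 + K2) * `|s - t|.
  have [||d [d0 dP]] := glue P _ _ t tI.
  + move=> t' t'I; have [t't|t't] := eqVneq t' t; last first.
      by exists 1; split => // s _ _ tt; rewrite tt eqxx in t't.
    rewrite t't in t'I *.
    have [tb|tb] := boolP (a <= t <= b); last first.
      by rewrite t'I in tb.
    exists d1; split => // s sI sd _; rewrite (le_trans (P1 tb s sI sd))//.
    by rewrite ler_wpM2r// lerDl.
  + move=> t' t'I; have [t't|t't] := eqVneq t' t; last first.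
      by exists 1; split => // s _ _ tt; rewrite tt eqxx in t't.
    rewrite t't in t'I *.
    have [tb|tb] := boolP (b <= t <= c); last first.
      by rewrite t'I in tb.
    exists d2; split => // s sI sd _.
    rewrite (_ : _ - _ = A2 s - A2 t); last by ring.
    rewrite (le_trans (P2 tb s sI sd))//.
    by rewrite ler_wpM2r// lerDr.
  by exists d; split => // s sI /(dP s sI); exact.
- move=> t tI e e0.
  apply: (glue (fun s t x y => D s t <= `|x - y| + e * `|s - t|)) => // t' t'I.
    exact: loc1.
  have [d [d0 dP]] := loc2 t' t'I e e0; exists d; split => // s sI sd.
  by rewrite (_ : A1 b + _ - _ = A2 s - A2 t'); [exact: dP|ring].
Qed.

(** To first order [g] varies at most like [C D], and [D] at most like [A]; [local_le] makes this
    global. The Lipschitz clause of [arcfun] absorbs the error [e1 |A s - A t|]. *)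
Lemma arcfun_le D f a b A (g : R -> R) (C : R) : a <= b -> 0 <= C ->
  arcfun D f a b A ->
  (forall t, a <= t <= b -> forall e, 0 < e -> exists d, 0 < d /\
    forall s, a <= s <= b -> `|s - t| < d -> `|g s - g t| <= (C + e) * D s t) ->
  forall u v, a <= u -> u <= v -> v <= b -> g v - g u <= C * (A v - A u).
Proof.
move=> ab C0 [_ mono lip loc] gD u v au uv vb.
rewrite mulrBr; apply: (@local_le u v g (fun t => C * A t)) => //.
  move=> s t us st tv; rewrite ler_wpM2l// mono//; first exact: le_trans us.
  exact: le_trans vb.
have sub x : u <= x <= v -> a <= x <= b.
  by move=> /andP[ux xv]; rewrite (le_trans au ux) (le_trans xv vb).
move=> t /sub tI e e0; have [K [d1 [d10 K0 P1]]] := lip t tI.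
(* [e1] and [e2] satisfy [e1 K <= e / 2] and [(C + e1) e2 = e / 2]. *)
pose e1 := e / (2 * (K + 1)).
have e10 : 0 < e1 by rewrite divr_gt0// mulr_gt0// ltr_wpDl.
have [d2 [d20 P2]] := gD t tI e1 e10.
pose e2 := e / (2 * (C + e1)).
have Ce : 0 < C + e1 by rewrite ltr_wpDl.
have e20 : 0 < e2 by rewrite divr_gt0// mulr_gt0.
have [d3 [d30 P3]] := loc t tI e2 e20.
exists (Num.min d1 (Num.min d2 d3)); split; first by rewrite !lt_min d10 d20.
move=> s /sub sI; rewrite !lt_min => /and3P[s1 s2 s3].
have h1 := P1 s sI s1; have h2 := P2 s sI s2; have h3 := P3 s sI s3.
rewrite -mulrBr normrM (ger0_norm C0).
have h4 : (C + e1) * D s t <= (C + e1) * (`|A s - A t| + e2 * `|s - t|).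
  by rewrite ler_wpM2l// ltW.
have h5 : e1 * `|A s - A t| <= e / 2 * `|s - t|.
  rewrite (le_trans (ler_wpM2l (ltW e10) h1))// mulrA ler_wpM2r//.
  rewrite /e1 -mulrA ler_wpM2l ?(ltW e0)//.
  rewrite invfM -mulrA ger_pMr ?invr_gt0// mulrC ler_pdivrMr ?mul1r ?lerDl//.
  by rewrite ltr_wpDl.
have h6 : (C + e1) * e2 = e / 2 by rewrite /e2; field; rewrite gt_eqF.
have h7 : (C + e1) * (`|A s - A t| + e2 * `|s - t|) =
    C * `|A s - A t| + e1 * `|A s - A t| + ((C + e1) * e2) * `|s - t| by ring.
rewrite h6 in h7; lra.
Qed.

End ArcLength.

(** * Young's and Hölder's inequalities for natural powers *)

Section Holder.
Implicit Types (x y : R).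

Lemma young_pow x y n : 0 <= x -> 0 <= y ->
  n.+1%:R * (x ^+ n * y) <= n%:R * x ^+ n.+1 + y ^+ n.+1.
Proof.
move=> x0 y0; elim: n => [|n IH]; first by rewrite expr0 !mul1r mul0r add0r.
rewrite -subr_ge0; have := ler_wpM2l y0 IH; rewrite -subr_ge0 => h.
have -> : n.+1%:R * x ^+ n.+2 + y ^+ n.+2 - n.+2%:R * (x ^+ n.+1 * y) =
   (y * (n%:R * x ^+ n.+1 + y ^+ n.+1) - y * (n.+1%:R * (x ^+ n * y)))
   + n.+1%:R * x ^+ n * (x - y) ^+ 2.
  by rewrite -!(natr1 n.+1) -!(natr1 n) !exprS; ring.
by rewrite addr_ge0 ?h// mulr_ge0 ?sqr_ge0// mulr_ge0// exprn_ge0.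
Qed.

(** The conjugate exponents are [(n + 1) / n] and [n + 1]; as the first factor is already a power
    [n], only natural powers occur. Young's inequality is summed after normalizing by [s] and
    [Y]. *)
Lemma holder_pow (T : Type) (F : seq T) (a y : T -> R) (s Y : R) n :
  0 < s -> 0 < Y -> (forall i, 0 <= a i) -> (forall i, 0 <= y i) ->
  \sum_(i <- F) a i ^+ n.+1 <= s ^+ n.+1 -> \sum_(i <- F) y i ^+ n.+1 <= Y ^+ n.+1 ->
  \sum_(i <- F) a i ^+ n * y i <= s ^+ n * Y.
Proof.
move=> s0 Y0 a0 y0 aS yS.
have h : n.+1%:R * \sum_(i <- F) (a i / s) ^+ n * (y i / Y) <= n.+1%:R.
  rewrite mulr_sumr (le_trans (ler_sum _ (fun i _ => young_pow n
    (divr_ge0 (a0 i) (ltW s0)) (divr_ge0 (y0 i) (ltW Y0)))))//.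
  rewrite big_split/= -mulr_sumr -natr1 lerD//.
    rewrite ler_piMr//; under eq_bigr do rewrite expr_div_n.
    by rewrite -mulr_suml ler_pdivrMr ?mul1r// exprn_gt0.
  under eq_bigr do rewrite expr_div_n.
  by rewrite -mulr_suml ler_pdivrMr ?mul1r// exprn_gt0.
have {}h : \sum_(i <- F) (a i / s) ^+ n * (y i / Y) <= 1.
  by rewrite -(@ler_pM2l _ n.+1%:R)// mulr1.
have sE : \sum_(i <- F) a i ^+ n * y i =
    s ^+ n * Y * \sum_(i <- F) (a i / s) ^+ n * (y i / Y).
  rewrite mulr_sumr; apply: eq_bigr => i _; rewrite expr_div_n.
  by field; rewrite gt_eqF// expf_neq0// gt_eqF.
by rewrite sE ler_piMr// mulr_ge0 ?exprn_ge0// ltW.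
Qed.

End Holder.

(** * Limits in operator norm *)

Section OperatorLimit.
Implicit Types (v w : H) (f : nat -> H -> H).

Lemma operator_limit f : (forall n, bop (f n)) ->
  (forall e : R, 0 < e -> exists N, forall m n, (N <= m)%N -> (N <= n)%N ->
    forall v, nr (f m v - f n v) <= e * nr v) ->
  exists l, bop l /\ forall e : R, 0 < e -> exists N, forall n, (N <= n)%N ->
    forall v, nr (f n v - l v) <= e * nr v.
Proof.
move=> bf fC.
have lim v : exists l, seqlim (fun n => f n v) l.
  apply: seqcauchy_lim => e e0; have v0 : 0 < nr v + 1 by rewrite ltr_wpDl ?nr_ge0.
  have [N NP] := fC _ (divr_gt0 e0 v0); exists N => m n Nm Nn.
  rewrite (le_lt_trans (NP m n Nm Nn v))// -mulrA gtr_pMr//.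
  by rewrite mulrC ltr_pdivrMr// mul1r ltrDl.
have [l lP] := choice lim.
have unif e : 0 < e -> exists N, forall n, (N <= n)%N ->
    forall v, nr (f n v - l v) <= e * nr v.
  move=> e0; have [N NP] := fC e e0; exists N => n Nn v.
  rewrite -subr_le0; apply: (@approx_le0 _ 1) => r r0.
  have [M MP] := lP v r r0.
  have h1 := NP n (maxn N M) Nn (leq_maxl _ _) v.
  have h2 := MP (maxn N M) (leq_maxr _ _).
  have := nr_triangle (f n v) (f (maxn N M) v) (l v); rewrite mul1r; lra.
exists l; split => //; split.
  move=> c v w; apply/eqP; rewrite -subr_eq0 -nr_eq0 eq_le nr_ge0 andbT.
  apply: (@approx_le0 _ (nr (c *: v + w) + normc c * nr v + nr w)) => r r0.
  have [N NP] := unif r r0; have fN := NP N (leqnn N).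
  have -> : l (c *: v + w) - (c *: l v + l w) = (l (c *: v + w) - f N (c *: v + w)) +
      (c *: (f N v - l v) + (f N w - l w)).
    have E : f N (c *: v + w) = c *: f N v + f N w := (bf N).1 c v w.
    by rewrite E scalerBr (addrACA (c *: f N v)) -opprD addrA subrK.
  rewrite (le_trans (nrD _ _))// -addrA mulrDl lerD//.
    by rewrite nrBC mulrC fN.
  rewrite (le_trans (nrD _ _))// mulrDl lerD//; last by rewrite mulrC fN.
  by rewrite nrZ -mulrA ler_wpM2l ?normc_ge0// mulrC fN.
have [N NP] := unif 1 ltr01; have [_ [K [K0 KP]]] := bf N.
exists (K + 1); split; first by rewrite addr_ge0.
move=> v; have := NP N (leqnn N) v; have := KP v.
have := nr_triangle (l v) (f N v) 0; rewrite !subr0 nrBC; lra.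
Qed.

End OperatorLimit.

Context (p : nat).
Hypotheses (p_gt0 : (0 < p)%N) (p_even : ~~ odd p).
Notation schatten := (schatten ip p).
Notation Up := (Up ip p).
Notation pnorm := (pnorm ip p).
Notation pdist := (pdist ip p).
Notation is_pderiv := (is_pderiv ip p).

(** * The Schatten norm *)

Section Schatten.
Implicit Types (v w x : H) (a b : H -> H) (A : R).

Lemma half_p : p./2.*2 = p.
Proof. by rewrite even_halfK. Qed.

Lemma half_p_gt0 : (0 < p./2)%N.
Proof. by rewrite -double_gt0 half_p. Qed.

Lemma natp_neq0 : p%:R != 0 :> R.
Proof. by rewrite pnatr_eq0 -lt0n. Qed.

Lemma unit_vector v : v != 0 ->
  exists w, [/\ nr w = 1, v = (nr v)%:C *: w & w = (nr v)^-1%:C *: v].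
Proof.
rewrite -nr_eq0 => v0; exists ((nr v)^-1%:C *: v); split => //.
  by rewrite nrZ normcR ger0_norm ?invr_ge0 ?nr_ge0// mulVf.
by rewrite scalerA -rmorphM divff// scale1r.
Qed.

Lemma root_exists (t : R) : 0 <= t -> (t `^ p%:R^-1) ^+ p = t.
Proof.
move=> t0; rewrite -powR_mulrn ?powR_ge0// -powRrM mulVf ?natp_neq0//.
by rewrite powRr1.
Qed.

Lemma pow_root (t : R) : 0 <= t -> exists2 r, 0 <= r & r ^+ p = t.
Proof. by exists (t `^ p%:R^-1); [exact: powR_ge0|exact: root_exists]. Qed.

Lemma ler_pexp (x y : R) : 0 <= x -> 0 <= y -> (x ^+ p <= y ^+ p) = (x <= y).
Proof. by move=> x0 y0; rewrite ler_pXn2r. Qed.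

Lemma schatten_trace_le a K : bop a ->
  (schatten_trace ip p a <= K%:E)%E <-> hs_bound (hbasis ip) (word a p./2) K.
Proof.
move=> ba; split=> [aK F uF FB|aK].
  rewrite -lee_fin; apply: le_trans aK; apply: esum_ge; exists [set` F].
    by split; [exact: finite_seq|move=> x /=; exact: FB].
  rewrite -fsbig_seq//= -sumEFin; apply: lee_sum => e _.
  by rewrite word_nr2.
apply: ge_ereal_sup => _ [X [fX XB] <-]; rewrite fsbig_finite//=.
rewrite (eq_bigr (fun e => (nr (word a p./2 e) ^+ 2)%:E)); last first.
  by move=> e _; rewrite word_nr2.
rewrite sumEFin lee_fin; apply: aK; first exact: finmap.fset_uniq.
by move=> e; rewrite in_fset_set// inE => /XB.
Qed.

Definition pbound K a := forall F, ons F -> \sum_(e <- F) nr (a e) ^+ p <= K.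

(** From the trace to the sums: [|a e|^(p/2) <= |word a p./2 e|] on unit vectors, and the
    Hilbert-Schmidt bound for [word a p./2] does not depend on the basis. Back: compactness gives an
    eigenbasis of [adj a \o a], on which [|word a p./2 e|^2 = |a e|^p]. *)
Lemma schatten_traceP a K : bop a ->
  (schatten_trace ip p a <= K%:E)%E <-> compactop a /\ pbound K a.
Proof.
move=> ba; have bW := bop_word p./2 ba.
split=> [/(schatten_trace_le _ ba) aK|[ca aK]].
  split.
    move=> e e0.
    have [F [oF FP]] := hs_tail hbasisP bW aK (exprn_gt0 p./2 e0).
    exists F; split => // v vF.
    have [->|v0] := eqVneq v 0; first by rewrite (bop0 ba) nr0 mulr0.
    have [w [w1 vE wE]] := unit_vector v0.
    have wF : {in F, forall f, ip w f = 0}.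
      by move=> f fF; rewrite wE ipZl vF// mulr0.
    have aw : nr (a w) <= e.
      have := le_trans (word_jensen p./2 ba w1) (FP w wF).
      rewrite w1 mulr1 ler_pXn2r ?nnegrE ?nr_ge0 ?(ltW e0)//.
      exact: half_p_gt0.
    rewrite [in nr (a v)]vE (bopZ ba) nrZ normcR ger0_norm ?nr_ge0// mulrC.
    by rewrite ler_wpM2r ?nr_ge0.
  move=> F oF.
  have oF' : orthonormal_set ip [set` F] by move=> e f; exact: oF.2.
  rewrite (le_trans _ (hs_bound_basis hbasisP oF' bW aK oF.1 _))//.
  apply: ler_sum_in => e eF.
  rewrite -[in leLHS]half_p -muln2 exprM ler_pXn2r ?nnegrE ?exprn_ge0 ?nr_ge0//.
  by apply: word_jensen => //; exact: ons_nr oF eF.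
apply/schatten_trace_le => //.
pose b := adj a \o a.
have bb : bop b by apply: bop_comp => //; exact: bop_adj.
have bself v w : ip (b v) w = ip v (b w).
  by rewrite /b/= adjEl// adjE.
have cb : compactop b by apply: compactop_comp => //; exact: bop_adj.
(* All three operators of [eigenbasis] are [b], so the relation is [b (b v) = l *: b v], with
   [s = l] and [q = 0]. *)
have [B [bB Beig]] := eigenbasis bb bb bb bself (fun=> erefl) bself cb
  (fun=> erefl) (fun v l bv => ex_intro _ l%:C (ex_intro _ 0
    (etrans (f_equal b bv) (etrans (bopZ bb _ _) (etrans (esym (addr0 _))
      (f_equal (+%R _) (esym (scale0r v)))))))).
apply: (hs_bound_basis bB hbasisP.1 bW).
move=> F uF FB; rewrite (le_trans _ (aK F (ons_of_set bB.1 uF FB)))//.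
apply: ler_sum_in => e eF.
have [l be] := Beig e (FB e eF).
have e1 : ip e e = 1 by rewrite bB.1 ?eqxx//; exact: FB.
have lE : l = (nr (a e) ^+ 2)%:C.
  by rewrite -ipvv adjE// -bself be ipZl e1 mulr1.
have -> : nr (word a p./2 e) ^+ 2 = Re (l ^+ p./2).
  rewrite -[LHS]/(Re (_)%:C) -word_nr2// -/b; congr Re.
  rewrite (_ : iter p./2 b e = l ^+ p./2 *: e) ?ipZl ?e1 ?mulr1//.
  elim: p./2 => [|n IH]; first by rewrite expr0 scale1r.
  by rewrite iterS IH (bopZ bb) be scalerA -exprSr.
by rewrite lE -rmorphXn /= -exprM mul2n half_p.
Qed.

(* [pball a A]: [a] is a Schatten operator with [|a|_p <= A].  The bound on all
   orthonormal families makes the norm properties of [|.|_p] immediate. *)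
Definition pball a A := [/\ bop a, compactop a, 0 <= A & pbound (A ^+ p) a].

Lemma schatten_trace_ge0 a : bop a -> (0 <= schatten_trace ip p a)%E.
Proof.
by move=> ba; apply: esum_ge0 => e _; rewrite word_nr2// lee_fin sqr_ge0.
Qed.

Lemma pnorm_le a A : bop a -> 0 <= A ->
  (pnorm a <= A%:E)%E <-> compactop a /\ pbound (A ^+ p) a.
Proof.
move=> ba A0; rewrite -(schatten_traceP _ ba) /pnorm.
have := schatten_trace_ge0 ba; case: schatten_trace => [t| |] //=.
  by rewrite !lee_fin => t0; rewrite -ler_pexp ?powR_ge0// root_exists.
by rewrite invr_eq0 (negbTE natp_neq0).
Qed.

Lemma pballP a A : bop a -> 0 <= A -> (pnorm a <= A%:E)%E <-> pball a A.
Proof.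
move=> ba A0; split=> [/(pnorm_le ba A0)[]//|[_ ca _ aA]].
by apply/pnorm_le.
Qed.

Lemma schattenP a : schatten a <-> exists A, pball a A.
Proof.
split=> [[/bounded_opE ba aty]|[A aA]].
  have t0 := schatten_trace_ge0 ba.
  have tf : schatten_trace ip p a \is a fin_num by rewrite ge0_fin_numE.
  exists (fine (schatten_trace ip p a) `^ p%:R^-1).
  apply/pballP; rewrite ?powR_ge0// /pnorm -{1}(fineK tf) poweR_EFin.
  exact: lexx.
have [ba ca A0 Ab] := aA; split; first exact/bounded_opE.
rewrite (le_lt_trans _ (ltry (A ^+ p)))//.
exact/schatten_traceP.
Qed.

Definition pn a : R := fine (pnorm a).

Lemma pnormE a : schatten a -> pnorm a = (pn a)%:E.
Proof.
move=> [_ aty]; rewrite /pn fineK// /pnorm ge0_fin_numE ?poweR_ge0//.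
exact: poweR_lty.
Qed.

Lemma pn_ge0 a : 0 <= pn a.
Proof. by rewrite fine_ge0// poweR_ge0. Qed.

Lemma pn_ball a : schatten a -> pball a (pn a).
Proof.
move=> sa; apply/pballP; rewrite ?pn_ge0 ?pnormE//.
by apply/bounded_opE; case: sa.
Qed.

Lemma pball_schatten a A : pball a A -> schatten a.
Proof. by move=> aA; apply/schattenP; exists A. Qed.

Lemma pn_le a A : pball a A -> pn a <= A.
Proof.
move=> aA; rewrite -lee_fin -pnormE; last exact: pball_schatten aA.
by case: (aA) => ba _ A0 _; apply/pballP.
Qed.

Lemma pball_opbound a A : pball a A -> opbound a A.
Proof.
move=> [ba _ A0 aA]; split => // v.
have [->|v0] := eqVneq v 0; first by rewrite (bop0 ba) nr0 mulr0.
have [w [w1 vE _]] := unit_vector v0.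
have := aA _ (ons1 w1); rewrite big_seq1 ler_pexp ?nr_ge0// => h.
rewrite [in nr (a v)]vE (bopZ ba) nrZ normcR ger0_norm ?nr_ge0// mulrC.
by rewrite ler_wpM2r ?nr_ge0.
Qed.

Lemma pball0_eq a : pball a 0 -> a = 0.
Proof.
move=> /pball_opbound[_ a0]; apply/funext => v; rewrite opzeroE.
by apply/eqP; rewrite -nr_eq0 eq_le nr_ge0 andbT (le_trans (a0 v))// mul0r.
Qed.

Lemma pball_zero : pball 0 0.
Proof.
split => //; [exact: bop_zero|exact: compactop_zero|].
move=> F _; rewrite big1// => e _.
by rewrite opzeroE nr0 expr0n eqn0Ngt p_gt0.
Qed.

Lemma pball_dom a b A k : bop b -> 0 <= k -> (forall v, nr (b v) <= k * nr (a v)) ->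
  pball a A -> pball b (k * A).
Proof.
move=> bb k0 ba [_ ca A0 aA]; split => //; first exact: compactop_dom ba ca.
  exact: mulr_ge0.
move=> F oF; rewrite exprMn (le_trans _ (ler_wpM2l (exprn_ge0 _ k0) (aA F oF)))//.
rewrite mulr_sumr; apply: ler_sum => e _.
by rewrite -exprMn ler_pexp ?mulr_ge0 ?nr_ge0.
Qed.

Lemma pballZ a A c : pball a A -> pball (c *: a) (normc c * A).
Proof.
move=> aA; apply: pball_dom (aA); rewrite ?normc_ge0//.
  by apply: bop_scale; case: aA.
by move=> v; rewrite opscaleE nrZ.
Qed.

Lemma pball_comp a b A k : bop b -> opbound b k -> pball a A -> pball (b \o a) (k * A).
Proof.
move=> bb [k0 bk] aA; apply: pball_dom (aA) => //.
  by apply: bop_comp => //; case: aA.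
by move=> v; exact: bk.
Qed.

Lemma pballD a b A B : pball a A -> pball b B -> pball (a + b) (A + B).
Proof.
move=> aA bB.
have [A0|A0] := eqVneq A 0.
  by move: aA; rewrite A0 => /pball0_eq ->; rewrite !add0r.
have [B0|B0] := eqVneq B 0.
  by move: bB; rewrite B0 => /pball0_eq ->; rewrite !addr0.
have [ba ca A1 aP] := aA; have [bb cb B1 bP] := bB.
split; [exact: bop_add|exact: compactop_add|exact: addr_ge0|].
move=> F oF.
have A2 : 0 < A by rewrite lt_def A0.
have B2 : 0 < B by rewrite lt_def B0.
rewrite (le_trans _ (minkowski_pow A2 B2 (fun e => nr_ge0 (a e))
  (fun e => nr_ge0 (b e)) (aP F oF) (bP F oF)))//.
by apply: ler_sum => e _; rewrite ler_pexp ?addr_ge0 ?nr_ge0// nrD.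
Qed.

Lemma pball_le a A A' : A <= A' -> pball a A -> pball a A'.
Proof.
move=> AA [ba ca A0 aA]; have A'0 : 0 <= A' by exact: le_trans AA.
by split => // F oF; rewrite (le_trans (aA F oF))// ler_pexp.
Qed.

(** Balls of [|.|_p] are closed in operator norm, because each finite sum passes to the limit. This
    plays the part of Fatou's lemma in the proof of completeness. *)
Lemma pball_lim a A : bop a -> 0 <= A ->
  (forall e, 0 < e -> exists b, pball b A /\ forall v, nr (a v - b v) <= e * nr v) ->
  pball a A.
Proof.
move=> ba A0 h; split => //.
  by apply: compactop_lim => e /h[b [[_ cb _ _] ab]]; exists b.
move=> F oF; set S := \sum_(e <- F) _.
have S0 : 0 <= S by apply: sumr_ge0 => e _; rewrite exprn_ge0 ?nr_ge0.
rewrite -(root_exists S0) ler_pexp ?powR_ge0// -subr_le0.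
apply: (@approx_le0 _ ((size F)%:R + 2)) => r r0.
have [b [[_ _ _ bP] ab]] := h r r0.
set K := _ * r.
(* Minkowski's inequality is applied with the positive bounds [A + r] for [b] and [(size F + 1) r]
   for the constant error [r] on [F]. *)
have K0 : 0 < ((size F)%:R + 1) * r by rewrite mulr_gt0// ltr_wpDl.
have A1 : 0 < A + r by rewrite ltr_wpDl.
rewrite lerBlDr.
have -> : K + A = (A + r) + ((size F)%:R + 1) * r by rewrite /K; ring.
have AK : 0 <= A + r + ((size F)%:R + 1) * r by rewrite addr_ge0 ?(ltW A1) ?(ltW K0).
rewrite -(ler_pexp (powR_ge0 _ _) AK) (root_exists S0).
rewrite (le_trans _ (minkowski_pow (F := F) (x := fun e => nr (b e)) (y := fun=> r)
  A1 K0 _ _ _ _))//.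
- rewrite /S big_seq [leRHS]big_seq; apply: ler_sum => e eF.
  rewrite ler_pexp ?addr_ge0 ?nr_ge0 ?(ltW r0)//.
  rewrite -(subrK (b e) (a e)) (le_trans (nrD _ _))// addrC lerD2l.
  by rewrite (le_trans (ab e))// (ons_nr oF eF) mulr1.
- by move=> e; exact: nr_ge0.
- by move=> _; exact: ltW.
- rewrite (le_trans (bP F oF))// ler_pexp ?(ltW A1)//.
  by rewrite lerDl ltW.
rewrite big_const_seq count_predT iter_addr_0 -[in leLHS]mulr_natl exprMn.
rewrite ler_wpM2r ?exprn_ge0 ?(ltW r0)//.
rewrite (@le_trans _ _ ((size F)%:R + 1))// ?lerDl//.
by rewrite -{1}[_ + 1]expr1 ler_weXn2l// lerDr.
Qed.

Lemma schatten_bop a : schatten a -> bop a.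
Proof. by move=> [/bounded_opE]. Qed.

Lemma schattenD a b : schatten a -> schatten b -> schatten (a + b).
Proof. by move=> /pn_ball ha /pn_ball hb; exact: pball_schatten (pballD ha hb). Qed.

Lemma schattenZ c a : schatten a -> schatten (c *: a).
Proof. by move=> /pn_ball ha; exact: pball_schatten (pballZ c ha). Qed.

Lemma schattenN a : schatten a -> schatten (- a).
Proof. by rewrite -scaleN1r; exact: schattenZ. Qed.

Lemma schattenB a b : schatten a -> schatten b -> schatten (a - b).
Proof. by move=> ha hb; apply: schattenD => //; exact: schattenN. Qed.

Lemma schatten0 : schatten 0.
Proof. exact: pball_schatten pball_zero. Qed.

Lemma schatten_comp a b : bop b -> schatten a -> schatten (b \o a).
Proof.
move=> bb; case: (bb) => _ [k bk] /pn_ball ha.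
exact: pball_schatten (pball_comp bb bk ha).
Qed.

Lemma pnD a b : schatten a -> schatten b -> pn (a + b) <= pn a + pn b.
Proof. by move=> /pn_ball ha /pn_ball hb; exact: pn_le (pballD ha hb). Qed.

Lemma pnZ_le c a : schatten a -> pn (c *: a) <= normc c * pn a.
Proof. by move=> /pn_ball ha; exact: pn_le (pballZ c ha). Qed.

Lemma pn_dom a b k : bop b -> 0 <= k -> schatten a ->
  (forall v, nr (b v) <= k * nr (a v)) -> schatten b /\ pn b <= k * pn a.
Proof.
move=> bb k0 /pn_ball ha ba; have h := pball_dom bb k0 ba ha.
by split; [exact: pball_schatten h|exact: pn_le].
Qed.

Lemma pnZ c a : schatten a -> pn (c *: a) = normc c * pn a.
Proof.
move=> sa; apply/eqP; rewrite eq_le pnZ_le//=.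
have [->|c0] := eqVneq c 0; first by rewrite normc0 mul0r pn_ge0.
rewrite -{1}(scale1r a) -(mulVf c0) -scalerA.
have n0 : 0 < normc c by rewrite lt_def normc_eq0 c0 normc_ge0.
rewrite mulrC -ler_pdivlMr// mulrC -normcV; apply: pnZ_le; exact: schattenZ.
Qed.

Lemma pnN a : schatten a -> pn (- a) = pn a.
Proof. by move=> sa; rewrite -scaleN1r pnZ// normcN normc1 mul1r. Qed.

Lemma pnB_C a b : schatten (a - b) -> pn (a - b) = pn (b - a).
Proof. by move=> sab; rewrite -pnN// opprB. Qed.

Lemma pnB a b : schatten a -> schatten b -> pn (a - b) <= pn a + pn b.
Proof. by move=> sa sb; rewrite -(pnN sb) pnD//; exact: schattenN. Qed.

Lemma pn0 : pn 0 = 0.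
Proof. by apply/eqP; rewrite eq_le pn_ge0 andbT; exact: pn_le pball_zero. Qed.

Lemma pn_eq0 a : schatten a -> pn a = 0 -> a = 0.
Proof. by move=> /pn_ball + a0; rewrite a0 => /pball0_eq. Qed.

Lemma pn_opbound a : schatten a -> opbound a (pn a).
Proof. by move=> /pn_ball/pball_opbound. Qed.

Lemma pn_sum a F : schatten a -> ons F -> \sum_(e <- F) nr (a e) ^+ p <= pn a ^+ p.
Proof. by move=> /pn_ball[_ _ _ h] /h. Qed.

End Schatten.

(** * The group [U_p], exponentials and logarithms *)

Section UnitaryGroup.
Implicit Types (v w : H) (a b u x : H -> H).

Lemma unitaryP u : unitary u <->
  [/\ bop u, forall v, adj u (u v) = v & forall v, u (adj u v) = v].
Proof.
split=> [[/bounded_opE bu uu uu']|[bu uu uu']]; split => //.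
- by move=> v; have := congr1 (fun f => f v) uu.
- by move=> v; have := congr1 (fun f => f v) uu'.
- exact/bounded_opE.
- exact/funext.
- exact/funext.
Qed.

Lemma unitary_bop u : unitary u -> bop u. Proof. by move=> /unitaryP[]. Qed.

Lemma unitary_ip u v w : unitary u -> ip (u v) (u w) = ip v w.
Proof. by move=> /unitaryP[bu uu _]; rewrite adjE// uu. Qed.

Lemma unitary_nr u v : unitary u -> nr (u v) = nr v.
Proof.
move=> uu; apply/eqP; rewrite -(@eqrXn2 _ 2) ?nr_ge0//.
by rewrite !nr2E unitary_ip.
Qed.

Lemma unitary_adj u : unitary u -> unitary (adj u).
Proof.
move=> /unitaryP[bu uu uu']; apply/unitaryP.
by rewrite adjK//; split => //; exact: bop_adj.
Qed.

Lemma adj_comp a b : bop a -> bop b -> adj (a \o b) = adj b \o adj a.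
Proof.
move=> ba bb; apply: (adj_uniq (bop_comp ba bb)) => v w /=.
by rewrite !adjE.
Qed.

Lemma adj_sub a b : bop a -> bop b -> adj (a - b) = adj a - adj b.
Proof.
move=> ba bb; apply: (adj_uniq (bop_sub ba bb)) => v w.
by rewrite !opsubE ipBl ipBr !adjE.
Qed.

Lemma adj_id : adj idfun = idfun.
Proof. exact: (adj_uniq (@bop_id)). Qed.

Lemma unitary_comp u a : unitary u -> unitary a -> unitary (u \o a).
Proof.
move=> /unitaryP[bu uu uu'] /unitaryP[ba aa aa']; apply/unitaryP.
rewrite adj_comp//; split; first exact: bop_comp.
- by move=> v /=; rewrite uu aa.
- by move=> v /=; rewrite aa' uu'.
Qed.

Lemma pn_unitary u a : unitary u -> schatten a -> pn (u \o a) = pn a.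
Proof.
move=> uu sa; have bu := unitary_bop uu; have ba := schatten_bop sa.
have nE v : nr ((u \o a) v) = nr (a v) by rewrite /= unitary_nr.
have [s1 h1] : schatten (u \o a) /\ pn (u \o a) <= 1 * pn a.
  by apply: pn_dom => // [|v]; [exact: bop_comp|rewrite nE mul1r].
have [_ h2] : schatten a /\ pn a <= 1 * pn (u \o a).
  by apply: pn_dom => // v; rewrite nE mul1r.
by apply/eqP; rewrite eq_le; move: h1 h2; rewrite !mul1r => -> ->.
Qed.

Lemma UpP u : Up u <-> unitary u /\ schatten (u - idfun).
Proof. by []. Qed.

Lemma Up_comp u a : Up u -> Up a -> Up (u \o a).
Proof.
move=> [uu su] [ua sa]; split; first exact: unitary_comp.
have -> : u \o a - idfun = u \o (a - idfun) + (u - idfun).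
  apply/funext => v; rewrite opsubE opaddE opsubE /= opsubE (bopB (unitary_bop uu)).
  by rewrite addrA subrK.
by apply: schattenD => //; apply: schatten_comp => //; exact: unitary_bop.
Qed.

Lemma Up_adj u : Up u -> Up (adj u).
Proof.
move=> [uu su]; split; first exact: unitary_adj.
have [bu uu1 uu2] := (unitaryP u).1 uu.
have -> : adj u - idfun = - (adj u \o (u - idfun)).
  apply/funext => v; rewrite opoppE /= !opsubE (bopB (bop_adj bu)) uu1.
  by rewrite opprB.
by apply: schattenN => //; apply: schatten_comp => //; exact: bop_adj.
Qed.

Lemma Up_sub u a : Up u -> Up a -> schatten (u - a).
Proof.
move=> [_ su] [_ sa]; have -> : u - a = (u - idfun) - (a - idfun).
  by apply/funext => v; rewrite !opsubE opprB addrA subrK.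
exact: schattenB.
Qed.

(** [eigenbasis] is applied with [h = x \o x], self-adjoint because [x] is skew; on its eigenspaces
    [x (x v) = l v], a quadratic relation with [s = 0]. Skewness makes the eigenvalues of [x]
    imaginary. *)
Lemma skew_spectral x : schatten_ah ip p x ->
  exists B (t : H -> R), orthonormal_basis ip B /\ diagi B t x.
Proof.
move=> [sx xx]; have bx := schatten_bop sx.
have xE v w : ip (x v) w = ip v (- x w) by rewrite adjE// xx.
have bh : bop (x \o x) by exact: bop_comp.
have hself v w : ip ((x \o x) v) w = ip v ((x \o x) w).
  by rewrite /= !xE (bopN bx) opprK.
have ch : compactop (x \o x).
  by apply: compactop_comp => //; case: (pn_ball sx).
have [B [bB Beig]] := eigenbasis bx (bop_opp bx) bh xE
  (fun v => etrans (bopN bx _) erefl) hself ch (fun=> erefl)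
  (fun v l xl => ex_intro _ 0 (ex_intro _ l%:C
    (etrans xl (esym (etrans (f_equal (fun z => z + _) (scale0r _)) (add0r _)))))).
exists B, (fun e => Im (ip (x e) e)); split => //; split => // e Be.
have [l xe] := Beig e Be.
have e1 : ip e e = 1 by rewrite bB.1 ?eqxx.
have le : ip (x e) e = l by rewrite xe ipZl e1 mulr1.
rewrite le xe; congr (_ *: _).
have : l = - Num.conj l by rewrite -{1}le xE xe ipNr ipZr e1 mulr1.
move=> /(congr1 (@Re R)); rewrite ReN Re_conj => h.
by apply: complex_eqP => //=; lra.
Qed.

(** [u] itself need not be compact, but with [d = u - 1] the operator
    [h = adj d \o d = 2 - u - adj u] is, and it commutes with [u]. Applying [u] to [h v = l v] gives
    [u (u v) = (2 - l) u v - v]. *)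
Lemma unitary_spectral u : Up u ->
  exists B (t : H -> R), [/\ orthonormal_basis ip B,
    forall e, B e -> `|t e| <= pi & diag B (fun e => cis (t e)) u].
Proof.
move=> [uu su]; have [bu uu1 uu2] := (unitaryP u).1 uu.
have bu' := bop_adj bu.
have bd := schatten_bop su.
pose d := u - idfun; pose h := adj d \o d.
have hE v : h v = v *+ 2 - u v - adj u v.
  rewrite /h /= {1}/d adj_sub ?adj_id//; last exact: bop_id.
  rewrite /d !opsubE (bopB bu') uu1 /=.
  by rewrite mulr2n opprB addrACA -[RHS]addrA (addrC (- adj u v)).
have bh : bop h by apply: bop_comp => //; exact: bop_adj.
have hself v w : ip (h v) w = ip v (h w).
  by rewrite /h /= adjEl// adjE.
have ch : compactop h.
  by apply: compactop_comp; [exact: bop_adj|case: (pn_ball su)].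
have [B [bB Beig]] : exists B, orthonormal_basis ip B /\
    forall e, B e -> exists l, u e = l *: e.
  apply: (eigenbasis bu bu' bh _ _ hself ch).
  - by move=> v w; exact: adjE.
  - by move=> v; rewrite uu1 uu2.
  - by move=> v; rewrite !hE !(bopB bu) mulr2n (bopD bu) -mulr2n uu1 uu2.
  - move=> v l hv; exists (2 - l%:C), (-1).
    have := congr1 u hv; rewrite hE (bopZ bu) !(bopB bu) uu2 mulr2n (bopD bu) => h2.
    rewrite scalerBl -h2 scaler_nat mulr2n scaleN1r.
    rewrite !opprB; set A := u v + u v.
    by rewrite addrCA (addrC A) subrK addrAC subrr add0r.
have lP e l : B e -> u e = l *: e -> normc l = 1.
  move=> Be ue; have := unitary_nr e uu.
  by rewrite ue nrZ (basis_nr bB Be) mulr1.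
have /choice[t tP] e : exists t : R, B e -> `|t| <= pi /\ u e = cis t *: e.
  have [Be|nBe] := pselect (B e); last by exists 0.
  have [l ue] := Beig e Be; have [t [tp lE]] := cis_arg (lP _ _ Be ue).
  by exists t; rewrite -lE.
exists B, t; split => //; first by move=> e /tP[].
by split => // e /tP[].
Qed.

Lemma diag_unitary B (t : H -> R) u : orthonormal_basis ip B ->
  diag B (fun e => cis (t e)) u -> unitary u.
Proof.
move=> bB du; have da := diag_adj bB du.
apply/unitaryP; split; first exact: du.1.
  move=> v; have := diag_uniq bB (diag_comp bB da du) (diag_id B).
  move=> /(_ _)/(congr1 (fun f => f v)) /= -> // e _.
  by rewrite cis_conj.
move=> v; have := diag_uniq bB (diag_comp bB du da) (diag_id B).
move=> /(_ _)/(congr1 (fun f => f v)) /= -> // e _.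
by rewrite mulrC cis_conj.
Qed.

Lemma diag_word B l a n : orthonormal_basis ip B -> diag B l a ->
  exists m, diag B m (word a n) /\ forall e, normc (m e) = normc (l e) ^+ n.
Proof.
move=> bB da; elim: n => [|n [m [dm mE]]].
  exists (fun=> 1); split; first exact: diag_id.
  by move=> e; rewrite normc1 expr0.
have da' := diag_adj bB da.
rewrite /=; case: (odd n).
  exists (fun e => Num.conj (l e) * m e); split; first exact: diag_comp.
  by move=> e; rewrite normcM normc_conj mE exprS.
exists (fun e => l e * m e); split; first exact: diag_comp.
by move=> e; rewrite normcM mE exprS.
Qed.

(** Sums over the eigenbasis suffice, through the trace and its independence of the basis, although
    [pbound] speaks of all orthonormal families. *)
Lemma diag_pball B l a A : orthonormal_basis ip B -> diag B l a -> 0 <= A ->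
  (forall F, uniq F -> {in F, forall e, B e} -> \sum_(e <- F) normc (l e) ^+ p <= A ^+ p) ->
  pball a A.
Proof.
move=> bB da A0 lA; have ba := da.1.
have : (schatten_trace ip p a <= (A ^+ p)%:E)%E.
  apply/schatten_trace_le => //.
  apply: (hs_bound_basis bB hbasisP.1); first exact: bop_word.
  move=> F uF FB; rewrite (le_trans _ (lA F uF FB))//.
  have [m [dm mE]] := diag_word p./2 bB da.
  apply: ler_sum_in => e /FB Be.
  rewrite dm.2// nrZ mE (basis_nr bB Be) mulr1 -exprM muln2.
  by rewrite half_p.
by move=> /(schatten_traceP _ ba)[]; split.
Qed.

Lemma diag_pn_sum B l a F : orthonormal_basis ip B -> diag B l a -> schatten a ->
  uniq F -> {in F, forall e, B e} ->
  \sum_(e <- F) normc (l e) ^+ p <= pn a ^+ p.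
Proof.
move=> bB da sa uF FB; have oF := ons_of_set bB.1 uF FB.
rewrite (le_trans _ (pn_sum sa oF))//.
apply: ler_sum_in => e /FB Be.
by rewrite da.2// nrZ (basis_nr bB Be) mulr1.
Qed.

Lemma diag_pn_dom B l m a b k : orthonormal_basis ip B -> 0 <= k ->
  diag B l a -> diag B m b -> schatten b ->
  (forall e, B e -> normc (l e) <= k * normc (m e)) ->
  schatten a /\ pn a <= k * pn b.
Proof.
move=> bB k0 da db sb lm; apply: pn_dom => //; first exact: da.1.
exact: diag_dom k0 da db lm.
Qed.

Lemma diag_imag_bound B (t : H -> R) x : orthonormal_basis ip B ->
  diagi B t x -> exists K, 0 <= K /\ forall e, B e -> `|t e| <= K.
Proof.
move=> bB dx; have [K xK] := dx.1.2; exists K; split; first exact: opbound_ge0 xK.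
by move=> e Be; have := diag_le_bound bB dx xK Be; rewrite normc_imag.
Qed.

Lemma diag_opexp B (t : H -> R) x s : orthonormal_basis ip B ->
  diagi B t x ->
  diag B (fun e => cis (s * t e)) (opexp (s%:C *: x)).
Proof.
move=> bB dx; have [K [K0 tK]] := diag_imag_bound bB dx.
have [u du] : exists u, diag B (fun e => cis (s * t e)) u.
  by apply: (diag_exists bB ler01) => e _; rewrite normc_cis.
have dsx : diag B (fun e => (s * t e) *i) (s%:C *: x).
  apply: (diag_ext (diag_scale _ dx)) => e _.
  by apply: complex_eqP; rewrite ?ReM ?ImM /=; ring.
rewrite (opexp_diag bB dsx du (K := `|s| * K))// => e Be.
by rewrite normrM ler_wpM2l// tK.
Qed.

Lemma diag_opexp_Up B (t : H -> R) x s : orthonormal_basis ip B ->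
  diagi B t x -> schatten x -> Up (opexp (s%:C *: x)).
Proof.
move=> bB dx sx; have du := diag_opexp s bB dx.
split; first exact: diag_unitary bB du.
have [] := diag_pn_dom bB (normr_ge0 s) (diag_sub du (diag_id B)) dx sx => //.
by move=> e Be; rewrite normc_imag -normrM cis_sub1_le.
Qed.

Lemma Up_log u : Up u -> exists x B t, [/\ orthonormal_basis ip B,
  diagi B t x, schatten_ah ip p x,
  forall e, B e -> `|t e| <= pi & diag B (fun e => cis (t e)) u].
Proof.
move=> Uu; have [B [t [bB tp du]]] := unitary_spectral Uu.
have [x dx] : exists x, diagi B t x.
  by apply: (diag_exists bB (pi_ge0 R)) => e Be; rewrite normc_imag tp.
exists x, B, t; split => //; split; last exact: (diag_skew bB dx).
have [] // := diag_pn_dom bB _ dx (diag_sub du (diag_id B)) Uu.2 (k := 4) => //.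
by move=> e Be; rewrite normc_imag cis_sub1_ge4// tp.
Qed.

Lemma geodesic_curve_Up u x s : Up u -> schatten_ah ip p x ->
  Up (geodesic_curve u x s).
Proof.
move=> Uu sx; have [B [t [bB dx]]] := skew_spectral sx.
by apply: Up_comp => //; exact: diag_opexp_Up bB dx sx.1.
Qed.

Lemma geodesic_curve0 u x : schatten_ah ip p x -> geodesic_curve u x 0 = u.
Proof.
move=> sx; have [B [t [bB dx]]] := skew_spectral sx.
have -> : geodesic_curve u x 0 = u \o idfun; last by [].
rewrite /geodesic_curve; congr (_ \o _).
apply: (diag_uniq bB (diag_opexp 0 bB dx) (diag_id B)) => e _.
by rewrite mul0r cis0.
Qed.

Lemma opexp1 (x : H -> H) : opexp ((1 : R)%:C *: x) = opexp x.
Proof. by rewrite scale1r. Qed.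

Lemma opnorm_diag_le B (t : H -> R) x (K : R) : orthonormal_basis ip B -> 0 <= K ->
  diagi B t x ->
  (opnorm x <= K%:E)%E <-> forall e, B e -> `|t e| <= K.
Proof.
move=> bB K0 dx; rewrite opnorm_le//; last exact: dx.1.1.
split=> [xK e Be|tK].
  by have := diag_le_bound bB dx xK Be; rewrite normc_imag.
by apply: (diag_bound bB K0 dx) => e Be; rewrite normc_imag tK.
Qed.

End UnitaryGroup.

(** * Derivatives and lengths of curves *)

Section Curves.
Implicit Types (u x d : H -> H) (g : R -> H -> H) (I : set R) (s t a b : R).

(** A first-order expansion in place of a difference quotient: it makes sense at [s = t] too and
    uses the real-valued [pn]. *)
Lemma pderivP I g t d : (forall s, I s -> schatten (g s - g t)) ->
  is_pderiv I g t d <-> schatten d /\ forall e, 0 < e -> exists r, 0 < r /\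
    forall s, I s -> `|s - t| < r -> pn (g s - g t - (s - t)%:C *: d) <= e * `|s - t|.
Proof.
move=> sg.
have key s : I s -> schatten d -> s != t -> forall e,
    ((pnorm (((s - t)^-1)%:C *: (g s - g t) - d)%R <= e%:E)%E <->
     pn (g s - g t - (s - t)%:C *: d) <= e * `|s - t|).
  move=> Is sd st e; have st0 : s - t != 0 by rewrite subr_eq0.
  have sq : schatten (((s - t)^-1)%:C *: (g s - g t) - d).
    by apply: schattenB => //; apply: schattenZ => //; exact: sg.
  have -> : g s - g t - (s - t)%:C *: d =
      (s - t)%:C *: (((s - t)^-1)%:C *: (g s - g t) - d).
    apply/funext => v; rewrite !opscaleE !opsubE !opscaleE scalerBr scalerA.
    by rewrite -rmorphM divff// scale1r.
  rewrite pnormE// lee_fin pnZ// normcR mulrC ler_pM2r//.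
  by rewrite normr_gt0.
split=> [[sd /cvge0P h]|[sd h]].
  split => // e e0.
  have /nbhs_ballP[r /= r0 rP] := h (fun _ => poweR_ge0 _ _) e e0.
  exists r; split => // s Is sr; have [->|st] := eqVneq s t.
    rewrite !subrr normr0 mulr0 scale0r subr0.
    by rewrite pn0.
  apply/(key s Is sd st); apply: rP => //.
  by rewrite /ball/= distrC.
split => //; apply/cvge0P; first by move=> s; exact: poweR_ge0.
move=> e e0; have [r [r0 rP]] := h e e0.
apply/nbhs_ballP; exists r => // s; rewrite /ball/= distrC => sr st Is.
by apply/(key s Is sd st); exact: rP.
Qed.

Lemma near_point t0 t1 t r : t0 < t1 -> t0 <= t <= t1 -> 0 < r ->
  exists s, [/\ t0 <= s <= t1, s != t & `|s - t| < r].
Proof.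
move=> t01 /andP[t0t tt1] r0; have r20 : 0 < r / 2 by rewrite divr_gt0.
have [tt|tt] := ltP t t1.
  exists (Num.min t1 (t + r / 2)).
  have h1 : t < Num.min t1 (t + r / 2) by rewrite lt_min tt ltrDl.
  have h2 : Num.min t1 (t + r / 2) <= t + r / 2 by rewrite ge_min lexx orbT.
  split; rewrite ?gt_eqF//.
    by rewrite ge_min lexx andbT (le_trans t0t (ltW h1)).
  by rewrite ger0_norm; lra.
exists (Num.max t0 (t - r / 2)).
have h1 : Num.max t0 (t - r / 2) < t by rewrite gt_max gtrBl r20 (lt_le_trans t01 tt).
have h2 : t - r / 2 <= Num.max t0 (t - r / 2) by rewrite le_max lexx orbT.
split; rewrite ?lt_eqF//.
  by rewrite le_max lexx/= (le_trans (ltW h1) tt1).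
by rewrite ler0_norm; lra.
Qed.

Lemma pderiv_unique t0 t1 g t d d' : t0 < t1 -> t0 <= t <= t1 ->
  (forall s, s \in `[t0, t1] -> schatten (g s - g t)) ->
  is_pderiv `[t0, t1] g t d -> is_pderiv `[t0, t1] g t d' -> d = d'.
Proof.
move=> t01 tI sg.
have sg' : forall s, (`[t0, t1]%classic : set R) s -> schatten (g s - g t) by [].
move=> /(pderivP _ sg')[sd h] /(pderivP _ sg')[sd' h'].
have sdd := schattenB sd sd'.
apply/eqP; rewrite -subr_eq0; apply/eqP; apply: (pn_eq0 sdd).
apply/eqP; rewrite eq_le pn_ge0 andbT; apply: (@approx_le0 _ 2) => e e0.
have [r [r0 rP]] := h e e0; have [r' [r'0 r'P]] := h' e e0.
have [|s [sI st]] := near_point t01 tI (r := Num.min r r').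
  by rewrite lt_min r0.
rewrite lt_min => /andP[sr sr'].
have sI' : (`[t0, t1]%classic : set R) s by rewrite /= in_itv.
have h1 := rP s sI' sr; have h2 := r'P s sI' sr'.
have st0 : 0 < `|s - t| by rewrite normr_gt0 subr_eq0.
rewrite -(ler_pM2r st0) mulrC -normcR -pnZ//.
have -> : (s - t)%:C *: (d - d') =
    (g s - g t - (s - t)%:C *: d') - (g s - g t - (s - t)%:C *: d).
  apply/funext => v; rewrite !opscaleE !opsubE !opscaleE scalerBr opprB.
  set X := g s v - g t v; rewrite -/X.
  by rewrite [RHS]addrC addrA subrK.
have s1 e' : schatten e' -> schatten (g s - g t - (s - t)%:C *: e').
  by move=> se; apply: schattenB => //; [exact: sg|exact: schattenZ].
rewrite (le_trans (pnB (s1 _ sd') (s1 _ sd)))//.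
rewrite normcR; lra.
Qed.

Lemma velocityE t0 t1 g t d : t0 < t1 -> t0 <= t <= t1 ->
  (forall s, s \in `[t0, t1] -> schatten (g s - g t)) ->
  is_pderiv `[t0, t1] g t d -> velocity ip p t0 t1 g t = d.
Proof.
move=> t01 tI sg gd; apply: (pderiv_unique t01 tI sg _ gd).
by apply: (@getPex _ [set d | is_pderiv `[t0, t1] g t d]); exists d.
Qed.

Lemma pn_abs_sub x d : schatten x -> schatten d -> `|pn x - pn d| <= pn (x - d).
Proof.
move=> sx sd; have sxd := schattenB sx sd.
have h1 := pnD sxd sd; rewrite subrK in h1.
have h2 := pnB sx sxd.
rewrite opprB addrC subrK in h2; rewrite ler_norml; apply/andP; split; lra.
Qed.

Lemma pderiv_bound g I t d : (forall s, I s -> schatten (g s - g t)) ->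
  is_pderiv I g t d -> forall e, 0 < e -> exists r, 0 < r /\
    forall s, I s -> `|s - t| < r -> pn (g s - g t) <= (pn d + e) * `|s - t|.
Proof.
move=> sg /(pderivP _ sg)[sd h] e e0; have [r [r0 rP]] := h e e0.
exists r; split => // s Is sr.
have s1 : schatten ((s - t)%:C *: d) by exact: schattenZ.
have s2 := schattenB (sg s Is) s1.
have := pnD s2 s1; rewrite subrK.
have := rP s Is sr; rewrite (pnZ _ sd) normcR; lra.
Qed.

(** The speed on the piece is [pn (D 1 t)]; the second derivative is used to make it continuous up
    to the end points. *)
Lemma smooth_piece t0 t1 a b g : t0 < t1 -> a < b -> t0 <= a -> b <= t1 ->
  (forall t, t \in `[t0, t1] -> Up (g t)) -> psmooth ip p a b g ->
  exists A, arcfun (fun s t => pn (g s - g t))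
    (fun t => pnorm (velocity ip p t0 t1 g t)) a b A.
Proof.
move=> t01 ab t0a bt1 Ug [D [D0 DP]].
have sub t : a <= t <= b -> t \in `[t0, t1].
  by move=> /andP[at_ tb]; rewrite in_itv/= (le_trans t0a at_) (le_trans tb bt1).
have sg t s : t \in `[t0, t1] -> s \in `[t0, t1] -> schatten (g s - g t).
  by move=> tI sI; apply: Up_sub => //; exact: Ug.
have sD n t : a <= t <= b -> schatten (D n.+1 t).
  by move=> tI; have [|] := DP n t; rewrite ?in_itv.
have d1 t : a <= t <= b -> is_pderiv `[a, b] g t (D 1%N t).
  by move=> tI; have := DP 0%N t; rewrite D0 in_itv; exact.
have d2 t : a <= t <= b -> is_pderiv `[a, b] (D 1%N) t (D 2%N t).
  by move=> tI; apply: DP; rewrite in_itv.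
apply: (@arcfun_piece _ _ (fun t => pn (D 1%N t))) => //.
- by move=> t _; exact: pn_ge0.
- move=> t tI e e0.
  have sDD s : (`[a, b]%classic : set R) s -> schatten (D 1%N s - D 1%N t).
    by rewrite /= in_itv/= => sI; apply: schattenB => //; exact: sD.
  have [r [r0 rP]] := pderiv_bound sDD (d2 t tI) ltr01.
  have c0 : 0 < pn (D 2%N t) + 1 by rewrite ltr_wpDl// pn_ge0.
  exists (Num.min r (e / (pn (D 2%N t) + 1))); split.
    by rewrite lt_min r0 divr_gt0.
  move=> s sI; rewrite lt_min => /andP[sr].
  rewrite ltr_pdivlMr// mulrC => /ltW se.
  rewrite (le_trans (pn_abs_sub (sD 0%N s sI) (sD 0%N t tI)))//.
  by rewrite (le_trans (rP s _ sr))// /= in_itv.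
- move=> t /andP[at_ tb]; have tI : a <= t <= b by rewrite !ltW.
  have sg' s : s \in `[t0, t1] -> schatten (g s - g t).
    by move=> sI; apply: sg => //; exact: sub.
  rewrite (@velocityE t0 t1 g t (D 1%N t))//; first by rewrite pnormE//; exact: sD.
    by have := sub t tI; rewrite in_itv.
  apply/pderivP; first by move=> s /= sI; exact: sg'.
  have sab s : (`[a, b]%classic : set R) s -> schatten (g s - g t).
    by rewrite /= in_itv/= => sI; apply: sg'; exact: sub.
  have /(pderivP _ sab)[sd h] := d1 t tI; split => // e e0.
  have [r [r0 rP]] := h e e0.
  (* Points this close to [t] stay in the piece, so the derivative relative to [[a, b]] is one
     relative to [[t0, t1]]. *)
  exists (Num.min r (Num.min (t - a) (b - t))); split.
    by rewrite !lt_min r0 !subr_gt0 at_.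
  move=> s _; rewrite !lt_min => /and3P[sr sa sb]; apply: rP => //=.
  have := ler_norm (s - t); have := ler_norm (t - s); rewrite distrC => h1 h2.
  by rewrite in_itv/=; apply/andP; split; lra.
- move=> t tI e e0.
  have sab s : (`[a, b]%classic : set R) s -> schatten (g s - g t).
    by rewrite /= in_itv/= => sI; apply: sg; exact: sub.
  have [r [r0 rP]] := pderiv_bound sab (d1 t tI) e0.
  by exists r; split => // s sI; apply: rP; rewrite /= in_itv.
Qed.

Lemma arc_length t0 t1 g : Up_curve ip p t0 t1 g ->
  exists A, arcfun (fun s t => pn (g s - g t))
      (fun t => pnorm (velocity ip p t0 t1 g t)) t0 t1 A /\
    plength ip p t0 t1 g = (A t1 - A t0)%:E.
Proof.
move=> [t01 Ug [s [[ps /eqP ls] sm]]].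
have [A hA] : exists A, arcfun (fun s t => pn (g s - g t))
      (fun t => pnorm (velocity ip p t0 t1 g t)) t0 t1 A.
  suff h a : t0 <= a -> a < t1 -> path <%R a s -> last a s = t1 ->
      (forall i, (i < size s)%N -> psmooth ip p (nth t1 (a :: s) i) (nth t1 s i) g) ->
      exists A, arcfun (fun s t => pn (g s - g t))
        (fun t => pnorm (velocity ip p t0 t1 g t)) a t1 A.
    exact: (h t0).
  elim: s a {ps ls sm} => [|x s IH] a t0a at1 /=.
    by move=> _ at1'; rewrite at1' ltxx in at1.
  move=> /andP[ax ps] ls sm.
  have xt1 : x <= t1.
    have /itv_partition_le : itv_partition x t1 s by split => //; apply/eqP.
    by [].
  have [A1 hA1] := smooth_piece t01 ax t0a xt1 Ug (sm 0%N isT).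
  (* The last subdivision point is [t1], where nothing remains to be glued. *)
  have [xE|xt] := eqVneq x t1; first (rewrite xE in hA1; exists A1; exact: hA1).
  have xlt : x < t1 by rewrite lt_def eq_sym xt.
  have [A2 hA2] := IH x (le_trans t0a (ltW ax)) xlt ps ls (fun i => sm i.+1).
  by apply: arcfun_glue hA1 hA2 => // t; exact: poweR_ge0.
exists A; split => //; have [[mf intE] _ _ _] := hA.
by rewrite /plength integral_itv_bndoo.
Qed.

End Curves.

(** * Smoothness and length of geodesics *)

Section Geodesics.
Implicit Types (u w x d : H -> H) (g : R -> H -> H) (s t a b : R) (F : seq H).

Lemma cis_sub (s t : R) : cis s - cis t = cis t * (cis (s - t) - 1).
Proof. by rewrite mulrBr mulr1 -cisD addrCA subrr addr0. Qed.

Lemma normc_cisM (t : R) z : normc (cis t * z) = normc z.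
Proof. by rewrite normcM normc_cis mul1r. Qed.

Lemma normcX (z : R[i]) n : normc (z ^+ n) = normc z ^+ n.
Proof. by elim: n => [|n IH]; rewrite ?expr0 ?normc1// !exprS normcM IH. Qed.

(** Up to the unitary factor [u], everything is diagonal in an eigenbasis of [x]. The derivative of
    order [n] is [u e^{sx} x^n]; differences and remainders are dominated, eigenvalue by eigenvalue,
    by a multiple of [x]. For [n = 0] only the differences are claimed to be Schatten operators. *)
Lemma geodesic_smooth u x : Up u -> schatten_ah ip p x ->
  psmooth ip p 0 1 (geodesic_curve u x) /\
  forall t, exists2 d, is_pderiv `[0, 1] (geodesic_curve u x) t d & pn d = pn x.
Proof.
move=> Uu Sx; have [B [th [bB dx]]] := skew_spectral Sx.
have [K [K0 thK]] := diag_imag_bound bB dx.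
have sx : schatten x by case: Sx.
have /UpP[Uun _] := Uu.
have bu := unitary_bop Uun.
pose L n (s : R) (e : H) : R[i] := cis (s * th e) * ((th e) *i) ^+ n.
pose Q n (s : R) : H -> H := opexp (s%:C *: x) \o iter n x.
have dQ n s : diag B (L n s) (Q n s).
  apply: (diag_comp bB (diag_opexp s bB dx)).
  exact: (diag_iter bB n dx).
have uB (y z : H -> H) : (u \o y) - (u \o z) = u \o (y - z).
  by apply/funext => v; rewrite opsubE /= opsubE (bopB bu).
have uZ (c : R) (z : H -> H) : c%:C *: (u \o z) = u \o (c%:C *: z).
  by apply/funext => v; rewrite opscaleE /= opscaleE (bopZ bu).
have pnU z : schatten z -> pn (u \o z) = pn z.
  by move=> sz; exact: (pn_unitary Uun sz).
have sU z : schatten z -> schatten (u \o z).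
  by move=> sz; exact: (schatten_comp bu sz).
have nX n e : B e -> normc (((th e) *i) ^+ n.+1) <= K ^+ n * normc ((th e) *i).
  move=> Be; rewrite normcX exprSr ler_wpM2r ?normc_ge0// normc_imag.
  by rewrite lerXn2r ?nnegrE// thK.
have sdiff n s t : schatten (Q n s - Q n t).
  have k0 : 0 <= `|s - t| * K ^+ n by rewrite mulr_ge0 ?exprn_ge0.
  have [] := diag_pn_dom bB k0
    (diag_sub (dQ n s) (dQ n t)) dx sx _ => // e Be.
  rewrite /L -mulrBl cis_sub normcM normc_cisM -mulrBl normcX normc_imag.
  rewrite (le_trans (ler_wpM2r (exprn_ge0 _ (normr_ge0 _)) (cis_sub1_le _)))//.
  rewrite normrM -!mulrA ler_wpM2l// mulrC ler_wpM2r//.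
  by rewrite lerXn2r ?nnegrE// thK.
have sQ n s : schatten (Q n.+1 s).
  have [] := diag_pn_dom bB (exprn_ge0 n K0) (dQ n.+1 s) dx sx _.
    by move=> e Be; rewrite /L normc_cisM nX.
  by [].
have der n (I : set R) t : is_pderiv I (fun s => u \o Q n s) t (u \o Q n.+1 t).
  apply/pderivP => [s _|]; first by rewrite uB; exact: sU.
  split; first exact: sU.
  move=> e e0; pose M := 2 * K ^+ n.+1 * pn x.
  have M0 : 0 <= M by rewrite !mulr_ge0 ?exprn_ge0// pn_ge0.
  have K1 : 0 < K + 1 by rewrite ltr_wpDl.
  have M1 : 0 < M + 1 by rewrite ltr_wpDl.
  (* The first radius gives [|(s - t) th| <= 1], the range of [cis_taylor1]; the second gives
     [M |s - t| <= e]. *)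
  exists (Num.min (K + 1)^-1 (e / (M + 1))); split.
    by rewrite lt_min invr_gt0 K1 divr_gt0.
  move=> s _; rewrite lt_min => /andP[sK sM].
  have sK1 : `|s - t| * K <= 1.
    move: sK; rewrite -(ltr_pM2r K1) mulVf ?gt_eqF// => /ltW; apply: le_trans.
    by rewrite ler_wpM2l// lerDl.
  have k0 : 0 <= 2 * (s - t) ^+ 2 * K ^+ n.+1.
    by rewrite mulr_ge0 ?exprn_ge0// mulr_ge0 ?sqr_ge0.
  rewrite uZ !uB.
  have dd := diag_sub (diag_sub (dQ n s) (dQ n t)) (diag_scale (s - t)%:C (dQ n.+1 t)).
  have [|sd pd] := diag_pn_dom bB k0 dd dx sx.
    move=> f Bf.
    have -> : L n s f - L n t f - (s - t)%:C * L n.+1 t f =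
       cis (t * th f) * ((cis ((s - t) * th f) - 1 - ((s - t) * th f) *i) *
         ((th f) *i) ^+ n).
      have -> : ((s - t) * th f) *i = (s - t)%:C * (th f) *i.
        by apply: complex_eqP; rewrite ?ReM ?ImM /=; ring.
      have sE : cis (s * th f) = cis ((s - t) * th f) * cis (t * th f).
        by rewrite -cisD; congr cis; ring.
      by rewrite /L sE exprS; ring.
    rewrite normc_cisM normcM normcX normc_imag.
    have h1 : `|(s - t) * th f| <= 1.
      by rewrite normrM (le_trans _ sK1)// ler_wpM2l// thK.
    rewrite (le_trans (ler_wpM2r (exprn_ge0 _ (normr_ge0 _)) (cis_taylor1 h1)))//.
    rewrite exprMn -(real_normK (num_real (th f))).
    have -> : 2 * ((s - t) ^+ 2 * `|th f| ^+ 2) * `|th f| ^+ n =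
      2 * (s - t) ^+ 2 * (`|th f| ^+ n.+1 * `|th f|) by rewrite !exprS; ring.
    rewrite -[leRHS]mulrA (ler_wpM2l (mulr_ge0 (ler0n _ 2) (sqr_ge0 _)))//.
    rewrite ler_wpM2r//.
    by rewrite lerXn2r ?nnegrE// thK.
  rewrite pnU// (le_trans pd)//.
  have -> : 2 * (s - t) ^+ 2 * K ^+ n.+1 * pn x = M * `|s - t| * `|s - t|.
    by rewrite /M -(real_normK (num_real (s - t))); ring.
  rewrite ler_wpM2r//; move: sM; rewrite ltr_pdivlMr// => /ltW.
  by apply: le_trans; rewrite mulrC ler_wpM2l// lerDl.
have Q0 : (fun s => u \o Q 0%N s) = geodesic_curve u x by [].
split.
  exists (fun n s => u \o Q n s); split; first exact: Q0.
  by move=> n t _; exact: der.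
move=> t; exists (u \o Q 1%N t); first by rewrite -Q0; exact: der.
rewrite pnU//.
have Ue := diag_unitary bB (diag_opexp t bB dx).
exact: (pn_unitary Ue sx).
Qed.

Lemma geodesic_Up_curve u x : Up u -> schatten_ah ip p x ->
  Up_curve ip p 0 1 (geodesic_curve u x).
Proof.
move=> Uu Sx; split=> //.
  by move=> t _; exact: geodesic_curve_Up.
exists [:: 1]; split; first by split; rewrite /= ?ltr01.
move=> [|i] // _; exact: (geodesic_smooth Uu Sx).1.
Qed.

Lemma plength_geodesic u x : Up u -> schatten_ah ip p x ->
  plength ip p 0 1 (geodesic_curve u x) = (pn x)%:E.
Proof.
move=> Uu Sx; have Ug t : Up (geodesic_curve u x t).
  exact: geodesic_curve_Up.
rewrite /plength (@eq_integral _ _ _ _ _ (cst (pn x)%:E)).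
  rewrite integral_cst//=.
  by rewrite lebesgue_measure_itv/= lte_fin ltr01 oppr0 adde0 mule1.
move=> t; rewrite inE/= in_itv/= => tI.
have [d dd pd] := (geodesic_smooth Uu Sx).2 t.
rewrite (velocityE ltr01 tI _ dd); first by rewrite pnormE ?pd//; case: dd.
by move=> s _; exact: (Up_sub (Ug s) (Ug t)).
Qed.

End Geodesics.

(** * Angles along a curve *)

Section CurveAngles.
Implicit Types (u v w x : H -> H) (g : R -> H -> H) (s t a b : R) (F : seq H).

Lemma arcfun_small (D : R -> R -> R) f a b A : arcfun D f a b A ->
  forall t, a <= t <= b -> forall e, 0 < e -> exists d, 0 < d /\
    forall s, a <= s <= b -> `|s - t| < d -> D s t < e.
Proof.
move=> [_ _ lip loc] t tI e e0.
have [K [d1 [d10 K0 h1]]] := lip t tI; have [d2 [d20 h2]] := loc t tI 1 ltr01.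
have K1 : 0 < K + 1 by rewrite ltr_wpDl.
exists (Num.min d1 (Num.min d2 (e / (K + 1)))); split.
  by rewrite !lt_min d10 d20 divr_gt0.
move=> s sI; rewrite !lt_min ltr_pdivlMr// => /and3P[s1 s2 s3].
rewrite (le_lt_trans (h2 s sI s2))// (le_lt_trans _ s3)// mulrDr mulr1 mul1r.
by rewrite lerD2r mulrC h1.
Qed.

Lemma acos1R : acos (1 : R) = 0.
Proof. by rewrite -[X in acos X]cos0 cosK// in_itv/= lexx pi_ge0. Qed.

Lemma ang_refl (y : H) : nr y = 1 -> ang y y = 0.
Proof. by move=> y1; rewrite /ang ipvv y1 expr1n acos1R. Qed.

Lemma ang_unitary u (y z : H) : unitary u -> ang (u y) (u z) = ang y z.
Proof. by move=> Uu; rewrite /ang unitary_ip. Qed.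

Lemma ang_eq0 (y z : H) : nr y = 1 -> nr z = 1 -> ang y z = 0 -> y = z.
Proof.
move=> y1 z1 a0; apply/eqP; rewrite -subr_eq0 -nr_eq0 -sqrf_eq0.
by rewrite chord_ang// a0 cos0 mulr1 subrr.
Qed.

Lemma ang_diff (y z w : H) : nr y = 1 -> nr z = 1 -> nr w = 1 ->
  `|ang y z - ang y w| <= ang z w.
Proof.
move=> y1 z1 w1; have h1 := ang_triangle y1 z1 w1.
have h2 := ang_triangle y1 w1 z1; rewrite (angC w z) in h2.
by rewrite ler_norml; apply/andP; split; lra.
Qed.

Lemma sum_nr_le x F (Y : R) : schatten x -> ons F -> pn x <= Y ->
  \sum_(e <- F) nr (x e) ^+ p <= Y ^+ p.
Proof.
move=> sx oF xY; rewrite (le_trans (pn_sum sx oF))//.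
by rewrite lerXn2r ?nnegrE ?pn_ge0// (le_trans _ xY)// pn_ge0.
Qed.

Lemma Up_curve_schatten t0 t1 g s t : Up_curve ip p t0 t1 g ->
  t0 <= s <= t1 -> t0 <= t <= t1 -> schatten (g s - g t).
Proof.
move=> [_ Ug _] sI tI.
by apply: Up_sub; apply: Ug; rewrite in_itv.
Qed.

(** [arcfun_le] with [C = 1], for the distance to the fixed point [g s]. *)
Lemma curve_chord t0 t1 g f A s t : Up_curve ip p t0 t1 g ->
  arcfun (fun s t => pn (g s - g t)) f t0 t1 A -> t0 <= s -> s <= t -> t <= t1 ->
  pn (g t - g s) <= A t - A s.
Proof.
move=> cg hA t0s st tt1; have [t01 _ _] := cg.
have sI : t0 <= s <= t1 by rewrite t0s (le_trans st tt1).
have sg r r' : t0 <= r <= t1 -> t0 <= r' <= t1 -> schatten (g r - g r').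
  exact: (Up_curve_schatten cg).
have := @arcfun_le _ _ _ _ _ (fun r => pn (g r - g s)) 1 (ltW t01) ler01 hA _
  s t t0s st tt1.
rewrite subrr pn0 subr0 mul1r; apply => r rI e e0.
exists 1; split => // r' r'I _.
rewrite (le_trans (pn_abs_sub (sg _ _ r'I sI) (sg _ _ rI sI)))//.
have -> : g r' - g s - (g r - g s) = g r' - g r by rewrite opprB addrA subrK.
by rewrite ler_peMl ?pn_ge0// lerDl ltW.
Qed.

(** Let [r^p] be the sum to be bounded. With the weights [al^(p-1)] frozen, the function [h] rises
    from 0 at [s] to [r^p] at [t], and Hölder bounds its variation by [r^(p-1)] times the chord, to
    first order. Hence [r^p <= r^(p-1) (A t - A s)]. *)
Lemma curve_ang_sum t0 t1 g f A s t F : Up_curve ip p t0 t1 g ->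
  arcfun (fun s t => pn (g s - g t)) f t0 t1 A -> t0 <= s -> s <= t -> t <= t1 ->
  ons F -> \sum_(e <- F) ang (g s e) (g t e) ^+ p <= (A t - A s) ^+ p.
Proof.
move=> cg hA t0s st tt1 oF; have [t01 Ug _] := cg.
have sI : t0 <= s <= t1 by rewrite t0s (le_trans st tt1).
have tI : t0 <= t <= t1 by rewrite tt1 (le_trans t0s st).
have sg r r' : t0 <= r <= t1 -> t0 <= r' <= t1 -> schatten (g r - g r').
  exact: (Up_curve_schatten cg).
have g1 r e : t0 <= r <= t1 -> e \in F -> nr (g r e) = 1.
  move=> rI eF; have /UpP[Ur _] : Up (g r) by apply: Ug; rewrite in_itv.
  by rewrite (unitary_nr _ Ur) (ons_nr oF).
(* The value 0 off [F] makes [al] nonnegative everywhere, as [holder_pow] requires. *)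
pose al e := if e \in F then ang (g s e) (g t e) else 0.
have al0 e : 0 <= al e.
  rewrite /al; case: ifP => // eF.
  by have /andP[] := ang_itv (g1 s e sI eF) (g1 t e tI eF).
have alE : \sum_(e <- F) ang (g s e) (g t e) ^+ p = \sum_(e <- F) al e ^+ p.
  by rewrite [LHS]big_seq [RHS]big_seq; apply: eq_bigr => e eF; rewrite /al eF.
have As : 0 <= A t - A s.
  by have [_ mA _ _] := hA; rewrite subr_ge0 mA.
have pE : p = p.-1.+1 by rewrite prednK.
rewrite alE; set S := \sum_(e <- F) al e ^+ p.
have S0 : 0 <= S by apply: sumr_ge0 => e _; rewrite exprn_ge0.
have [r r0 rS] : exists2 r, 0 <= r & r ^+ p = S.
  exact: pow_root.
have [r_eq0|r_neq0] := eqVneq r 0.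
  by rewrite -rS r_eq0 expr0n gtn_eqF// exprn_ge0.
have rgt0 : 0 < r by rewrite lt_def r_neq0.
rewrite -rS lerXn2r ?nnegrE//.
pose C := r ^+ p.-1; have C0 : 0 < C by rewrite exprn_gt0.
pose h z := \sum_(e <- F) al e ^+ p.-1 * ang (g s e) (g z e).
have main : h t - h s <= C * (A t - A s).
  apply: (arcfun_le (ltW t01) (ltW C0) hA _ t0s st tt1) => z zI eps eps0.
  (* The relative error [eps / C] becomes the additive [eps] in [C + eps]. *)
  have [d [d0 dP]] := ang_chord (divr_gt0 eps0 C0).
  have [d' [d'0 d'P]] := arcfun_small hA zI d0.
  exists d'; split => // y yI yz.
  have sy := sg _ _ yI zI.
  have nry e' : e' \in F -> nr (g y e' - g z e') <= pn (g y - g z).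
    move=> e'F; have [_ /(_ e')] := pn_opbound sy.
    by rewrite opsubE (ons_nr oF e'F) mulr1.
  have step : `|h y - h z| <=
      \sum_(e <- F) al e ^+ p.-1 * ((1 + eps / C) * nr ((g y - g z) e)).
    rewrite /h -sumrB (le_trans (ler_norm_sum _ _ _))//.
    apply: ler_sum_in => e' e'F.
    rewrite -mulrBr normrM ger0_norm ?exprn_ge0// ler_wpM2l ?exprn_ge0//.
    rewrite (le_trans (ang_diff (g1 _ _ sI e'F) (g1 _ _ yI e'F) (g1 _ _ zI e'F)))//.
    rewrite opsubE dP ?g1// (le_lt_trans (nry _ e'F))//.
    exact: d'P.
  rewrite (le_trans step)//.
  under eq_bigr do rewrite mulrCA.
  rewrite -mulr_sumr -[C + eps](_ : C * (1 + eps / C) = _); last first.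
    by rewrite mulrDr mulr1 mulrCA divff ?gt_eqF// mulr1.
  rewrite -mulrA (mulrC C) -mulrA ler_wpM2l//; last rewrite mulrC.
    by rewrite addr_ge0// divr_ge0// ltW.
  (* [holder_pow] asks for a positive bound, and [pn (g y - g z)] may vanish. *)
  rewrite -subr_le0; apply: (@approx_le0 _ C) => eta eta0.
  rewrite lerBlDl -mulrDr.
  have Y0 : 0 < pn (g y - g z) + eta by rewrite ltr_wpDl ?pn_ge0.
  apply: (holder_pow rgt0 Y0 al0) => [i||]; first exact: nr_ge0.
    by rewrite -pE rS.
  by rewrite -pE; apply: sum_nr_le => //; rewrite lerDl ltW.
have hs : h s = 0.
  rewrite /h big_seq big1// => e eF.
  by rewrite ang_refl ?mulr0// g1.
have ht : h t = C * r.
  rewrite -exprSr -pE rS /S /h big_seq [RHS]big_seq; apply: eq_bigr => e eF.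
  have aE : al e = ang (g s e) (g t e) by rewrite /al eF.
  by rewrite -aE -exprSr -pE.
by move: main; rewrite hs ht subr0 ler_pM2l.
Qed.

End CurveAngles.

(** * The distance and its comparison with the norm *)

Section Distance.
Implicit Types (u v w x : H -> H) (g : R -> H -> H) (s t a b : R) (F : seq H).
Implicit Types (B : set H) (th : H -> R).

Lemma geodesic_curve1 u x : geodesic_curve u x 1 = u \o opexp x.
Proof. by rewrite /geodesic_curve opexp1. Qed.

Lemma ang_opexp B th u x e : unitary u -> orthonormal_basis ip B ->
  diagi B th x -> `|th e| <= pi -> B e ->
  ang (u e) (u (opexp x e)) = `|th e|.
Proof.
move=> Uu bB dx thpi Be; rewrite ang_unitary//.
have := (diag_opexp 1 bB dx).2 e Be; rewrite opexp1 mul1r => ->.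
by rewrite ang_cis// (basis_nr bB Be).
Qed.

Lemma pn_le_ang_sum B th u x (D : R) : unitary u -> orthonormal_basis ip B ->
  diagi B th x -> (forall e, B e -> `|th e| <= pi) -> 0 <= D ->
  (forall F, ons F -> \sum_(e <- F) ang (u e) (u (opexp x e)) ^+ p <= D ^+ p) ->
  pn x <= D.
Proof.
move=> Uu bB dx thpi D0 h; apply: pn_le.
apply: (diag_pball bB dx D0) => F uF FB.
rewrite (le_trans _ (h F (ons_of_set bB.1 uF FB)))//.
apply: ler_sum_in => e /FB Be.
by rewrite normc_imag (ang_opexp Uu bB dx (thpi e Be) Be).
Qed.

Lemma pn_le_plength B th u x t0 t1 g : unitary u -> orthonormal_basis ip B ->
  diagi B th x -> (forall e, B e -> `|th e| <= pi) ->
  joins ip p u (u \o opexp x) t0 t1 g -> ((pn x)%:E <= plength ip p t0 t1 g)%E.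
Proof.
move=> Uu bB dx thpi [cg g0 g1].
have [A [hA ->]] := arc_length cg.
have [t01 _ _] := cg; have [_ mA _ _] := hA.
rewrite lee_fin; apply: (pn_le_ang_sum Uu bB dx thpi).
  by rewrite subr_ge0 mA ?(ltW t01).
move=> F oF.
have := curve_ang_sum cg hA (lexx _) (ltW t01) (lexx _) oF.
by rewrite g0 g1.
Qed.

Lemma joins_geodesic u x : Up u -> schatten_ah ip p x ->
  joins ip p u (u \o opexp x) 0 1 (geodesic_curve u x).
Proof.
move=> Uu Sx; split; first exact: geodesic_Up_curve.
  exact: (geodesic_curve0 u Sx).
exact: geodesic_curve1.
Qed.

Lemma pdist_opexp B th u x : Up u -> schatten_ah ip p x ->
  orthonormal_basis ip B -> diagi B th x ->
  (forall e, B e -> `|th e| <= pi) -> pdist u (u \o opexp x) = (pn x)%:E.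
Proof.
move=> Uu Sx bB dx thpi; apply/eqP; rewrite eq_le; apply/andP; split.
  apply: ereal_inf_lbound; exists 0, 1, (geodesic_curve u x).
  split; first exact: joins_geodesic.
  by rewrite plength_geodesic.
apply: le_ereal_inf_tmp => _ [t0 [t1 [g [jg ->]]]].
have /UpP[Uun _] := Uu; exact: (pn_le_plength Uun bB dx thpi jg).
Qed.

Lemma Up_log2 u v : Up u -> Up v -> exists x B th,
  [/\ orthonormal_basis ip B, diagi B th x, schatten_ah ip p x,
    forall e, B e -> `|th e| <= pi & v = u \o opexp x].
Proof.
move=> Uu Uv; have Uw := Up_comp (Up_adj Uu) Uv.
have [x [B [th [bB dx Sx thpi dw]]]] := Up_log Uw.
exists x, B, th; split => //.
have -> : opexp x = adjoint ip u \o v.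
  have dE := diag_opexp 1 bB dx; rewrite opexp1 in dE.
  by apply: (diag_uniq bB dE dw) => e _; rewrite mul1r.
have /UpP[/unitaryP[_ _ h] _] := Uu.
by apply/funext => y /=; rewrite h.
Qed.

Definition ang_bound u v (D : R) := 0 <= D /\
  forall F, ons F -> \sum_(e <- F) ang (u e) (v e) ^+ p <= D ^+ p.

(** All clauses come from the geodesic of the principal logarithm of [adj u \o v]. Its length is
    [d]; [curve_ang_sum] and [curve_chord] bound its angles and its chord, and the angles at the
    eigenvectors exclude a smaller bound. *)
Lemma pdistP u v : Up u -> Up v -> exists d,
  [/\ pdist u v = d%:E, ang_bound u v d, forall D, ang_bound u v D -> d <= D
    & pn (u - v) <= d].
Proof.
move=> Uu Uv; have [x [B [th [bB dx Sx thpi vE]]]] := Up_log2 Uu Uv.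
exists (pn x); have [cg g0 g1] := joins_geodesic Uu Sx; rewrite -vE in g1.
have [A [hA]] := arc_length cg.
rewrite plength_geodesic// => -[AE].
have Uun : unitary u by case: Uu.
split.
- by rewrite vE (pdist_opexp _ Sx bB dx).
- split => [|F oF]; first exact: pn_ge0.
  have := curve_ang_sum cg hA (lexx _) ler01 (lexx _) oF.
  by rewrite g0 g1 AE.
- by move=> D [D0]; rewrite vE => h; exact: (pn_le_ang_sum Uun bB dx thpi D0 h).
- have := curve_chord cg hA (lexx _) ler01 (lexx _).
  rewrite g0 g1 -AE pnB_C//.
  exact: Up_sub.
Qed.

Lemma ang_boundC u v D : ang_bound u v D -> ang_bound v u D.
Proof.
move=> [D0 h]; split => // F oF; rewrite (le_trans _ (h F oF))//.
by apply: ler_sum => e _; rewrite angC.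
Qed.

(** The triangle inequality on the sphere for each [e], then Minkowski, whose strictly positive
    bounds are the reason for [eta]. *)
Lemma ang_bound_triangle u v w D E : unitary u -> unitary v -> unitary w ->
  ang_bound u v D -> ang_bound v w E -> ang_bound u w (D + E).
Proof.
move=> Uu Uv Uw [D0 hD] [E0 hE]; split => [|F oF]; first exact: addr_ge0.
have u1 z e : unitary z -> e \in F -> nr (z e) = 1.
  by move=> Uz eF; rewrite (unitary_nr _ Uz) (ons_nr oF).
pose al z z' e := if e \in F then ang (z e) (z' e) else 0.
have alE z z' : \sum_(e <- F) ang (z e) (z' e) ^+ p = \sum_(e <- F) al z z' e ^+ p.
  by rewrite [LHS]big_seq [RHS]big_seq; apply: eq_bigr => e eF; rewrite /al eF.
have al0 z z' : unitary z -> unitary z' -> forall e, 0 <= al z z' e.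
  move=> Uz Uz' e; rewrite /al; case: ifP => // eF.
  by have /andP[] := ang_itv (u1 z e Uz eF) (u1 z' e Uz' eF).
have h1 := hD F oF; have h2 := hE F oF; rewrite !alE in h1 h2 *.
have step : \sum_(e <- F) al u w e ^+ p <= \sum_(e <- F) (al u v e + al v w e) ^+ p.
  apply: ler_sum_in => e eF.
  rewrite lerXn2r ?nnegrE ?addr_ge0 ?al0// /al eF.
  by apply: ang_triangle; exact: u1.
rewrite (le_trans step)//.
set S := \sum_(e <- F) _.
have S0 : 0 <= S by apply: sumr_ge0 => e _; rewrite exprn_ge0// addr_ge0// al0.
have [r r0 rS] : exists2 r, 0 <= r & r ^+ p = S.
  exact: pow_root.
rewrite -rS lerXn2r ?nnegrE ?addr_ge0// -subr_le0.
apply: (@approx_le0 _ 2) => eta eta0.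
have Deta : 0 < D + eta by rewrite ltr_wpDl.
have Eeta : 0 < E + eta by rewrite ltr_wpDl.
have mono (y : R) : 0 <= y -> y ^+ p <= (y + eta) ^+ p.
  by move=> y0; rewrite lerXn2r ?nnegrE ?addr_ge0 ?(ltW eta0)// lerDl ltW.
have := minkowski_pow Deta Eeta (al0 u v Uu Uv) (al0 v w Uv Uw)
  (le_trans h1 (mono D D0)) (le_trans h2 (mono E E0)).
rewrite -/S -rS ler_pexp// ?addr_ge0 ?(ltW Deta) ?(ltW Eeta)//; lra.
Qed.

Lemma pdist_metric : metric_on (Up) (pdist).
Proof.
split.
- move=> u v Uu Uv; have [d [-> [d0 _] _ _]] := pdistP Uu Uv.
  by rewrite lee_fin d0 ltry.
- move=> u v Uu Uv; have [d [-> dB dmin dn]] := pdistP Uu Uv.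
  split=> [[d0]|uv].
    have suv := Up_sub Uu Uv.
    apply/eqP; rewrite -subr_eq0; apply/eqP.
    apply: (pn_eq0 suv); apply/eqP.
    by rewrite eq_le pn_ge0 andbT -d0.
  have d0 : d <= 0.
    apply: dmin; split => // F oF; rewrite big_seq big1 ?exprn_ge0// => e eF.
    have Uvn : unitary v by case: Uv.
    rewrite uv ang_refl ?expr0n ?gtn_eqF//.
    by rewrite (unitary_nr _ Uvn) (ons_nr oF).
  by have [d0' _] := dB; congr EFin; apply/eqP; rewrite eq_le d0.
- move=> u v Uu Uv; have [d [-> dB dmin _]] := pdistP Uu Uv.
  have [e [-> eB emin _]] := pdistP Uv Uu.
  congr EFin; apply/eqP; rewrite eq_le dmin/=; last exact: ang_boundC.
  by rewrite emin//; exact: ang_boundC.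
- move=> u v w Uu Uv Uw; have [d [-> dB _ _]] := pdistP Uu Uv.
  have [e [-> eB _ _]] := pdistP Uv Uw; have [f [-> _ fmin _]] := pdistP Uu Uw.
  rewrite -EFinD lee_fin; apply: fmin.
  case: Uu => Uu _; case: Uv => Uv _; case: Uw => Uw _.
  exact: ang_bound_triangle dB eB.
Qed.

Lemma pn_opexp_sub B th u x : unitary u -> schatten_ah ip p x ->
  orthonormal_basis ip B -> diagi B th x ->
  [/\ schatten (opexp x - idfun), diag B (fun e => cis (th e) - 1) (opexp x - idfun)
    & schatten (u - (u \o opexp x)) -> pn (u - (u \o opexp x)) = pn (opexp x - idfun)].
Proof.
move=> Uu [sx _] bB dx; have := diag_opexp_Up 1 bB dx sx.
rewrite opexp1 => /UpP[_ sE]; split => //.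
  have dE := diag_opexp 1 bB dx; rewrite opexp1 in dE.
  have dE' : diag B (fun e => cis (th e)) (opexp x).
    by apply: (diag_ext dE) => e _; rewrite mul1r.
  exact: (diag_sub dE' (diag_id B)).
move=> su; rewrite (pnB_C su).
have -> : (u \o opexp x) - u = u \o (opexp x - idfun).
  apply/funext => y; rewrite opsubE /= opsubE (bopB (unitary_bop Uu)).
  by [].
exact: (pn_unitary Uu sE).
Qed.

(** Two constants, as it serves twice: [k = 1] with the sharper [c] for the comparison with
    [|u - v|_p], and [c = 1], [k = 4] for completeness. *)
Lemma pdist_le_pn k c u v : Up u -> Up v -> 0 <= k ->
  (forall t : R, `|t| <= pi -> c * `|t| <= k * normc (cis t - 1)) -> 0 < c ->
  (c%:E * pdist u v <= (k * pn (u - v))%:E)%E.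
Proof.
move=> Uu Uv k0 hk c0; have [x [B [th [bB dx Sx thpi vE]]]] := Up_log2 Uu Uv.
have Uun : unitary u by case: Uu.
have sx : schatten x by case: Sx.
rewrite vE (pdist_opexp Uu Sx bB dx thpi) -EFinM lee_fin -vE.
have [sE dE pE] := pn_opexp_sub Uun Sx bB dx.
rewrite -vE in pE; rewrite pE; last exact: Up_sub.
have k0' : 0 <= k / c by rewrite divr_ge0// ltW.
have [|_] := diag_pn_dom bB k0' dx dE sE.
  move=> e Be; rewrite normc_imag mulrAC ler_pdivlMr// mulrC.
  exact: hk (thpi e Be).
by rewrite mulrAC ler_pdivlMr// mulrC.
Qed.

Lemma pdist_pn_bounds u v : Up u -> Up v ->
  ((Num.sqrt (1 - pi ^+ 2 / 12))%:E * pdist u v <= pnorm (u - v)%R)%E /\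
  (pnorm (u - v)%R <= pdist u v)%E.
Proof.
move=> Uu Uv; have suv := Up_sub Uu Uv; rewrite pnormE//.
split; last by have [d [-> _ _ dn]] := pdistP Uu Uv; rewrite lee_fin.
(* A vanishing root is treated apart, because [pdist_le_pn] asks for a positive constant. *)
have := sqrtr_ge0 (1 - pi ^+ 2 / 12 : R); rewrite le_eqVlt => /orP[/eqP <-|c0].
  by rewrite mul0e lee_fin pn_ge0.
have := pdist_le_pn Uu Uv ler01 _ c0; rewrite mul1r; apply => t tpi.
by rewrite mul1r cis_sub1_ge.
Qed.

End Distance.

(** * Completeness of the distance *)

Section Completeness.
Implicit Types (v w : H) (f : nat -> H -> H).

(** The adjoints converge at the same rate, so both unitarity relations pass to the limit. *)
Lemma unitary_limit f l : (forall n, unitary (f n)) -> bop l ->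
  (forall e : R, 0 < e -> exists n, forall v, nr (f n v - l v) <= e * nr v) ->
  unitary l.
Proof.
move=> Uf bl fl.
have aux e : 0 < e -> exists n, forall v, nr (f n v - l v) <= e * nr v /\
    nr (adj (f n) v - adj l v) <= e * nr v.
  move=> e0; have [n nP] := fl e e0; exists n => v; split => //.
  have bfn := unitary_bop (Uf n).
  have ob : opbound (f n - l) e by split=> [|w]; rewrite ?(ltW e0)// opsubE.
  have [_ /(_ v)] := adj_bound (bop_sub bfn bl) ob.
  by rewrite adj_sub// opsubE.
apply/unitaryP; split => // v; apply/eqP; rewrite -subr_eq0 -nr_eq0 eq_le nr_ge0 andbT.
  apply: (@approx_le0 _ (nr (l v) + nr v)) => e e0; have [n nP] := aux e e0.
  have /unitaryP[_ h _] := Uf n; have Ua := unitary_adj (Uf n).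
  rewrite (le_trans (nr_triangle _ (adj (f n) (l v)) _))//.
  rewrite nrBC mulrDl lerD//; first by rewrite mulrC (nP (l v)).2.
  rewrite -[X in nr (_ - X)](h v) -(bopB (unitary_bop Ua)) (unitary_nr _ Ua) nrBC mulrC.
  exact: (nP v).1.
apply: (@approx_le0 _ (nr (adj l v) + nr v)) => e e0; have [n nP] := aux e e0.
have /unitaryP[_ _ h] := Uf n; have Ua := Uf n.
rewrite (le_trans (nr_triangle _ (f n (adj l v)) _))//.
rewrite nrBC mulrDl lerD//; first by rewrite mulrC (nP (adj l v)).1.
rewrite -[X in nr (_ - X)](h v) -(bopB (unitary_bop Ua)) (unitary_nr _ Ua) nrBC mulrC.
exact: (nP v).2.
Qed.

Lemma pdist_complete : complete_on (Up) (pdist).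
Proof.
move=> f Uf fC.
have sf m n := Up_sub (Uf m) (Uf n).
have pC e : 0 < e -> exists N, forall m n, (N <= m)%N -> (N <= n)%N ->
    pn (f m - f n) <= e.
  move=> e0; have [N NP] := fC e e0; exists N => m n Nm Nn.
  have := NP m n Nm Nn.
  have [d [-> _ _ dn]] := pdistP (Uf m) (Uf n).
  by rewrite lte_fin => /ltW; exact: le_trans.
have Un n : unitary (f n) by have /UpP[] := Uf n.
have bf n : bop (f n) by exact: (unitary_bop (Un n)).
have [|l [bl fl]] := operator_limit bf.
  move=> e e0; have [N NP] := pC e e0; exists N => m n Nm Nn v.
  have [_ /(_ v)] := pn_opbound (sf m n); rewrite opsubE => h.
  by rewrite (le_trans h)// ler_wpM2r ?nr_ge0// NP.
have Ul : unitary l.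
  apply: (unitary_limit Un bl) => e e0; have [N NP] := fl e e0.
  by exists N; exact: NP.
have pl e : 0 < e -> exists N, forall n, (N <= n)%N -> pball (f n - l) e.
  move=> e0; have [N NP] := pC e e0; exists N => n Nn.
  (* The operators [f n - f m] stay in the ball of radius [e] and tend to [f n - l] in operator
     norm. *)
  apply: (pball_lim (bop_sub (bf n) bl) (ltW e0)) => r r0.
  have [M MP] := fl r r0; exists (f n - f (maxn N M)); split.
    apply: (pball_le (NP n (maxn N M) Nn (leq_maxl _ _))).
    exact: (pn_ball (sf _ _)).
  move=> v; rewrite !opsubE.
  have -> : f n v - l v - (f n v - f (maxn N M) v) = f (maxn N M) v - l v.
    by rewrite opprB addrCA addrAC subrr add0r addrC.
  by apply: MP; exact: leq_maxr.
have UPl : Up l.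
  apply/UpP; split => //; have [N /(_ N (leqnn N)) NP] := pl 1 ltr01.
  have s1 := pball_schatten NP.
  have /UpP[_ s2] := Uf N.
  have := schattenB s2 s1.
  have -> // : f N - idfun - (f N - l) = l - idfun.
  by rewrite opprB addrCA addrAC subrr add0r addrC.
exists l => //; apply/cvge0P.
  move=> n; have [d [-> [d0 _] _ _]] := pdistP (Uf n) UPl.
  by rewrite lee_fin.
move=> e e0; have e40 : 0 < e / 4 by rewrite divr_gt0.
have [N NP] := pl _ e40; exists N => // n /= Nn.
have := pdist_le_pn (Uf n) UPl (ler0n _ 4) _ ltr01.
rewrite mul1e => h; rewrite (le_trans (h _))//.
  by move=> t tpi; rewrite mul1r cis_sub1_ge4.
rewrite lee_fin -ler_pdivlMl// mulrC.
exact: (pn_le (NP n Nn)).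
Qed.

End Completeness.

(** * Shortest curves and minimal geodesics *)

Section Uniqueness.
Implicit Types (u v w x y : H -> H) (g : R -> H -> H) (s t a b : R) (F : seq H).
Implicit Types (B : set H) (th : H -> R).

Lemma opnorm_lt x (K : R) (y : H) : (opnorm x < K%:E)%E -> nr y <= 1 -> nr (x y) < K.
Proof.
move=> xK y1; rewrite -lte_fin (le_lt_trans _ xK)//.
apply: ereal_sup_ubound; exists y => //=.
by rewrite nrE -[1]/((1 : R)%:C) lecR.
Qed.

Lemma sum_gap (F : seq H) (f g : H -> R) e : e \in F ->
  {in F, forall i, f i <= g i} ->
  \sum_(i <- F) f i + (g e - f e) <= \sum_(i <- F) g i.
Proof.
move=> eF fg; rewrite !(big_rem e eF)/= [leLHS]addrC [leLHS]addrA subrK lerD2l.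
apply: ler_sum_in => i /mem_rem; exact: fg.
Qed.

(** Strict inequalities between finite sums may be lost in the supremum; a deficit [d] at the single
    vector [e0] is uniform in [F] and bounds all sums by [Y ^+ p - d]. *)
Lemma diag_gap B l x e0 (d Y : R) : orthonormal_basis ip B -> diag B l x -> B e0 ->
  0 < d -> 0 <= Y ->
  (forall F, uniq F -> {in F, forall e, B e} -> e0 \in F ->
    \sum_(e <- F) normc (l e) ^+ p + d <= Y ^+ p) -> pn x < Y.
Proof.
move=> bB dx Be0 d0 Y0 h.
have c0 F : 0 <= \sum_(e <- F) normc (l e) ^+ p.
  by apply: sumr_ge0 => e _; rewrite exprn_ge0 ?normc_ge0.
have h0 := h [:: e0] isT; have {h0} : 0 <= Y ^+ p - d.
  have := h0 _ (mem_head _ _); have := c0 [:: e0] => h1 h2; rewrite subr_ge0.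
  rewrite (le_trans _ (h2 _)) ?lerDr// => e; rewrite inE => /eqP ->; exact: Be0.
move=> Yd; have [r r0 rE] : exists2 r, 0 <= r & r ^+ p = Y ^+ p - d.
  exact: pow_root.
have rY : r < Y.
  rewrite ltNge; apply/negP => Yr; have := Y0; rewrite -ler_pexp // in Yr.
  by move: Yr; rewrite rE; lra.
apply: le_lt_trans rY; apply: pn_le.
apply: (diag_pball bB dx r0) => F uF FB; rewrite rE.
rewrite lerBrDr; have [e0F|e0F] := boolP (e0 \in F); first exact: h.
(* A family without [e0] is enlarged by it, which does not decrease the sum. *)
have := h (e0 :: F); rewrite /= e0F uF => /(_ isT) h1.
have := h1 _ (mem_head _ _); rewrite big_cons => h2.
apply: le_trans (h2 _); first by rewrite lerD2r lerDr exprn_ge0 ?normc_ge0.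
by move=> e; rewrite inE => /orP[/eqP ->//|/FB].
Qed.

(** The equality case of Minkowski's inequality. If [|th e|^p < X e] for one [e], then [diag_gap]
    gives [pn x < pn x]. So for every [e] both the triangle inequality and [pow_add_le] are
    equalities, and strict convexity yields [al e / D = be e / E]. *)
Lemma ang_split B th u v w x D E : unitary u -> unitary v -> unitary w ->
  orthonormal_basis ip B -> diagi B th x ->
  (forall e, B e -> `|th e| <= pi) -> v = u \o opexp x ->
  ang_bound u w D -> ang_bound w v E -> D + E = pn x -> 0 < pn x ->
  forall e, B e -> ang (u e) (w e) = D / pn x * `|th e| /\
                   ang (w e) (v e) = E / pn x * `|th e|.
Proof.
move=> Uu Uv Uw bB dx thpi vE [D0 hD] [E0 hE] DE l0.
have n1 z e : unitary z -> B e -> nr (z e) = 1.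
  by move=> Uz Be; rewrite (unitary_nr _ Uz) (basis_nr bB Be).
have uvE e : B e -> ang (u e) (v e) = `|th e|.
  by move=> Be; rewrite vE; exact: (ang_opexp Uu bB dx (thpi e Be) Be).
have z0 z z' e : unitary z -> unitary z' -> B e ->
    (forall F, ons F -> \sum_(e <- F) ang (z e) (z' e) ^+ p <= 0 ^+ p) -> z e = z' e.
  move=> Uz Uz' Be h; have z1 := n1 z e Uz Be; have z1' := n1 z' e Uz' Be.
  apply: (ang_eq0 z1 z1'); have /andP[a0 _] := ang_itv z1 z1'.
  have := h [:: e] (ons1 (basis_nr bB Be)).
  rewrite big_seq1 ler_pexp// => a0'.
  by apply/eqP; rewrite eq_le a0' a0.
have ln : pn x != 0 by rewrite gt_eqF.
(* If [D] or [E] is 0, then [w] agrees with [u] or [v] on [B]; otherwise division by both is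
   possible. *)
have [Dz|Dn] := eqVneq D 0.
  move=> e Be; rewrite Dz in hD DE; rewrite add0r in DE; have uw := z0 u w e Uu Uw Be hD.
  by rewrite Dz mul0r mul0r -uw uvE// ang_refl ?n1// DE divff// mul1r.
have [Ez|En] := eqVneq E 0.
  move=> e Be; rewrite Ez in hE DE; rewrite addr0 in DE; have wv := z0 w v e Uw Uv Be hE.
  by rewrite Ez mul0r mul0r wv uvE// ang_refl ?n1// DE divff// mul1r.
have Dp : 0 < D by rewrite lt_def Dn.
have Ep : 0 < E by rewrite lt_def En.
pose al e := ang (u e) (w e); pose be e := ang (w e) (v e).
have al0 e : B e -> 0 <= al e.
  by move=> Be; have /andP[] := ang_itv (n1 u e Uu Be) (n1 w e Uw Be).
have be0 e : B e -> 0 <= be e.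
  by move=> Be; have /andP[] := ang_itv (n1 w e Uw Be) (n1 v e Uv Be).
pose X e := pn x ^+ p * (D / pn x * (al e ^+ p / D ^+ p) + E / pn x * (be e ^+ p / E ^+ p)).
have tri e : B e -> `|th e| <= al e + be e.
  by move=> Be; rewrite -uvE//; apply: ang_triangle; exact: n1.
have h1 e : B e -> `|th e| ^+ p <= (al e + be e) ^+ p.
  by move=> Be; rewrite ler_pexp ?addr_ge0 ?al0 ?be0// tri.
have h2 e : B e -> (al e + be e) ^+ p <= X e.
  by move=> Be; have := pow_add_le p Dp Ep (al0 e Be) (be0 e Be); rewrite DE.
have sumX F : uniq F -> {in F, forall e, B e} -> \sum_(e <- F) X e <= pn x ^+ p.
  move=> uF FB; have oF := ons_of_set bB.1 uF FB.
  rewrite -mulr_sumr ler_piMr ?exprn_ge0 ?pn_ge0// big_split/= -!mulr_sumr -!mulr_suml.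
  have q1 : (\sum_(e <- F) al e ^+ p) / D ^+ p <= 1.
    by rewrite ler_pdivrMr ?exprn_gt0// mul1r; exact: hD.
  have q2 : (\sum_(e <- F) be e ^+ p) / E ^+ p <= 1.
    by rewrite ler_pdivrMr ?exprn_gt0// mul1r; exact: hE.
  have -> : 1 = D / pn x * 1 + E / pn x * 1 by rewrite !mulr1 -mulrDl DE divff.
  by rewrite lerD// ler_wpM2l// divr_ge0// pn_ge0.
have eqX e : B e -> `|th e| ^+ p = X e.
  move=> Be; apply/eqP; rewrite eq_le (le_trans (h1 e Be) (h2 e Be))/= leNgt.
  apply/negP => lt; have d0 : 0 < X e - `|th e| ^+ p by rewrite subr_gt0.
  suff : pn x < pn x by rewrite ltxx.
  apply: (diag_gap bB dx Be d0 (pn_ge0 _)) => F uF FB eF.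
  rewrite (le_trans _ (sumX F uF FB))// -[`|th e|](normc_imag (th e)).
  apply: (sum_gap eF) => i /FB Bi.
  by rewrite normc_imag (le_trans (h1 i Bi))// h2.
move=> e Be; have aE := al0 e Be; have bE := be0 e Be.
have e1 : (al e + be e) ^+ p = X e.
  by apply/eqP; rewrite eq_le h2//= -eqX// h1.
have e2 : al e + be e = `|th e|.
  apply/eqP; rewrite eq_le tri// andbT -ler_pexp ?addr_ge0// e1.
  by rewrite (eqX e Be).
have xy : al e / D = be e / E.
  apply: (@pow_convex_eq (D / pn x) (E / pn x) _ _ p./2);
    rewrite ?half_p_gt0 ?divr_gt0// ?divr_ge0// ?half_p//.
    by rewrite -mulrDl DE divff.
  have -> : D / pn x * (al e / D) + E / pn x * (be e / E) = (al e + be e) / pn x.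
    by field; rewrite ?ln ?Dn ?En.
  rewrite !expr_div_n e1 /X; field.
  by rewrite !expf_neq0 ?ln.
have bE2 : be e = E / D * al e by rewrite -[LHS](divfK En) -xy; field; rewrite ?Dn.
rewrite -/(al e) -/(be e) -e2 -DE bE2; split; field.
all: by rewrite ?Dn ?En ?DE ?ln.
Qed.

Lemma opnorm_diag_lt B th x (K : R) : orthonormal_basis ip B ->
  diagi B th x -> (opnorm x < K%:E)%E ->
  forall e, B e -> `|th e| < K.
Proof.
move=> bB dx xK e Be; have := opnorm_lt xK (y := e).
by rewrite (basis_nr bB Be) dx.2// nrZ (basis_nr bB Be) mulr1
  normc_imag; exact.
Qed.

Lemma shortest_geodesic u x : Up u -> schatten_ah ip p x ->
  (opnorm x <= pi%:E)%E -> shortest_curve ip p (geodesic_curve u x).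
Proof.
move=> Uu Sx xpi; have [B [th [bB dx]]] := skew_spectral Sx.
have thpi := (opnorm_diag_le bB (pi_ge0 R) dx).1 xpi.
have [cg g0 g1] := joins_geodesic Uu Sx; split; first exact: cg.
move=> t0 t1 g; rewrite g0 g1 (plength_geodesic Uu Sx).
have /UpP[Uun _] := Uu.
exact: (pn_le_plength Uun bB dx thpi).
Qed.

Lemma arcfun_continuous (D : R -> R -> R) f a b A : arcfun D f a b A ->
  {within `[a, b], continuous A}.
Proof.
move=> [_ _ lip _]; apply/subspace_continuousP => t /= tI.
have [K [d [d0 K0 dP]]] : exists K d, [/\ 0 < d, 0 <= K &
     forall s, a <= s <= b -> `|s - t| < d -> `|A s - A t| <= K * `|s - t|].
  by apply: lip; move: tI; rewrite in_itv.
have K1 : 0 < K + 1 by rewrite ltr_wpDl.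
apply/cvgrPdist_le => e e0; rewrite near_withinE.
apply/nbhs_ballP; exists (Num.min d (e / (K + 1))).
  by rewrite /= lt_min d0 divr_gt0.
move=> s; rewrite /ball/= lt_min ltr_pdivlMr// distrC => /andP[sd se].
rewrite in_itv/= => sI; rewrite distrC (le_trans (dP s sI sd))//.
rewrite (le_trans _ (ltW se))// mulrC ler_wpM2l// lerDl//.
Qed.

Lemma shortest_unique u x g : Up u -> schatten_ah ip p x ->
  (opnorm x < pi%:E)%E ->
  joins ip p (geodesic_curve u x 0) (geodesic_curve u x 1) 0 1 g ->
  shortest_curve ip p g -> reparametrization g (geodesic_curve u x).
Proof.
move=> Uu Sx xpi; have [B [th [bB dx]]] := skew_spectral Sx.
have thlt := opnorm_diag_lt bB dx xpi.
have thpi e : B e -> `|th e| <= pi by move=> Be; rewrite ltW// thlt.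
have [cx x0 x1] := joins_geodesic Uu Sx.
rewrite x0 x1 => -[cg g0 g1] [_ gmin].
have /UpP[Uun _] := Uu.
have [A [hA gA]] := arc_length cg.
have AE : A 1 - A 0 = pn x.
  have h1 : (plength ip p 0 1 g <= plength ip p 0 1 (geodesic_curve u x))%E.
    by apply: gmin; rewrite g0 g1; exact: (And3 cx x0 x1).
  have h2 := pn_le_plength Uun bB dx thpi (And3 cg g0 g1).
  move: h1 h2; rewrite (plength_geodesic Uu Sx) gA !lee_fin => h1 h2.
  by apply/eqP; rewrite eq_le h1.
have [_ mA _ _] := hA.
have Ug t : 0 <= t <= 1 -> unitary (g t).
  by move=> tI; have [_ /(_ t) h _] := cg; rewrite in_itv/= in h; have /UpP[] := h tI.
(* Zero length makes both curves constant; arc length cannot be normalized then, and [id] is the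
   reparametrization. *)
have [l0|l_neq0] := eqVneq (pn x) 0.
  have const h f Ah : Up_curve ip p 0 1 h -> h 0 = u ->
      arcfun (fun s t => pn (h s - h t)) f 0 1 Ah -> Ah 1 - Ah 0 = 0 ->
      forall t, 0 <= t <= 1 -> h t = u.
    move=> ch h0 hAh Ah0 t /andP[t0 t1].
    have := curve_chord ch hAh (lexx _) t0 t1; rewrite h0 => hh.
    have [_ mAh _ _] := hAh; have h2 := mAh t 1 t0 t1 (lexx _).
    have st : schatten (h t - u).
      rewrite -h0; apply: (Up_curve_schatten ch).
        by rewrite t0.
      by rewrite lexx ler01.
    apply/eqP; rewrite -subr_eq0; apply/eqP.
    apply: (pn_eq0 st); apply/eqP.
    by rewrite eq_le pn_ge0 andbT; lra.
  have [A' [hA']] := arc_length cx.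
  rewrite (plength_geodesic Uu Sx) => -[A'E].
  have A'0 : A' 1 - A' 0 = 0 by rewrite -A'E.
  have A0 : A 1 - A 0 = 0 by rewrite AE.
  exists id; split.
  - by apply: continuous_subspaceT => t; exact: cvg_id.
  - by [].
  - by rewrite image_id.
  - move=> t; rewrite in_itv/= => tI.
    by rewrite (const _ _ _ cg g0 hA A0 t tI) (const _ _ _ cx x0 hA' A'0 t tI).
have lp : 0 < pn x by rewrite lt_def l_neq0 pn_ge0.
(* Arc length of [g] divided by its total length, since the geodesic has constant speed. *)
pose phi t := (A t - A 0) / pn x.
have phi_cont : {within `[0, 1], continuous phi}.
  have cA := arcfun_continuous hA.
  move=> t; apply: cvgM; last exact: cvg_cst.
  by apply: cvgB; [exact: cA|exact: cvg_cst].
have phi01 t : 0 <= t <= 1 -> 0 <= phi t <= 1.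
  move=> /andP[t0 t1]; have m1 := mA 0 t (lexx _) t0 t1.
  have m2 := mA t 1 t0 t1 (lexx _).
  rewrite /phi divr_ge0 ?subr_ge0 ?pn_ge0//= ler_pdivrMr// mul1r -AE.
  by rewrite lerD2r.
have phi0 : phi 0 = 0 by rewrite /phi subrr mul0r.
have phi1 : phi 1 = 1 by rewrite /phi AE divff.
exists phi; split => //.
- move=> s t; rewrite !in_itv/= => /andP[s0 s1] /andP[t0 t1] st.
  by rewrite ler_pM2r ?invr_gt0// lerD2r mA.
- apply/seteqP; split=> [_ [t tI <-]|r].
    by move: tI; rewrite /= !in_itv/=; exact: phi01.
  rewrite /= in_itv/= => rI.
  have [|t tI tr] := IVT ler01 phi_cont (v := r).
    by rewrite phi0 phi1 min_l ?max_r.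
  by exists t.
move=> t; rewrite in_itv/= => tI; have /andP[t0 t1] := tI.
have Uw := Ug t tI.
have Uv : unitary (u \o opexp x) by rewrite -g1; apply: Ug; rewrite ler01 lexx.
have b1 : ang_bound u (g t) (A t - A 0).
  split => [|F oF]; first by rewrite subr_ge0 mA.
  by have := curve_ang_sum cg hA (lexx _) t0 t1 oF; rewrite g0.
have b2 : ang_bound (g t) (u \o opexp x) (A 1 - A t).
  split => [|F oF]; first by rewrite subr_ge0 mA.
  by have := curve_ang_sum cg hA t0 t1 (lexx _) oF; rewrite g1.
have sE : A t - A 0 + (A 1 - A t) = pn x by rewrite -AE; ring.
have split := ang_split Uun Uv Uw bB dx thpi erefl b1 b2 sE lp.
have dE := diag_opexp (phi t) bB dx.
have d1 := diag_opexp 1 bB dx; rewrite opexp1 in d1.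
apply/funext => y; apply/eqP; rewrite -subr_eq0; apply/eqP.
have bu := unitary_bop Uun.
(* [ang_split] places [g t e] at the same fraction [phi t] of the angle for every [e];
   [slerp_unique] then uses [|th e| < pi]. *)
have ge e : B e -> g t e = u (cis (phi t * th e) *: e).
  move=> Be; have [a1 a2] := split e Be; rewrite (bopZ bu).
  have n1 := basis_nr bB Be.
  apply: (slerp_unique _ _ (thlt e Be) (phi01 t tI)).
  - by rewrite (unitary_nr _ Uun).
  - by rewrite (unitary_nr _ Uw).
  - by rewrite a1.
  - rewrite -(bopZ bu); move: a2; rewrite /= d1.2// mul1r => ->.
    by congr (_ * _); rewrite /phi -sE; field; rewrite sE.
have dw : diag B (fun e => cis (phi t * th e)) (adjoint ip u \o g t).
  split; first by apply: bop_comp; [exact: (bop_adj bu)|exact: (unitary_bop Uw)].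
  by move=> e Be /=; rewrite ge//; have /unitaryP[_ -> _] := Uun.
have := diag_uniq bB dw dE (fun e _ => erefl).
move=> /(congr1 (fun f => u (f y))) /=; have /unitaryP[_ _ ->] := Uun.
by rewrite /geodesic_curve /= => ->; rewrite subrr.
Qed.

Lemma minimal_geodesic_exists u v : Up u -> Up v ->
  exists g, [/\ minimal_geodesic ip p g, g 0 = u & g 1 = v].
Proof.
move=> Uu Uv; have [x [B [th [bB dx Sx thpi vE]]]] := Up_log2 Uu Uv.
have [cg g0 g1] := joins_geodesic Uu Sx.
exists (geodesic_curve u x); split; [|exact: g0|by rewrite g1].
split; first by exists u, x.
rewrite g0 g1 (plength_geodesic Uu Sx).
by rewrite (pdist_opexp Uu Sx bB dx thpi).
Qed.

(** Each eigenvalue beyond [pi] in modulus is reduced modulo [2 pi] to [[-pi, pi]], which keeps the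
    exponential. *)
Lemma reduce_log B th x : schatten_ah ip p x -> orthonormal_basis ip B ->
  diagi B th x -> exists y th',
  [/\ schatten_ah ip p y, diagi B th' y, opexp y = opexp x &
      forall e, B e -> `|th' e| <= pi /\ (`|th' e| < `|th e| \/ th' e = th e)].
Proof.
move=> [sx _] bB dx.
have ex e : exists r, [/\ cis r = cis (th e), `|r| <= pi & `|r| < `|th e| \/ r = th e].
  have [h|h] := leP `|th e| pi; first by exists (th e); split => //; right.
  have [r [rpi rE]] := cis_arg (normc_cis (th e)).
  by exists r; split => //; left; exact: le_lt_trans h.
have [th' th'P] := choice ex.
have [y dy] : exists y, diagi B th' y.
  apply: (diag_exists bB (pi_ge0 R)) => e _; rewrite normc_imag.
  by have [] := th'P e.
have [|sy _] := diag_pn_dom bB ler01 dy dx sx.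
  move=> e _; rewrite mul1r !normc_imag.
  by have [_ _ [/ltW|->]] := th'P e.
exists y, th'; split => //.
- by split => //; exact: (diag_skew bB dy).
- have d1 := diag_opexp 1 bB dx; have d2 := diag_opexp 1 bB dy.
  rewrite !opexp1 in d1 d2; apply: (diag_uniq bB d2 d1) => e _.
  by rewrite !mul1r; have [] := th'P e.
- by move=> e _; have [] := th'P e.
Qed.

(** The reduced logarithm has the same end point, and its norm is the distance, hence [pn x].
    Lowering even one eigenvalue would make that norm strictly smaller, by [diag_gap]. *)
Lemma minimal_log_bound u x : Up u -> schatten_ah ip p x ->
  (pn x)%:E = pdist u (u \o opexp x) ->
  exists B th, [/\ orthonormal_basis ip B, diagi B th x &
    forall e, B e -> `|th e| <= pi].
Proof.
move=> Uu Sx xE; have [B [th [bB dx]]] := skew_spectral Sx.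
have [y [th' [Sy dy yx thP]]] := reduce_log Sx bB dx.
have th'pi e : B e -> `|th' e| <= pi by move=> /thP[].
have xy : pn x = pn y.
  apply: (@EFin_inj R); rewrite xE -yx.
  exact: (pdist_opexp Uu Sy bB dy th'pi).
exists B, th; split => // e0 Be0; have [h [lt|<-]] := thP e0 Be0; last exact: h.
suff : pn y < pn x by rewrite xy ltxx.
have sx : schatten x by case: Sx.
apply: (diag_gap bB dy Be0 (d := `|th e0| ^+ p - `|th' e0| ^+ p)).
- by rewrite subr_gt0 ltrXn2r ?nnegrE// ?gtn_eqF.
- exact: pn_ge0.
move=> F uF FB e0F.
rewrite (le_trans _ (diag_pn_sum bB dx sx uF FB))//.
rewrite -!normc_imag.
apply: (sum_gap (f := fun e => normc ((th' e) *i) ^+ p)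
  (g := fun e => normc ((th e) *i) ^+ p) e0F) => e /FB Be.
rewrite !normc_imag ler_pexp//.
by have [_ [/ltW|->]] := thP e Be.
Qed.

(** An eigenvalue of modulus [pi] would send its unit eigenvector under [u] and [u \o opexp x] to
    opposite points, at distance 2. *)
Lemma minimal_log_lt u x : Up u -> schatten_ah ip p x ->
  (pn x)%:E = pdist u (u \o opexp x) ->
  (opnorm ((u - (u \o opexp x))%R) < 2%:E)%E ->
  exists B th, [/\ orthonormal_basis ip B, diagi B th x &
    forall e, B e -> `|th e| < pi].
Proof.
move=> Uu Sx xE u2; have [B [th [bB dx thpi]]] := minimal_log_bound Uu Sx xE.
exists B, th; split => // e Be; rewrite lt_neqAle thpi// andbT.
apply/eqP => thE; have /UpP[Uun _] := Uu; have n1 := basis_nr bB Be.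
have := opnorm_lt u2 (y := e); rewrite n1 => /(_ (lexx _)).
rewrite opsubE /= -(bopB (unitary_bop Uun)) (unitary_nr _ Uun).
have d1 := diag_opexp 1 bB dx; rewrite opexp1 in d1; rewrite d1.2// mul1r.
rewrite -[X in X - _]scale1r -scalerBl nrZ n1 mulr1 -opprB.
have -> : normc (- (cis (th e) - 1)) = 2; last by rewrite ltxx.
apply/eqP; rewrite -(@eqrXn2 _ 2) ?normc_ge0// normcN.
by rewrite normc_cis_sub1 -cos_norm thE cospi; apply/eqP; ring.
Qed.

(** The eigenbases of [x] and [y] may differ. If [e] in [B] and [f] in [C] are not orthogonal, their
    eigenvalues for the common exponential agree, so [th e = ph f] by [cis_inj]; hence [y] acts on
    [e] as [x] does. *)
Lemma log_unique B C th ph x y : orthonormal_basis ip B -> orthonormal_basis ip C ->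
  diagi B th x -> diagi C ph y ->
  (forall e, B e -> `|th e| < pi) -> (forall e, C e -> `|ph e| < pi) ->
  opexp x = opexp y -> x = y.
Proof.
move=> bB bC dx dy thpi phpi xy.
have d1 := diag_opexp 1 bB dx; have d2 := diag_opexp 1 bC dy.
rewrite !opexp1 xy in d1 d2.
have dB : diagi B th y.
  split; first exact: dy.1.
  move=> e Be; apply: (basis_ext bC) => f Cf.
  rewrite (diag_ip bC e dy Cf) ipZl.
  have [->|ef] := eqVneq (ip e f) 0; first by rewrite !mulr0.
  congr (_ * _); congr (_ *i).
  apply: cis_inj (phpi f Cf) (thpi e Be) _.
  apply: (mulIf ef); have := diag_ip bC e d2 Cf; rewrite mul1r => <-.
  by rewrite d1.2// ipZl mul1r.
by apply: (diag_uniq bB dx dB).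
Qed.

Lemma minimal_geodesic_unique u v g h : Up u -> Up v ->
  (opnorm (u - v)%R < 2%:E)%E ->
  [/\ minimal_geodesic ip p g, g 0 = u & g 1 = v] ->
  [/\ minimal_geodesic ip p h, h 0 = u & h 1 = v] -> g = h.
Proof.
move=> Uu Uv uv.
have main k : [/\ minimal_geodesic ip p k, k 0 = u & k 1 = v] ->
    exists x B th, [/\ k = geodesic_curve u x, orthonormal_basis ip B,
      diagi B th x, forall e, B e -> `|th e| < pi & v = u \o opexp x].
  move=> [[[u' [x [Uu' Sx kE]]] kmin] k0 k1].
  have [_ x0 x1] := joins_geodesic Uu' Sx.
  have u'E : u' = u by rewrite -k0 kE x0.
  rewrite u'E in Uu' kE x0 x1; rewrite k0 k1 kE in kmin.
  have vE : v = u \o opexp x by rewrite -k1 kE x1.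
  have xE : (pn x)%:E = pdist u (u \o opexp x).
    by rewrite -vE -kmin (plength_geodesic Uu' Sx).
  rewrite vE in uv; have [B [th [bB dx thpi]]] := minimal_log_lt Uu Sx xE uv.
  by exists x, B, th.
move=> /main[x [B [th [-> bB dx thpi vx]]]] /main[y [C [ph [-> bC dy phpi vy]]]].
congr geodesic_curve; apply: (log_unique bB bC dx dy thpi phpi).
have /UpP[/unitaryP[_ hu _] _] := Uu.
apply/funext => z; rewrite -(hu (opexp x z)) -(hu (opexp y z)).
by have := congr1 (fun f => adjoint ip u (f z)) (etrans (esym vx) vy).
Qed.

End Uniqueness.

(** * Minimal geodesics of arbitrary length *)

Section Diameter.
Hypothesis H_inf : infinite_dimensional H.
Notation hbasis := (hbasis ip).

(** If a finite [F] exhausted the basis, the expansions along [F] would make [H] finite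
    dimensional. *)
Lemma hbasis_large n : exists F : seq H,
  [/\ uniq F, {in F, forall e, hbasis e} & size F = n].
Proof.
elim: n => [|n [F [uF FB sF]]]; first by exists [::].
have [[e [Be eF]]|no] := pselect (exists e, hbasis e /\ e \notin F).
  exists (e :: F); split; rewrite /= ?eF ?sF// => f.
  by rewrite inE => /orP[/eqP ->//|/FB].
exfalso; apply: H_inf; exists (size F), (tnth (in_tuple F)) => v.
exists (fun i => ip v (tnth (in_tuple F) i)).
rewrite -(big_tnth _ _ F xpredT (fun f => ip v f *: f)).
apply/eqP; rewrite -subr_eq0; apply/eqP.
apply: hbasisP.2 => e Be; have eF : e \in F.
  by apply/negPn/negP => eF; apply: no; exists e.
exact: (pr_orth _ (ons_of_set hbasisP.1 uF FB) eF).
Qed.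

Lemma Up_id : Up idfun.
Proof.
apply/UpP; rewrite subrr; split; last exact: schatten0.
have bH := hbasisP.
apply: (diag_unitary (t := fun=> 0) bH).
by apply: (diag_ext (diag_id _)) => e _; rewrite cis0.
Qed.

(** The eigenvalue [l / m] on [m^p] basis vectors gives the norm [(m^p (l / m)^p)^(1/p) = l], and
    [m > l / pi] keeps it below [pi]. *)
Lemma skew_of_norm (l : R) : 0 <= l -> exists x th,
  [/\ schatten_ah ip p x, diagi hbasis th x,
      forall e, hbasis e -> `|th e| <= pi & pn x = l].
Proof.
move=> l0; have bH := hbasisP; have pi0 := pi_gt0 R.
have := archi_boundP (divr_ge0 l0 (ltW pi0)); set m := Num.bound _ => lm.
have m0 : 0 < m%:R :> R by rewrite (le_lt_trans _ lm)// divr_ge0// ltW.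
pose s := l / m%:R.
have s0 : 0 <= s by rewrite divr_ge0// ltW.
have spi : s <= pi by move: lm; rewrite ltr_pdivrMr// ler_pdivrMr// mulrC => /ltW.
have [F [uF FB sF]] := hbasis_large (m ^ p).
pose th e : R := if e \in F then s else 0.
have thpi e : hbasis e -> `|th e| <= pi.
  by move=> _; rewrite /th; case: ifP => _; rewrite ?normr0 ?ger0_norm// ltW.
have [x dx] : exists x, diagi hbasis th x.
  by apply: (diag_exists bH (pi_ge0 R)) => e /thpi; rewrite normc_imag.
have sn : s ^+ p *+ (m ^ p) = l ^+ p.
  rewrite -mulr_natr natrX -exprMn /s divfK//.
  by rewrite gt_eqF.
have xl : pball x l.
  apply: (diag_pball bH dx l0) => G uG _.
  rewrite (eq_bigr (fun e => if e \in F then s ^+ p else 0)); last first.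
    move=> e _; rewrite normc_imag /th; case: ifP => _; rewrite ?ger0_norm//.
    by rewrite expr0n gtn_eqF.
  rewrite -big_mkcond/= -big_filter big_const_seq count_predT iter_addr addr0 -sn.
  rewrite -!(mulr_natr (s ^+ p)) ler_wpM2l ?exprn_ge0// ler_nat -sF.
  apply: uniq_leq_size; first exact: filter_uniq.
  by move=> e; rewrite mem_filter => /andP[].
have sx := pball_schatten xl.
exists x, th; split => //; first by split => //; exact: (diag_skew bH dx).
apply/eqP; rewrite eq_le (pn_le xl)/= -ler_pexp ?pn_ge0//.
rewrite -sn -sF (le_trans _ (diag_pn_sum bH dx sx uF FB))//.
rewrite big_seq (eq_bigr (fun=> s ^+ p)); last first.
  by move=> e eF; rewrite normc_imag /th eF ger0_norm.
by rewrite -big_seq big_const_seq count_predT iter_addr addr0.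
Qed.

Lemma minimal_geodesic_of_length (l : R) : 0 <= l ->
  exists g, minimal_geodesic ip p g /\ plength ip p 0 1 g = l%:E.
Proof.
move=> l0; have [x [th [Sx dx thpi xl]]] := skew_of_norm l0.
have [cg g0 g1] := joins_geodesic Up_id Sx.
have gl := plength_geodesic Up_id Sx.
exists (geodesic_curve idfun x); split; last by rewrite gl xl.
split; first by exists idfun, x; split => //; exact: Up_id.
rewrite g0 g1 gl.
by rewrite (pdist_opexp Up_id Sx hbasisP dx thpi).
Qed.

Lemma Up_diameter :
  ereal_sup [set pdist uv.1 uv.2 | uv in Up `*` Up] = +oo%E.
Proof.
apply/eqyP => l l0; have [x [th [Sx dx thpi xl]]] := skew_of_norm (ltW l0).
have [cg _ g1] := joins_geodesic Up_id Sx.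
apply: ereal_sup_ubound; exists (idfun, idfun \o opexp x) => /=.
  split; first exact: Up_id.
  by rewrite -g1; apply: geodesic_curve_Up => //; exact: Up_id.
by rewrite (pdist_opexp Up_id Sx hbasisP dx thpi) xl.
Qed.

End Diameter.

End HilbertSpace.

Theorem theorem3p2 (R : realType) (H : completeNormedModType R[i])
    (ip : {dot H for Num.conj})
    (ip_norm : forall v : H, ip v v = `|v| ^+ 2)
    (H_inf : infinite_dimensional H)
    (p : nat) (p_gt0 : (0 < p)%N) (p_even : ~~ odd p) :
  [/\ (* 1 *)
      forall u x : H -> H, Up ip p u -> schatten_ah ip p x ->
        (opnorm x <= pi%:E)%E ->
        shortest_curve ip p (geodesic_curve u x) /\
        ((opnorm x < pi%:E)%E ->
          forall g, joins ip p (geodesic_curve u x 0) (geodesic_curve u x 1)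
                          0 1 g ->
            shortest_curve ip p g -> reparametrization g (geodesic_curve u x)),
      (* 2 *)
      forall u0 u1 : H -> H, Up ip p u0 -> Up ip p u1 ->
        (exists g, [/\ minimal_geodesic ip p g, g 0 = u0 & g 1 = u1]) /\
        ((opnorm (u0 - u1)%R < 2%:E)%E ->
          forall g h,
            [/\ minimal_geodesic ip p g, g 0 = u0 & g 1 = u1] ->
            [/\ minimal_geodesic ip p h, h 0 = u0 & h 1 = u1] ->
            forall t, t \in `[0, 1] -> g t = h t),
      (* 3 *)
      (forall l : R, 0 <= l ->
        exists g, minimal_geodesic ip p g /\ plength ip p 0 1 g = l%:E) /\
      ereal_sup [set pdist ip p uv.1 uv.2 | uv in Up ip p `*` Up ip p] = +oo%E &
      (* 4 *)
      (forall u v : H -> H, Up ip p u -> Up ip p v ->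
        ((Num.sqrt (1 - pi ^+ 2 / 12))%:E * pdist ip p u v
           <= pnorm ip p (u - v)%R)%E /\
        (pnorm ip p (u - v)%R <= pdist ip p u v)%E) /\
      metric_on (Up ip p) (pdist ip p) /\ complete_on (Up ip p) (pdist ip p)].
Proof.
split.
- move=> u x Uu Sx xpi; split; first exact: (shortest_geodesic ip_norm p_gt0 p_even).
  by move=> xlt g jg sg; exact: (shortest_unique ip_norm p_gt0 p_even Uu Sx xlt jg sg).
- move=> u0 u1 U0 U1; split.
    exact: (minimal_geodesic_exists ip_norm p_gt0 p_even).
  move=> u2 g h hg hh t _.
  by rewrite (minimal_geodesic_unique ip_norm p_gt0 p_even U0 U1 u2 hg hh).
- split; first exact: (minimal_geodesic_of_length ip_norm p_gt0 p_even H_inf).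
  exact: (Up_diameter ip_norm p_gt0 p_even H_inf).
- split; first by move=> u v Uu Uv; exact: (pdist_pn_bounds ip_norm p_gt0 p_even).
  split; first exact: (pdist_metric ip_norm p_gt0 p_even).
  exact: (pdist_complete ip_norm p_gt0 p_even).
Qed.
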